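(* Let $C\subset\mathbb{R}^2$ be a smooth tropical plane quartic curve. Then $C$ is non-hyperelliptic; that is, the skeleton $\Gamma$ of $C$, viewed as a metric graph, has no divisor of degree $2$ and rank $1$.
   Context: **Plane tropical curves.** A plane tropical curve is a planar graph $C\subset\mathbb{R}^2$ with straight edges (some unbounded), together with positive integer weights on the edges, such that each edge has rational slope and, at each vertex, the weighted sum of the primitive integral vectors of the outgoing edge directions is zero. It is smooth of degree $d$ if it is dual to a unimodular triangulation of the triangle $T$ with vertices $(0,0),(d,0),(0,d)$, i.e. a subdivision of $T$ into $d^2$ lattice triangles of area $\tfrac12$. Dual means: vertices of $C$ correspond to triangles, edges of $C$ to orthogonal edges of the triangulation, unbounded edges to edges on the boundary of $T$, and complementary regions to lattice points; $C$ then has all weights $1$ and $d$ unbounded edges in each of the directions $(1,1),(-1,0),(0,-1)$. A smooth tropical plane quartic curve is a smooth plane tropical curve of degree $4$. **Skeleton and metric.** The skeleton of $C$ is the subgraph obtained by (repeatedly) contracting all leaf edges, including unbounded edges. It is a metric graph using lattice length: a segment with primitive integral direction vector $u$ has lattice length equal to its Euclidean length divided by $|u|$. **Divisors.** A divisor on a metric graph $\Gamma$ is a finite formal sum $D=\sum a_i\cdot p_i$ of points of $\Gamma$ with integer coefficients; its degree is $\sum a_i$, and it is effective if all $a_i\ge0$. A rational function on $\Gamma$ is a continuous piecewise linear function with integer slopes; $\operatorname{div}(f)$ is the divisor whose coefficient at $p$ is the sum of the outgoing slopes of $f$ at $p$. Divisors $D,D'$ are linearly equivalent if $D-D'=\operatorname{div}(f)$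 for some rational function $f$. A divisor $D$ has rank $r$ if $r$ is the largest integer such that for every effective divisor $E$ of degree $r$ the divisor $D-E$ is linearly equivalent to an effective divisor. A metric graph is hyperelliptic if it has a divisor of degree $2$ and rank $1$. *)

(* Defs.v *)
From HB Require Import structures.
From mathcomp Require Import all_boot all_order all_algebra.
From mathcomp Require Import all_classical all_reals all_analysis.
From mathcomp Require Import freeg.

Set Implicit Arguments.
Unset Strict Implicit.
Unset Printing Implicit Defensive.

Import Order.TTheory GRing.Theory Num.Theory numFieldNormedType.Exports.

Local Open Scope classical_set_scope.
Local Open Scope ring_scope.

(* Finite multigraph with positive edge lengths; the orientation src -> tgt is
   only a choice of parametrization of each edge e by [0, mg_len e]. *)
Record metric_graph (R : realType) := MetricGraph {
  mg_vertex : finType;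
  mg_edge : finType;
  mg_src : mg_edge -> mg_vertex;
  mg_tgt : mg_edge -> mg_vertex;
  mg_len : mg_edge -> R;
  mg_len_gt0 : forall e, 0 < mg_len e }.

Section MetricGraph.
Context {R : realType} (G : metric_graph R).

(* inl v is a vertex; inr (e, t) is the point of the open edge e at distance t
   from its source. *)
Definition mg_point : Type :=
  (mg_vertex G + {x : mg_edge G * R | 0 < x.2 < mg_len x.1})%type.

HB.instance Definition _ := Choice.on mg_point.

Definition edge_point (e : mg_edge G) (t : R) : mg_point :=
  if insub (e, t) is Some x then inr x
  else inl (if t <= 0 then mg_src e else mg_tgt e).

Definition piecewise_linear_int (l : R) (g : R -> R) : Prop :=
  exists s : seq R, [/\ path <%R 0 s, last 0 s = l
    & forall i, (i < size s)%N -> exists m : int,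
        forall t, nth 0 (0 :: s) i <= t <= nth 0 s i ->
          g t = g (nth 0 (0 :: s) i) + m%:~R * (t - nth 0 (0 :: s) i)].

(* Continuity is built in: consecutive linear pieces share an endpoint, and
   f \o edge_point e takes the values of f at the end vertices of e. *)
Definition rational_function (f : mg_point -> R) : Prop :=
  forall e, piecewise_linear_int (mg_len e) (f \o edge_point e).

(* The slope of h immediately to the right of 0 (0 if there is none). *)
Definition germ_slope (h : R -> R) : int :=
  xget 0 [set m : int | exists2 eps, 0 < eps &
    forall t, 0 <= t <= eps -> h t = h 0 + m%:~R * t].

Definition slope_fwd (f : mg_point -> R) (e : mg_edge G) (t : R) : int :=
  germ_slope (fun s => f (edge_point e (t + s))).

Definition slope_bwd (f : mg_point -> R) (e : mg_edge G) (t : R) : int :=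
  germ_slope (fun s => f (edge_point e (t - s))).

Definition div_coeff (f : mg_point -> R) (p : mg_point) : int :=
  match p with
  | inl v => \sum_(e | mg_src e == v) slope_fwd f e 0
             + \sum_(e | mg_tgt e == v) slope_bwd f e (mg_len e)
  | inr x => slope_fwd f (val x).1 (val x).2 + slope_bwd f (val x).1 (val x).2
  end.

Local Notation divisor := {freeg mg_point / int}.

Definition effective (D : divisor) : Prop :=
  forall p, 0 <= coeff p D.

Definition lin_equiv (D D' : divisor) : Prop :=
  exists2 f, rational_function f & forall p, coeff p (D - D') = div_coeff f p.

Definition rank_at_least (D : divisor) (r : int) : Prop :=
  forall E : divisor, effective E -> deg E = r ->
    exists2 D' : divisor, effective D' & lin_equiv (D - E) D'.

Definition has_rank (D : divisor) (r : int) : Prop :=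
  rank_at_least D r /\ forall r' : int, rank_at_least D r' -> r' <= r.

Definition hyperelliptic : Prop :=
  exists2 D : divisor, deg D = 2 & has_rank D 1.

End MetricGraph.

Definition translate {R : realType} (x : R * R) (t : R) (u : int * int) : R * R :=
  (x.1 + t * u.1%:~R, x.2 + t * u.2%:~R).

Definition primitive (u : int * int) : bool := coprimez u.1 u.2.

(* The bounded edge e is the segment from pos (src e) to
   pos (tgt e) = pos (src e) + len e * dir e; as dir e is required to be
   primitive below, len e is the lattice length of e. *)
Record plane_graph (R : realType) := PlaneGraph {
  vertex : finType;
  edge : finType;
  ray : finType;
  pos : vertex -> R * R;
  src : edge -> vertex;
  tgt : edge -> vertex;
  dir : edge -> int * int;
  len : edge -> R;
  weight : edge -> nat;
  base : ray -> vertex;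
  rdir : ray -> int * int;
  rweight : ray -> nat;
  len_gt0 : forall e, 0 < len e;
  pos_tgt : forall e, pos (tgt e) = translate (pos (src e)) (len e) (dir e) }.

Section PlaneGraph.
Context {R : realType} (C : plane_graph R).

Inductive cell := CVertex of vertex C | CEdge of edge C | CRay of ray C.

Definition relint (c : cell) : set (R * R) :=
  match c with
  | CVertex v => [set pos v]
  | CEdge e => [set translate (pos (src e)) t (dir e) | t in [set t | 0 < t < len e]]
  | CRay r => [set translate (pos (base r)) t (rdir r) | t in [set t | 0 < t]]
  end.

Definition curve_support : set (R * R) := \bigcup_c relint c.

Definition balanced_at (v : vertex C) : Prop :=
  \sum_(e | src e == v) dir e *+ weight e
  - \sum_(e | tgt e == v) dir e *+ weight e
  + \sum_(r | base r == v) rdir r *+ rweight r = 0.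

Definition plane_tropical_curve : Prop :=
  [/\ (forall e : edge C, primitive (dir e) /\ (0 < weight e)%N),
      (forall r : ray C, primitive (rdir r) /\ (0 < rweight r)%N),
      trivIset [set: cell] relint
    & forall v, balanced_at v].

(* The bounded edges left when only the vertices in S remain. *)
Definition edges_in (S : {set vertex C}) : {set edge C} :=
  [set e : edge C | (src e \in S) && (tgt e \in S)].

Definition valence_in (S : {set vertex C}) (v : vertex C) : nat :=
  (#|[set e in edges_in S | src e == v]%SET|
   + #|[set e in edges_in S | tgt e == v]%SET|)%N.

(* Contracting a leaf edge amounts to deleting its vertex of valence 1. *)
Definition contract_leaf (S : {set vertex C}) : {set vertex C} :=
  if [pick v in S | valence_in S v == 1%N] is Some v then S :\ v else S.

(* Contracting an unbounded edge does not affect the vertices. At most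
   #|vertex C| further contractions are possible. *)
Definition skeleton_vertices : {set vertex C} :=
  iter #|vertex C| contract_leaf [set: vertex C]%SET.

Lemma skeleton_srcP (e : {e : edge C | e \in edges_in skeleton_vertices}) :
  src (val e) \in skeleton_vertices.
Proof. by case: e => e /=; rewrite inE => /andP[]. Qed.

Lemma skeleton_tgtP (e : {e : edge C | e \in edges_in skeleton_vertices}) :
  tgt (val e) \in skeleton_vertices.
Proof. by case: e => e /=; rewrite inE => /andP[]. Qed.

Definition skeleton : metric_graph R :=
  @MetricGraph R {v : vertex C | v \in skeleton_vertices}
    {e : edge C | e \in edges_in skeleton_vertices}
    (fun e => exist _ (src (val e)) (skeleton_srcP e))
    (fun e => exist _ (tgt (val e)) (skeleton_tgtP e))
    (fun e => len (val e)) (fun e => len_gt0 (val e)).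

End PlaneGraph.

(* The lattice points of the triangle T with vertices (0,0), (d,0), (0,d). *)
Notation lattice_point d := {p : 'I_d.+1 * 'I_d.+1 | (p.1 + p.2 <= d)%N}.

Section Triangulation.
Context (R : realType) (d : nat).
Implicit Types (p q : lattice_point d) (S s : {set lattice_point d}).

Definition coord p : int * int := (((val p).1 : nat)%:Z, ((val p).2 : nat)%:Z).

Definition big_triangle : set (R * R) :=
  [set x | [/\ 0 <= x.1, 0 <= x.2 & x.1 + x.2 <= d%:R]].

Definition hull S : set (R * R) :=
  [set x | exists w : lattice_point d -> R,
    [/\ forall p, 0 <= w p, \sum_(p in S) w p = 1,
        x.1 = \sum_(p in S) w p * (coord p).1%:~R
      & x.2 = \sum_(p in S) w p * (coord p).2%:~R]].

Definition twice_area p q r : int :=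
  `|((coord q).1 - (coord p).1) * ((coord r).2 - (coord p).2)
    - ((coord q).2 - (coord p).2) * ((coord r).1 - (coord p).1)|.

Definition unimodular_triangle S : Prop :=
  exists p q r, S = [set p; q; r]%SET /\ twice_area p q r = 1.

Definition unimodular_triangulation (X : {set {set lattice_point d}}) : Prop :=
  [/\ #|X| = (d ^ 2)%N,
      forall S, S \in X -> unimodular_triangle S,
      \bigcup_(S in [set` X]) hull S = big_triangle
    & forall S S', S \in X -> S' \in X -> hull S `&` hull S' = hull (S :&: S')%SET].

Definition triangulation_edges (X : {set {set lattice_point d}}) :
    {set {set lattice_point d}} :=
  [set s : {set lattice_point d} | (#|s| == 2%N) && [exists S in X, s \subset S]].

Definition on_boundary s : bool :=
  [|| [forall p in s, (coord p).1 == 0], [forall p in s, (coord p).2 == 0]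
    | [forall p in s, (coord p).1 + (coord p).2 == d%:Z]].

Definition dot (u v : int * int) : int := u.1 * v.1 + u.2 * v.2.

(* u is orthogonal to the edge s of the triangle S and points out of S. *)
Definition outward_normal (u : int * int) S s : Prop :=
  [/\ s \subset S,
      forall p q, p \in s -> q \in s -> dot u (coord q - coord p) = 0
    & forall p q, p \in S -> p \notin s -> q \in s -> 0 < dot u (coord q - coord p)].

(* The cells of C, resp. the components of its complement, correspond via
   dual, resp. region, to the positive-dimensional cells of the triangulation,
   resp. the lattice points of T. Among the two orientations compatible with
   orthogonality, the one used is that for which the unbounded edges have
   directions (1,1), (-1,0) and (0,-1): edges leave a vertex along the outward
   normals of the dual triangle. *)
Definition dual_to (C : plane_graph R) (X : {set {set lattice_point d}}) : Prop :=
  exists (dual : cell C -> {set lattice_point d})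
         (region : lattice_point d -> set (R * R)),
  [/\ [/\ injective dual,
          [set dual (CVertex v) | v in [set: vertex C]] = [set` X],
          [set dual (CEdge e) | e in [set: edge C]]
            = [set s | s \in triangulation_edges X /\ ~~ on_boundary s]
        & [set dual (CRay r) | r in [set: ray C]]
            = [set s | s \in triangulation_edges X /\ on_boundary s]],
      [/\ forall (e : edge C) (v : vertex C),
            dual (CEdge e) \subset dual (CVertex v) <-> v = src e \/ v = tgt e
        & forall (r : ray C) (v : vertex C),
            dual (CRay r) \subset dual (CVertex v) <-> v = base r],
      [/\ forall e, outward_normal (dir e) (dual (CVertex (src e))) (dual (CEdge e)),
          forall e, outward_normal (- dir e) (dual (CVertex (tgt e))) (dual (CEdge e))
        & forall r, outward_normal (rdir r) (dual (CVertex (base r))) (dual (CRay r))],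
      (forall e : edge C, weight e = 1%N) /\ (forall r : ray C, rweight r = 1%N)
    & [/\ injective region,
          range region
            = [set connected_component (~` curve_support C) x | x in ~` curve_support C]
        & forall c p, relint c `<=` closure (region p) <-> p \in dual c]].

Definition smooth_of_degree (C : plane_graph R) : Prop :=
  plane_tropical_curve C /\
  exists2 X, unimodular_triangulation X & dual_to C X.

End Triangulation.

(* Main.v *)
(* On a hyperelliptic graph there is a map q such that the chips at
   x and q x can be moved to y and q y, for all points x and y. Each level set of the
   corresponding rational function is crossed by at most two chips, and a cycle that is
   crossed uses up both. Suppose that two cycles K and J are attached to a third one, the
   hub, along an edge or by a bridge. Taking for x and y midpoints of edges of K and J
   forces the chips to run around the two arcs of the hub between K and J at unit speed,
   so that these arcs have the same length.

   The three inner lattice points A = (1,1), B = (2,1), C = (1,2) of the triangle give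
   cycles of the skeleton. The midpoints of AB, AC and BC are half-lattice points, hence
   midpoints of edges of the triangulation. Since edges do not cross, either the triangulation
   contains the triangle ABC, in which case one of the two arcs around A degenerates to a
   point, or it contains an edge from an inner point H to a certain boundary point p0. In the
   latter case, one of the arcs at the hub of H is the single edge dual to [H, p0], and
   closing up the polygon dual to H shows that it is strictly shorter than the other one. *)
Require Import Defs.
From mathcomp Require Import all_boot all_order all_algebra.
From mathcomp Require Import all_classical all_reals all_analysis.
From mathcomp Require Import freeg ring lra zify.

Set Implicit Arguments.
Unset Strict Implicit.
Unset Printing Implicit Defensive.

Import Order.TTheory GRing.Theory Num.Theory numFieldNormedType.Exports.

Local Open Scope ring_scope.

(** * Piecewise linear functions on an interval *)

(** Rank 1 enters only through [q]: removing a point [x] from the divisor leaves an effective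
    divisor of degree 1, that is, one point [q x]. The unit speed has an arithmetical reason: by
    summation by parts the slopes crossing a level add up to the number of chips dropping through
    it, at most 2, and slopes are integers. The skeleton arises by leaf contraction, so its edges
    depend on the whole triangulation. Two local criteria avoid an enumeration: an edge is kept if
    its dual segment ends in an inner point or has inner apexes on both sides; a segment between
    boundary points with no inner point beyond it carries no edge of the skeleton. Evaluation then
    only has to treat the neighbourhood of [H]. The point [p0] is the reflection of [H] in the
    midpoint of the other two inner points. Some coordinate is 1 at [H] and 2 at [p0]; in that
    coordinate of the closing relation the edge dual to [[H, p0]] counts with 1, and those of the
    other arc with at least -1. *)

Section PiecewiseLinear.
Context {R : realType}.
Implicit Types (a b c l t : R) (s : seq R) (g h : R -> R).

Definition linear_on a b (m : int) g :=
  forall t, a <= t <= b -> g t = g a + m%:~R * (t - a).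

(** A recursive form of [piecewise_linear_int], so that inductions can peel off the first piece;
    [plP] converts between the two. *)
Fixpoint pl a s g : Prop :=
  if s is b :: s' then [/\ a < b, exists m, linear_on a b m g & pl b s' g]
  else True.

Definition fslope g t : int := germ_slope (fun u => g (t + u)).
Definition bslope g t : int := germ_slope (fun u => g (t - u)).

(** Two slopes valid near 0 are compared at the smaller radius, so the choice made by [xget] is
    harmless. *)
Lemma germ_slope_eq h (m : int) (eps : R) : 0 < eps ->
  (forall t, 0 <= t <= eps -> h t = h 0 + m%:~R * t) -> germ_slope h = m.
Proof.
move=> eps0 hm; rewrite /germ_slope; case: xgetP => [m' _ [e e0 hm']|].
  have [d0 [d1 d2]] : 0 < Num.min e eps /\ (Num.min e eps <= e /\ Num.min e eps <= eps).
    by rewrite lt_min e0 eps0 !ge_min !lexx orbT.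
  move: d0 d1 d2; set d := Num.min e eps => d0 d1 d2.
  have := hm' d; rewrite (ltW d0) d1 => /(_ isT).
  have := hm d; rewrite (ltW d0) d2 => /(_ isT) -> /addrI.
  by move=> /(mulIf (lt0r_neq0 d0)) /intr_inj.
by move=> /(_ m) []; exists eps.
Qed.

Lemma linear_fslope a b m g : a < b -> linear_on a b m g -> fslope g a = m.
Proof.
move=> ab gm; apply: (@germ_slope_eq _ _ (b - a)); first by rewrite subr_gt0.
move=> t /andP[t0 tb]; rewrite addr0 gm; last by apply/andP; split; lra.
by congr (_ + _ * _); ring.
Qed.

Lemma linear_bslope a b m g : a < b -> linear_on a b m g -> bslope g b = - m.
Proof.
move=> ab gm; apply: (@germ_slope_eq _ _ (b - a)); first by rewrite subr_gt0.
move=> t /andP[t0 tb]; rewrite subr0 gm; last by apply/andP; split; lra.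
rewrite (gm b); last by apply/andP; split; lra.
by rewrite rmorphN /=; ring.
Qed.

Lemma linear_onS a b a' b' m g :
  a <= a' -> b' <= b -> linear_on a b m g -> linear_on a' b' m g.
Proof.
move=> aa bb gm t /andP[t1 t2].
rewrite gm ?(gm a'); [ring| |]; apply/andP; split; lra.
Qed.

Lemma pl_last a s g : pl a s g -> a <= last a s.
Proof.
by elim: s a => //= b s IH a [ab _ /IH]; apply: le_trans; apply: ltW.
Qed.

Lemma pl_nthP a s g : pl a s g <-> path <%R a s /\
  forall i, (i < size s)%N -> exists m : int,
        forall t, nth 0 (a :: s) i <= t <= nth 0 s i ->
          g t = g (nth 0 (a :: s) i) + m%:~R * (t - nth 0 (a :: s) i).
Proof.
elim: s a => [|b s IH] a //=; split.
  move=> [ab [m gm] /IH[p gs]]; split; first by rewrite ab.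
  by move=> [|i] si; [exists m | exact: gs].
move=> [/andP[ab p] gs]; split=> //.
  by have [m gm] := gs 0%N isT; exists m.
by apply/IH; split=> // i si; exact: (gs i.+1).
Qed.

Lemma plP l g :
  piecewise_linear_int l g <-> exists2 s, pl 0 s g & last 0 s = l.
Proof.
split=> -[s]; first by case=> p sl gs; exists s => //; apply/pl_nthP.
by move=> /pl_nthP[p gs] sl; exists s.
Qed.

Lemma pl_cat a s s' g : pl a s g -> pl (last a s) s' g -> pl a (s ++ s') g.
Proof. by elim: s a => //= b s IH a [ab gm p] p'; split=> //; apply: IH. Qed.

Lemma pl_rev a l s g : pl a s g -> last a s <= l ->
  exists2 s', pl (l - last a s) s' (fun t => g (l - t))
            & last (l - last a s) s' = l - a.
Proof.
elim: s a => [|b s IH] a /=; first by exists [::].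
move=> [ab [m gm] p] sl; have [s' p' s'b] := IH b p sl.
exists (s' ++ [:: l - a]); last by rewrite last_cat.
apply: pl_cat => //=; split=> //; first by rewrite s'b; lra.
exists (- m) => t; rewrite s'b => /andP[t1 t2].
rewrite (gm (l - t)); last by apply/andP; split; lra.
rewrite (gm (l - (l - b))); last by apply/andP; split; lra.
by rewrite rmorphN /=; ring.
Qed.

Lemma linear_onB a b m n g h : linear_on a b m g -> linear_on a b n h ->
  linear_on a b (m - n) (g \- h).
Proof.
move=> gm hn t t1; rewrite /= gm // hn // rmorphB /=; ring.
Qed.

(** The two subdivisions are merged like sorted lists: the nearer breakpoint comes first, and the
    longer piece is cut there. *)
Lemma plB a s s' g h : pl a s g -> pl a s' h -> last a s = last a s' ->
  exists2 r, pl a r (g \- h) & last a r = last a s.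
Proof.
have [n] := ubnP (size s + size s').
elim: n s s' a => // n IH [|b s] [|b' s'] a /= sz.
- by exists [::].
- move=> _ [ab _ /pl_last bl] e; move: bl; rewrite -e => /(lt_le_trans ab).
  by rewrite ltxx.
- move=> [ab _ /pl_last bl] _ e; move: bl; rewrite e => /(lt_le_trans ab).
  by rewrite ltxx.
move=> [ab [m gm] p] [ab' [m' hm] p'] e.
have [bb|bb|bb] := ltgtP b b'.
- have [||||r pr rl] := IH s (b' :: s') b => //=.
    by split=> //; exists m'; apply: linear_onS hm => //; apply: ltW.
  exists (b :: r) => //=; split=> //; exists (m - m').
  by apply: linear_onB => //; apply: linear_onS hm => //; apply: ltW.
- have [||||r pr rl] := IH (b :: s) s' b' => //=; first by lia.
    by split=> //; exists m; apply: linear_onS gm => //; apply: ltW.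
  exists (b' :: r) => //=; split=> //; exists (m - m').
  by apply: linear_onB => //; apply: linear_onS gm => //; apply: ltW.
move: ab' hm p' e; rewrite -bb => ab' hm p' e.
have [||||r pr rl] := IH s s' b => //=; first by lia.
exists (b :: r) => //=; split=> //; exists (m - m').
exact: linear_onB.
Qed.

(* A continued slope: no break can occur at a point where the two germs cancel. *)
Lemma pl_linear a s g (m : int) : pl a s g ->
  fslope g a = m ->
  (forall t, a < t < last a s -> g t = g a + m%:~R * (t - a) ->
     fslope g t + bslope g t = 0) ->
  linear_on a (last a s) m g.
Proof.
elim: s a => [|b s IH] a /=.
  by move=> _ _ _ t; rewrite -eq_le => /eqP <-; rewrite subrr mulr0 addr0.
move=> [ab [m' gm] p] gam nobreak.
have mm : m' = m by rewrite -gam (linear_fslope ab gm).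
rewrite {}mm in gm; have gb : g b = g a + m%:~R * (b - a).
  by rewrite gm // (ltW ab) lexx.
case: s IH p nobreak => [|b' s] IH p nobreak //.
have bl : b < last b (b' :: s) by case: p => bb' _ /pl_last; apply: lt_le_trans.
have gbm : fslope g b = m.
  have := nobreak b; rewrite ab bl => /(_ isT gb).
  by rewrite (linear_bslope ab gm) => /eqP; rewrite subr_eq0 => /eqP.
have lin := IH b p gbm; move=> t /andP[t1 t2].
have [tb|/ltW bt] := leP t b; first by rewrite gm // t1 tb.
rewrite lin ?bt ?t2 //; first by rewrite gb; ring.
move=> t' /andP[bt' t'l] gt'; apply: nobreak.
  by rewrite (lt_trans ab bt').
by rewrite gt' gb; ring.
Qed.

(** * Summation by parts and level crossings on an interval *)

Definition pieces a s := zip (belast a s) s.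

(** Each piece contributes its slope at its left end and the opposite slope at its right end, as
    both are measured outwards. *)
Lemma pl_green a s g (psi : R -> int) : pl a s g -> s != [::] ->
  psi a * fslope g a
  + \sum_(t <- behead (belast a s)) psi t * (fslope g t + bslope g t)
  + psi (last a s) * bslope g (last a s)
  = \sum_(z <- pieces a s) fslope g z.1 * (psi z.1 - psi z.2).
Proof.
rewrite /pieces; elim: s a => // b s IH a /= [ab [m gm] p] _.
have ga := linear_fslope ab gm; have gb := linear_bslope ab gm.
case: s IH p => [|b' s] IH p.
  by rewrite /= big_nil big_seq1 /= ga gb; ring.
by rewrite [RHS]big_cons -IH //= big_cons /= ga gb; ring.
Qed.

(** The test [c < g] is strict: a piece descending exactly to [c] counts as crossing, one touching
    [c] from below does not. *)
Definition crossing_weight a s g c : nat :=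
  \sum_(z <- pieces a s) `|fslope g z.1|%N * ((c < g z.1)%R != (c < g z.2)%R).

Lemma linear_side a b m g c t : linear_on a b m g -> a <= t <= b ->
  (c < g a) = (c < g b) -> (c < g t) = (c < g a).
Proof.
move=> gm /andP[t1 t2]; have ab := le_trans t1 t2.
have := gm b; rewrite ab lexx => /(_ isT) gb.
have := gm t; rewrite t1 t2 => /(_ isT) gt.
have : (g a <= g t <= g b) || (g b <= g t <= g a).
  rewrite gt gb; have [m0|m0] := leP 0 m.
    have m0' : (0 : R) <= m%:~R by rewrite ler0z.
    by apply/orP; left; apply/andP; split; nra.
  have m0' : m%:~R <= (0 : R) by rewrite lerz0 ltW.
  by apply/orP; right; apply/andP; split; nra.
by case/orP => /andP[]; case: (ltP c (g a)); case: (ltP c (g b)) => //;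
  case: (ltP c (g t)) => //; lra.
Qed.

(** The right side of [pl_green] for the indicator of [c < g]. On a crossing piece the sign of the
    slope agrees with the direction of the crossing, so every term is minus an absolute value. *)
Lemma crossing_weight_green a s g c : pl a s g ->
  \sum_(z <- pieces a s)
     fslope g z.1 * ((c < g z.1)%R%:R - (c < g z.2)%R%:R) = - (crossing_weight a s g c)%:Z.
Proof.
rewrite /crossing_weight /pieces; elim: s a => [|b s IH] a /=.
  by rewrite !big_nil.
move=> [ab [m gm] /IH {}IH]; rewrite !big_cons /= IH PoszD opprD; congr (_ + _).
have := gm b; rewrite (ltW ab) lexx => /(_ isT).
rewrite (linear_fslope ab gm) => gb.
have [m0|m0] := leP 0 m.
  have m0' : (0 : R) <= m%:~R by rewrite ler0z.
  case: (ltP c (g a)) => ca; case: (ltP c (g b)) => cb //=; try lia.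
  have : g a <= g b by rewrite gb; nra.
  by move=> /(lt_le_trans ca); rewrite ltNge cb.
have m0' : m%:~R <= (0 : R) by rewrite lerz0 ltW.
case: (ltP c (g a)) => ca; case: (ltP c (g b)) => cb //=; try lia.
have : g b <= g a by rewrite gb; nra.
by move=> /(lt_le_trans cb); rewrite ltNge ca.
Qed.

(** Slopes are integers, so each crossing counts at least 1, and a function that leaves one side of
    the level and returns to it crosses at least twice. *)
Lemma crossing_weightP a s g c : pl a s g ->
  [/\ (c < g a) != (c < g (last a s)) -> (0 < crossing_weight a s g c)%N,
      (c < g a) = (c < g (last a s)) -> crossing_weight a s g c != 0%N ->
        (1 < crossing_weight a s g c)%N
    & crossing_weight a s g c = 0%N ->
        forall t, a <= t <= last a s -> (c < g t) = (c < g a)].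
Proof.
rewrite /crossing_weight /pieces; elim: s a => [|b s IH] a /=.
  move=> _; rewrite big_nil eqxx; split=> // _ t.
  by rewrite -eq_le => /eqP <-.
move=> [ab [m gm] p]; rewrite !big_cons /=; have {IH} := IH b p.
set w := (\sum_(z <- _) _)%N; move=> [w1 w2 w3].
rewrite (linear_fslope ab gm); set w' := (_ * _)%N.
have w'0 : (c < g a) = (c < g b) -> w' = 0%N by rewrite /w' => ->; rewrite eqxx muln0.
have w'1 : (c < g a) != (c < g b) -> (0 < w')%N.
  move=> ne; rewrite /w' ne muln1 absz_gt0; apply: contraNneq ne => m0.
  by rewrite (gm b) ?(ltW ab) ?lexx // m0 mul0r addr0.
have piece t : (c < g a) = (c < g b) -> a <= t <= b -> (c < g t) = (c < g a).
  by move=> e te; apply: (linear_side gm).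
split.
- case: (boolP ((c < g a) == (c < g b))) => [/eqP -> /w1|/w'1]; lia.
- case: (boolP ((c < g a) == (c < g b))) => [/eqP e|ne].
    by rewrite w'0 // add0n e; exact: w2.
  move=> e _; have := w'1 ne; have : (0 < w)%N by apply: w1; rewrite -e eq_sym.
  lia.
case: (boolP ((c < g a) == (c < g b))) => [/eqP e|ne]; last by have := w'1 ne; lia.
rewrite w'0 // add0n => w0 t /andP[t1 t2].
have [tb|/ltW bt] := leP t b; first by apply: piece; rewrite // t1.
by rewrite w3 // ?bt.
Qed.

Lemma crossing_weight_linear a s g c m : pl a s g ->
  linear_on a (last a s) m g -> (c < g a) != (c < g (last a s)) ->
  crossing_weight a s g c = `|m|%N.
Proof.
rewrite /crossing_weight /pieces; elim: s a => [|b s IH] a /=.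
  by rewrite eqxx.
move=> [ab [m' gm'] p] lin; rewrite !big_cons /=.
have bl := pl_last p.
have gm : linear_on a b m g by apply: linear_onS lin.
have gbm : linear_on b (last b s) m g.
  by apply: linear_onS lin => //; apply: ltW.
rewrite (linear_fslope ab gm).
case: (boolP ((c < g a) == (c < g b))) => [/eqP -> /(IH _ p gbm) ->|ne ne'].
  by rewrite muln0.
rewrite muln1; have {}ne' : (c < g b) = (c < g (last b s)).
  by case: (c < g a) ne ne'; case: (c < g b); case: (c < g (last b s)).
(* After the piece that crosses, the linear function stays on one side, so the later pieces
   contribute nothing. *)
suff -> : (\sum_(z <- zip (belast b s) s)
   `|fslope g z.1| * ((c < g z.1)%R != (c < g z.2)%R))%N = 0%N by rewrite addn0.
elim: s b {IH bl ab gm' gm ne lin} p gbm ne' => [|b' s IH] b /=.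
  by rewrite big_nil.
move=> [bb' [m'' _] p] lin e; rewrite big_cons /=.
have bl := pl_last p.
have eb' : (c < g b') = (c < g b).
  by apply: (linear_side lin) => //; rewrite (ltW bb').
rewrite eb' eqxx muln0 add0n; apply: IH => //; last by rewrite eb' e.
by apply: linear_onS lin => //; apply: ltW.
Qed.

End PiecewiseLinear.

Section Breaks.
Context {R : realType}.

Lemma pl_nobreak (a t : R) s g : pl a s g -> a < t < last a s ->
  t \notin behead (belast a s) -> fslope g t + bslope g t = 0.
Proof.
elim: s a => [|b s IH] a /=; first by move=> _ /andP[/lt_trans h /h]; rewrite ltxx.
move=> [ab [m gm] p] /andP[at_ tl] tn.
have [tb|bt|tb] := ltgtP t b.
- rewrite (@linear_fslope _ t b m) //; last by apply: linear_onS gm => //; apply: ltW.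
  rewrite (@linear_bslope _ a t m) ?subrr //; apply: linear_onS gm => //; exact: ltW.
- apply: (IH b) => //; first by rewrite bt.
  by apply: contra tn; case: (s) => //= c s'; rewrite inE orbC => ->.
- case: s p tl tn {IH} => [|c s] p /=; first by rewrite tb ltxx.
  by rewrite inE tb eqxx.
Qed.

Lemma pl_breaks (a : R) s g : pl a s g ->
  uniq (behead (belast a s)) /\
  forall t, t \in behead (belast a s) -> a < t < last a s.
Proof.
elim: s a => // b s IH a [ab _ p]; case: s IH p => // c s IH p /=.
have [u cs] := IH b p; split=> [|t].
  by rewrite /= u andbT; apply/negP => /cs; rewrite ltxx.
have bl : b < last c s by case: p => bc _ /pl_last; apply: lt_le_trans.
rewrite inE => /orP[/eqP ->|/cs /andP[bt tl]]; first by rewrite ab.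
by rewrite (lt_trans ab bt).
Qed.

End Breaks.

(** * Rational functions and chip firing on metric graphs *)

Section Graph.
Context {R : realType} (G : metric_graph R).
Local Notation V := (mg_vertex G).
Local Notation E := (mg_edge G).
Local Notation point := (mg_point G).
Implicit Types (f : point -> R) (e : E) (v : V) (c t : R).

Local Notation len := (@mg_len R G).

Lemma edge_point0 e : edge_point e 0 = inl (mg_src e).
Proof. by rewrite /edge_point insubF ?ltxx // lexx. Qed.

Lemma edge_point_len e : edge_point e (len e) = inl (mg_tgt e).
Proof.
by rewrite /edge_point insubF /= ?ltxx ?andbF // leNgt mg_len_gt0.
Qed.

Lemma edge_point_inside e t (te : 0 < t < len e) :
  edge_point e t = inr (Sub (e, t) te).
Proof. by rewrite /edge_point insubT. Qed.

Lemma div_coeff_inside f e t : 0 < t < len e ->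
  div_coeff f (edge_point e t)
  = fslope (f \o edge_point e) t + bslope (f \o edge_point e) t.
Proof. by move=> te; rewrite (edge_point_inside te). Qed.

Lemma edge_point_inj e t e' t' : 0 < t < len e ->
  edge_point e t = edge_point e' t' -> e = e' /\ t = t'.
Proof.
move=> te; rewrite (edge_point_inside te) /edge_point.
case: insubP => [x _ vx|//].
move=> /(congr1 (fun y => if y is inr z then val z else val x)).
by rewrite SubK vx => -[].
Qed.

Lemma div_coeff_vertex f v :
  div_coeff f (inl v) = \sum_(e | mg_src e == v) fslope (f \o edge_point e) 0
    + \sum_(e | mg_tgt e == v) bslope (f \o edge_point e) (len e).
Proof. by []. Qed.

(** A finite list containing every point where the divisor of [f] is nonzero; vertices are listed
    whether or not [f] bends there. *)
Definition breaks (s : E -> seq R) : seq point :=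
  [seq inl v | v <- enum V]
  ++ [seq edge_point e t | e <- enum E, t <- behead (belast 0 (s e))].

Lemma rational_breaks f : rational_function f -> exists s : E -> seq R,
  forall e, pl 0 (s e) (f \o edge_point e) /\ last 0 (s e) = len e.
Proof.
move=> rf; suff /choice[s sf] : forall e, exists r : seq R,
    pl 0 r (f \o edge_point e) /\ last 0 r = len e by exists s.
by move=> e; have [r ? ?] := (plP _ _).1 (rf e); exists r.
Qed.

Section Breaks.
Variables (f : point -> R) (s : E -> seq R).
Hypothesis sf : forall e, pl 0 (s e) (f \o edge_point e) /\ last 0 (s e) = len e.

Lemma break_inside e t : t \in behead (belast 0 (s e)) -> 0 < t < len e.
Proof.
by have [p sl] := sf e; have [_ /(_ t)] := pl_breaks p; rewrite sl.
Qed.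

Lemma uniq_breaks : uniq (breaks s).
Proof.
rewrite /breaks cat_uniq map_inj_uniq ?enum_uniq; last by move=> v v' [].
rewrite andTb; apply/andP; split.
  apply/hasPn => x /allpairsPdep[e [t [_ te ->]]]; apply/negP => /mapP[v _].
  by rewrite (edge_point_inside (break_inside te)).
apply: allpairs_uniq_dep; first exact: enum_uniq.
  by move=> e _; have [p _] := sf e; have [] := pl_breaks p.
move=> [e t] [e' t'] /allpairsPdep[e1 [t1 [_ h1 /= q1]]] _ /=.
have h : t \in behead (belast 0 (s e)).
  have /= ee := congr1 (@tag _ _) q1.
  by have /= tt := congr1 (fun z : {_ : E & R} => projT2 z) q1; rewrite ee tt.
by move=> /(edge_point_inj (break_inside h)) [-> ->].
Qed.

Lemma div_coeff_off_breaks x : x \notin breaks s -> div_coeff f x = 0.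
Proof.
case: x => [v|[[e t] te]]; rewrite mem_cat negb_or => /andP[].
  by move=> /negP[]; apply: map_f; rewrite mem_enum.
move=> _ xn; rewrite [LHS](_ : _ = div_coeff f (edge_point e t)); last first.
  by rewrite edge_point_inside.
rewrite div_coeff_inside //; have [p sl] := sf e.
apply: (pl_nobreak p); first by rewrite sl.
apply: contra xn => tb; apply/allpairsPdep; exists e, t.
by rewrite mem_enum edge_point_inside.
Qed.

Lemma length_positive e : s e != [::].
Proof.
by have [_ sl] := sf e; apply/eqP => se; have := mg_len_gt0 e; rewrite -sl se ltxx.
Qed.

(** [pl_green] summed over all edges; the end terms are regrouped by source and by target vertex,
    which gives the two sums in [div_coeff]. *)
Lemma green (psi : point -> int) :
  \sum_(x <- breaks s) psi x * div_coeff f x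
  = \sum_e \sum_(z <- pieces 0 (s e)) fslope (f \o edge_point e) z.1
             * (psi (edge_point e z.1) - psi (edge_point e z.2)).
Proof.
rewrite big_cat /= big_map big_allpairs_dep /= !big_enum /=.
under [RHS]eq_bigr => e _.
  have [p sl] := sf e.
  rewrite -(pl_green (psi \o edge_point e) p (length_positive e)) sl.
  rewrite /= edge_point0 edge_point_len addrAC.
  over.
rewrite [RHS]big_split /=; congr (_ + _); last first.
  apply: eq_bigr => e _; apply: eq_big_seq => t /break_inside te.
  by rewrite div_coeff_inside.
under eq_bigr => v _ do rewrite mulrDr !mulr_sumr.
rewrite !big_split /=; congr (_ + _).
  rewrite [RHS](partition_big (@mg_src R G) predT) //=.
  by apply: eq_bigr => v _; apply: eq_bigr => e /eqP ->.
rewrite [RHS](partition_big (@mg_tgt R G) predT) //=.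
by apply: eq_bigr => v _; apply: eq_bigr => e /eqP ->.
Qed.

End Breaks.

(* The chips [D] are moved to [D'] by firing [f]. *)
Definition moves f (D D' : seq point) : Prop :=
  rational_function f /\
  forall x, div_coeff f x = (count_mem x D')%:Z - (count_mem x D)%:Z.

Lemma sum_count_mem (r D : seq point) (psi : point -> int) :
  uniq r -> {subset D <= r} ->
  \sum_(x <- r) psi x * (count_mem x D)%:Z = \sum_(x <- D) psi x.
Proof.
move=> ur; elim: D => [|y D IH] sub.
  by rewrite big_nil big1 // => x _; rewrite mulr0.
rewrite big_cons -IH; last by move=> x xD; apply: sub; rewrite inE xD orbT.
under eq_bigr do rewrite /= PoszD mulrDr; rewrite big_split /=; congr (_ + _).
rewrite (bigD1_seq y) ?sub ?mem_head //= eqxx mulr1 big1 ?addr0 // => x xy.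
by rewrite eq_sym (negbTE xy) mulr0.
Qed.

Lemma sum_div_coeff (f : point -> R) (r0 D D' : seq point) (psi : point -> int) :
  uniq r0 -> (forall x, x \notin r0 -> div_coeff f x = 0) ->
  (forall x, div_coeff f x = (count_mem x D')%:Z - (count_mem x D)%:Z) ->
  \sum_(x <- r0) psi x * div_coeff f x
  = \sum_(x <- D') psi x - \sum_(x <- D) psi x.
Proof.
move=> ur0 off df.
(* Chips common to [D] and [D'] may lie outside [r0]. Adding their positions changes nothing, since
   the coefficient of [f] is 0 there, and makes both lists fully counted. *)
pose r := r0 ++ [seq x <- undup (D ++ D') | x \notin r0].
have ur : uniq r.
  rewrite cat_uniq ur0 filter_uniq ?undup_uniq // andbT.
  by apply/hasPn => x; rewrite mem_filter => /andP[].
have subr x : x \in D ++ D' -> x \in r.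
  by rewrite [x \in r]mem_cat mem_filter mem_undup => ->; rewrite andbT orbN.
have -> : \sum_(x <- r0) psi x * div_coeff f x = \sum_(x <- r) psi x * div_coeff f x.
  rewrite big_cat /= [X in _ + X]big1_seq ?addr0 // => x /andP[_].
  by rewrite mem_filter => /andP[/off -> _]; rewrite mulr0.
under eq_bigr => x _ do rewrite df mulrBr.
rewrite sumrB !sum_count_mem // => x xD; apply: subr; rewrite mem_cat xD ?orbT //.
Qed.

(** Green's formula for the indicator of [c < f]: the slopes across the level [c] account exactly
    for the chips that leave the region above it. With two chips the total weight is therefore at
    most 2. *)
Lemma crossing_weights f D D' : moves f D D' -> exists w : R -> E -> nat,
  forall c,
  [/\ (\sum_e w c e + count (fun x => c < f x)%R D'
          = count (fun x => c < f x)%R D)%N,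
      forall e, (c < f (inl (mg_src e))) != (c < f (inl (mg_tgt e))) ->
        (0 < w c e)%N,
      forall e, (c < f (inl (mg_src e))) = (c < f (inl (mg_tgt e))) ->
        w c e != 0%N -> (1 < w c e)%N,
      forall e, w c e = 0%N -> forall t, 0 <= t <= len e ->
        (c < f (edge_point e t)) = (c < f (inl (mg_src e)))
    & forall e m, linear_on 0 (len e) m (f \o edge_point e) ->
        (c < f (inl (mg_src e))) != (c < f (inl (mg_tgt e))) ->
        w c e = `|m|%N].
Proof.
move=> [rf df]; have [s sf] := rational_breaks rf.
exists (fun c e => crossing_weight 0 (s e) (f \o edge_point e) c) => c.
split; last 4 first.
- move=> e; have [p sl] := sf e; have [+ _ _] := crossing_weightP c p.
  by rewrite sl /= edge_point0 edge_point_len.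
- move=> e; have [p sl] := sf e; have [_ + _] := crossing_weightP c p.
  by rewrite sl /= edge_point0 edge_point_len.
- move=> e; have [p sl] := sf e; have [_ _ +] := crossing_weightP c p.
  by rewrite sl /= edge_point0.
- move=> e m lin; have [p sl] := sf e.
  have := crossing_weight_linear (c := c) p (m := m).
  by rewrite sl /= edge_point0 edge_point_len; apply.
pose psi x : int := (c < f x)%R : nat.
have psic (r : seq point) : \sum_(x <- r) psi x = count (fun x => c < f x) r.
  elim: r => [|x r IH]; first by rewrite big_nil.
  by rewrite big_cons IH -PoszD.
have := green sf psi.
have -> : \sum_e \sum_(z <- pieces 0 (s e)) fslope (f \o edge_point e) z.1 *
     (psi (edge_point e z.1) - psi (edge_point e z.2))
  = - (\sum_e crossing_weight 0 (s e) (f \o edge_point e) c)%N%:Z.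
  rewrite (big_morph Posz PoszD (erefl _)) -sumrN; apply: eq_bigr => e _.
  have [p sl] := sf e; rewrite -(crossing_weight_green c p).
  by apply: eq_bigr => z _; rewrite /psi !natz.
rewrite (sum_div_coeff psi (uniq_breaks sf) (div_coeff_off_breaks sf) df).
rewrite !psic; lia.
Qed.

Lemma degree_div_coeff f : rational_function f ->
  exists2 r, uniq r & (forall x, x \notin r -> div_coeff f x = 0)
    /\ \sum_(x <- r) div_coeff f x = 0.
Proof.
move=> /rational_breaks[s sf]; exists (breaks s); first exact: uniq_breaks sf.
split; first exact: div_coeff_off_breaks sf.
have := green sf (fun=> 1); under eq_bigr do rewrite mul1r.
move=> ->; apply: big1 => e _; apply: big1 => z _; exact: mulr0.
Qed.

End Graph.

Section Germs.
Context {R : realType}.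

Lemma pl_germ_right (a t : R) s g : pl a s g -> a <= t < last a s ->
  exists b m, t < b /\ linear_on t b m g.
Proof.
elim: s a => [|b s IH] a /=; first by move=> _ /andP[/le_lt_trans h /h]; rewrite ltxx.
move=> [ab [m gm] p] /andP[at_ tl].
have [tb|bt] := ltP t b; last by apply: (IH b) => //; rewrite bt.
by exists b, m; split=> //; apply: linear_onS gm.
Qed.

Lemma pl_germ_left (a t : R) s g : pl a s g -> a < t <= last a s ->
  exists b m, b < t /\ linear_on b t m g.
Proof.
elim: s a => [|b s IH] a /=; first by move=> _ /andP[/lt_le_trans h /h]; rewrite ltxx.
move=> [ab [m gm] p] /andP[at_ tl].
have [tb|bt] := leP t b; last by apply: (IH b) => //; rewrite bt.
by exists a, m; split=> //; apply: linear_onS gm.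
Qed.

Lemma fslopeB (a t : R) s g r h : pl a s g -> pl a r h -> last a s = last a r ->
  a <= t < last a s -> fslope (g \- h) t = fslope g t - fslope h t.
Proof.
move=> pg ph sr ts; have [b [m [tb gm]]] := pl_germ_right pg ts.
rewrite sr in ts; have [b' [m' [tb' hm]]] := pl_germ_right ph ts.
have tmin : t < Num.min b b' by rewrite lt_min tb.
rewrite (linear_fslope tb gm) (linear_fslope tb' hm).
apply: (linear_fslope tmin); apply: linear_onB.
  by apply: linear_onS gm => //; rewrite ge_min lexx.
by apply: linear_onS hm => //; rewrite ge_min lexx orbT.
Qed.

Lemma bslopeB (a t : R) s g r h : pl a s g -> pl a r h -> last a s = last a r ->
  a < t <= last a s -> bslope (g \- h) t = bslope g t - bslope h t.
Proof.
move=> pg ph sr ts; have [b [m [tb gm]]] := pl_germ_left pg ts.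
rewrite sr in ts; have [b' [m' [tb' hm]]] := pl_germ_left ph ts.
have tmax : Num.max b b' < t by rewrite gt_max tb.
rewrite (linear_bslope tb gm) (linear_bslope tb' hm) -opprD.
apply: (linear_bslope tmax); apply: linear_onB.
  by apply: linear_onS gm => //; rewrite le_max lexx.
by apply: linear_onS hm => //; rewrite le_max lexx orbT.
Qed.

End Germs.

(** * From a divisor of degree 2 and rank 1 to moves of two chips *)

Section Hyperelliptic.
Context {R : realType} (G : metric_graph R).
Local Notation point := (mg_point G).
Implicit Types (f g : point -> R).

Lemma rational_functionB f g :
  rational_function f -> rational_function g -> rational_function (f \- g).
Proof.
move=> rf rg e; have [s p sl] := (plP _ _).1 (rf e).
have [s' p' sl'] := (plP _ _).1 (rg e); apply/plP.
have [r pr rl] := plB p p' (etrans sl (esym sl')).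
by exists r; rewrite // rl.
Qed.

Lemma div_coeffB f g x : rational_function f -> rational_function g ->
  div_coeff (f \- g) x = div_coeff f x - div_coeff g x.
Proof.
move=> rf rg; have [s sf] := rational_breaks rf; have [r rg'] := rational_breaks rg.
have fB e t : 0 <= t < mg_len e ->
    slope_fwd (f \- g) e t = slope_fwd f e t - slope_fwd g e t.
  have [p sl] := sf e; have [p' sl'] := rg' e => te.
  by apply: (fslopeB p p'); rewrite sl.
have bB e t : 0 < t <= mg_len e ->
    slope_bwd (f \- g) e t = slope_bwd f e t - slope_bwd g e t.
  have [p sl] := sf e; have [p' sl'] := rg' e => te.
  by apply: (bslopeB p p'); rewrite sl.
case: x => [v|[[e t] /= /andP[t0 tl]]] /=; last first.
  by rewrite fB ?bB ?t0 ?tl ?ltW //=; ring.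
rewrite (eq_bigr (fun e => slope_fwd f e 0 - slope_fwd g e 0)); last first.
  by move=> e _; rewrite fB // lexx mg_len_gt0.
rewrite [X in _ + X = _](eq_bigr
    (fun e => slope_bwd f e (mg_len e) - slope_bwd g e (mg_len e))); last first.
  by move=> e _; rewrite bB // lexx mg_len_gt0.
rewrite !sumrB; ring.
Qed.

Lemma degE (D : {freeg point / int}) (r : seq point) : uniq r ->
  (forall x, x \notin r -> coeff x D = 0) -> deg D = \sum_(x <- r) coeff x D.
Proof.
move=> ur off; rewrite -{1}(freeg_sumE D) raddf_sum /=.
under eq_bigr do rewrite degU.
rewrite [RHS](bigID (mem (dom D))) /= [X in _ + X]big1 ?addr0; last first.
  by move=> x; rewrite mem_dom negbK => /eqP.
rewrite -[RHS]big_filter; apply: perm_big; apply: uniq_perm.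
- exact: uniq_dom.
- exact: filter_uniq.
move=> x; rewrite mem_filter andbC; case: (boolP (x \in r)) => //= /off.
by rewrite mem_dom => ->; rewrite eqxx.
Qed.

(** An effective divisor of degree 1 is a point, which defines [q x]. Both [x + q x] and [y + q y]
    are equivalent to [D]; the difference of the two functions makes the move. *)
Lemma hyperelliptic_moves : hyperelliptic G ->
  exists q : point -> point, forall x y, exists f, moves f [:: x; q x] [:: y; q y].
Proof.
move=> [D degD [rkD _]].
have /choice[q qP] : forall x, exists q, exists2 f, rational_function f &
    forall p, div_coeff f p = coeff p D - (x == p)%:Z - (q == p)%:Z.
  move=> x; have [p|D' effD' [f rf df]] := rkD << x >> _ (degU _ _).
    by rewrite coeffU mul1r; case: (x == p).
  have [r ur [off sum0]] := degree_div_coeff rf.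
  have degD' : deg D' = 1.
    have := degE ur (D := D - << x >> - D').
    rewrite (eq_bigr (div_coeff f)) ?sum0 => [|p _]; last by rewrite df.
    by rewrite !degB degD degU => h; have := h (fun p pr => etrans (df p) (off p pr)); lia.
  have [|q D'q] := @deg1pos _ D' _ degD'.
    exact/fgposP.
  exists q, f => // p; rewrite -df !coeffB D'q !coeffU !mul1r.
  by case: (x == p); case: (q == p).
exists q => x y; have [f rf df] := qP x; have [g rg dg] := qP y.
exists (f \- g); split=> [|p]; first exact: rational_functionB.
rewrite div_coeffB // df dg /=.
lia.
Qed.

End Hyperelliptic.

Section Darts.
Context {R : realType} (G : metric_graph R).
Local Notation V := (mg_vertex G).
Local Notation E := (mg_edge G).
Local Notation point := (mg_point G).
Local Notation len := (@mg_len R G).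
Implicit Types (f : point -> R) (e : E) (v : V) (c t : R).

Definition dart : Type := (E * bool)%type.
Implicit Types d : dart.
Definition dsrc d : V := if d.2 then mg_src d.1 else mg_tgt d.1.
Definition dtgt d : V := if d.2 then mg_tgt d.1 else mg_src d.1.
Definition drev d : dart := (d.1, ~~ d.2).
Definition dpt d t : point := edge_point d.1 (if d.2 then t else len d.1 - t).
Definition dslope f d : int :=
  if d.2 then fslope (f \o edge_point d.1) 0
  else bslope (f \o edge_point d.1) (len d.1).

Lemma dtgt_rev d : dtgt (drev d) = dsrc d. Proof. by case: d => e []. Qed.
Lemma dsrc_rev d : dsrc (drev d) = dtgt d. Proof. by case: d => e []. Qed.
Lemma drevK d : drev (drev d) = d. Proof. by case: d => e []. Qed.

Lemma dpt0 d : dpt d 0 = inl (dsrc d).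
Proof. by case: d => e []; rewrite /dpt /= ?subr0 ?edge_point0 ?edge_point_len. Qed.

Lemma dpt_len d : dpt d (len d.1) = inl (dtgt d).
Proof. by case: d => e []; rewrite /dpt /= ?subrr ?edge_point0 ?edge_point_len. Qed.

Lemma div_coeff_darts f v :
  div_coeff f (inl v) = \sum_(d : dart | dsrc d == v) dslope f d.
Proof.
rewrite div_coeff_vertex [RHS](bigID (fun d : dart => d.2)) /=; congr (_ + _).
  rewrite [RHS](reindex_onto (fun e => (e, true)) (fun d => d.1)) /=.
    by apply: eq_big => // e; rewrite eqxx !andbT.
  by case=> e [] //; rewrite andbF.
rewrite [RHS](reindex_onto (fun e => (e, false)) (fun d => d.1)) /=.
  by apply: eq_big => // e; rewrite eqxx !andbT.
by case=> e [] //; rewrite andbF.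
Qed.

Lemma dart_pl f d : rational_function f -> exists s,
  [/\ pl 0 s (f \o dpt d), last 0 s = len d.1, fslope (f \o dpt d) 0 = dslope f d
    & forall t, 0 < t < len d.1 ->
        fslope (f \o dpt d) t + bslope (f \o dpt d) t = div_coeff f (dpt d t)].
Proof.
move=> rf; case: d => e [].
  have [s p sl] := (plP _ _).1 (rf e); exists s; split=> // t te.
  by rewrite /dpt /= div_coeff_inside.
have [s p sl] := (plP _ _).1 (rf e).
have [|s' p' sl'] := pl_rev (l := len e) p; first by rewrite sl.
rewrite sl subrr in p' sl'; exists s'; split=> //; first by rewrite sl' subr0.
  rewrite /fslope /dslope /bslope /dpt /=; congr (germ_slope _).
  by apply: funext => u; rewrite add0r.
move=> t /andP[t0 tl]; rewrite /dpt /= div_coeff_inside; last by apply/andP; split; lra.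
rewrite addrC /fslope /bslope /=; congr (_ + _);
  congr germ_slope; apply: funext => u /=; congr (f (edge_point _ _)); ring.
Qed.

(* [f] continues straight along [d] as long as it meets no chip; the hypothesis
   only concerns the points where it still does. *)
Lemma dart_linear f d : rational_function f ->
  (forall t, 0 < t < len d.1 ->
     f (dpt d t) = f (inl (dsrc d)) + (dslope f d)%:~R * t ->
     div_coeff f (dpt d t) = 0) ->
  linear_on 0 (len d.1) (dslope f d) (f \o dpt d).
Proof.
move=> rf free; have [s [p sl fs div]] := dart_pl d rf.
have := pl_linear p fs; rewrite sl; apply.
move=> t te; rewrite subr0 /= dpt0 => /(free t te) <-; exact: div.
Qed.

Lemma linear_dslope_rev f d m : linear_on 0 (len d.1) m (f \o dpt d) ->
  dslope f (drev d) = - m.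
Proof.
case: d => e [] lin; rewrite /dslope /=.
  exact: (linear_bslope (mg_len_gt0 e) lin).
apply: (linear_fslope (mg_len_gt0 e)) => t /andP[t0 tl] /=.
have := lin (len e - t); rewrite /dpt /= subKr => -> //; last by apply/andP; split; lra.
have := lin (len e); rewrite /dpt /= subrr => -> //; last by apply/andP; split; lra.
by rewrite rmorphN /=; ring.
Qed.

Lemma linear_edge f d m : linear_on 0 (len d.1) m (f \o dpt d) ->
  exists2 m', linear_on 0 (len d.1) m' (f \o edge_point d.1) & `|m'|%N = `|m|%N.
Proof.
case: d => e [] lin; first by exists m.
exists (- m); last by rewrite abszN.
move=> t /andP[t0 tl] /=.
have := lin (len e - t); rewrite /dpt /= subKr => -> //; last by apply/andP; split; lra.
have := lin (len e); rewrite /dpt /= subrr => -> //; last by apply/andP; split; lra.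
by rewrite rmorphN /=; ring.
Qed.

Lemma dslope_ge0 f d : rational_function f ->
  (forall t, 0 <= t <= len d.1 -> f (inl (dsrc d)) <= f (dpt d t)) ->
  0 <= dslope f d.
Proof.
move=> rf mn; have [s [p sl <- _]] := dart_pl d rf.
have [|b [m [b0 lin]]] := pl_germ_right (t := 0) p; first by rewrite sl lexx mg_len_gt0.
rewrite (linear_fslope b0 lin) -(ler0z R).
have lb : 0 < Num.min b (len d.1) by rewrite lt_min b0 mg_len_gt0.
have le1 : Num.min b (len d.1) <= b by rewrite ge_min lexx.
have le2 : Num.min b (len d.1) <= len d.1 by rewrite ge_min lexx orbT.
move: lb le1 le2; set u := Num.min _ _ => u0 ub ul.
have := mn u; rewrite ul (ltW u0) => /(_ isT).
have /= -> := lin u; last by rewrite (ltW u0).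
by rewrite dpt0 subr0 lerDl pmulr_lge0.
Qed.

End Darts.

(** * Cycles crossed by a level of a function that moves two chips *)

Section Levels.
Context {R : realType} (G : metric_graph R).
Local Notation V := (mg_vertex G).
Local Notation E := (mg_edge G).
Local Notation point := (mg_point G).
Local Notation len := (@mg_len R G).
Implicit Types (f : point -> R) (e : E) (v : V) (c t : R) (K J : {set E}).

Definition on_edges K (x : point) : Prop :=
  exists e t, [/\ e \in K, 0 <= t <= len e & x = edge_point e t].

(* Every vertex cut meeting [K] meets it at least twice. *)
Definition cyclic_edges K : Prop := forall b : V -> bool,
  (forall e e', e \in K -> e' \in K ->
     b (mg_src e) = b (mg_src e') /\ b (mg_src e) = b (mg_tgt e))
  \/ exists e e', [/\ e \in K, e' \in K, e != e',
        b (mg_src e) != b (mg_tgt e) & b (mg_src e') != b (mg_tgt e')].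

Definition splits f c K : Prop :=
  exists x y, [/\ on_edges K x, on_edges K y, f x <= c & c < f y].

Definition uncrossed f c e : Prop :=
  forall t, 0 <= t <= len e -> (c < f (edge_point e t)) = (c < f (inl (mg_src e))).

Lemma uncrossed_dart f c (d : dart G) t : uncrossed f c d.1 -> 0 <= t <= len d.1 ->
  (c < f (dpt d t)) = (c < f (inl (dsrc d))).
Proof.
move=> un te; have := un (len d.1); rewrite lexx ltW ?mg_len_gt0 // => /(_ isT).
case: d un te => e [] /= un te; rewrite /dpt /dsrc /= ?edge_point_len; first by rewrite un.
move=> ->; apply: un; case/andP: te => t0 t1; apply/andP; split; lra.
Qed.

Lemma uncrossed_tgt f c (d : dart G) : uncrossed f c d.1 ->
  (c < f (inl (dtgt d))) = (c < f (inl (dsrc d))).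
Proof.
by move=> un; rewrite -dpt_len (uncrossed_dart un) // lexx ltW // mg_len_gt0.
Qed.

(** A level that passes through a cycle is crossed there with weight at least 2, which is all that
    two chips allow. So both chips must drop through it, and no edge off [K] meets it. *)
Lemma splitsP f p q p' q' c K :
  moves f [:: p; q] [:: p'; q'] -> cyclic_edges K -> splits f c K ->
  [/\ c < f p, c < f q, f p' <= c, f q' <= c & forall e, e \notin K -> uncrossed f c e].
Proof.
move=> mf cK [x [y [[e [t [eK te xe]]] [e' [t' [eK' te' ye']]] xc cy]]].
have [w /(_ c)[tot w1 w2 w3 _]] := crossing_weights mf.
(* If all vertices of [K] are on one side, an edge reaching the other side has to come back and
   counts twice; otherwise two different edges separate their ends. *)
have w_ge2 : (2 <= \sum_(e | e \in K) w c e)%N.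
  have [same|[e1 [e2 [e1K e2K ne s1 s2]]]] := cK (fun v => c < f (inl v)).
    have [e0 e0K w0] : exists2 e0, e0 \in K & w c e0 != 0%N.
      apply: contrapT => noe.
      have z e0 : e0 \in K -> w c e0 = 0%N.
        by move=> e0K; apply/eqP/negPn/negP => w0; apply: noe; exists e0.
      have := w3 e' (z _ eK') t' te'; rewrite -ye' cy.
      have [<- _] := same e e' eK eK'.
      by have := w3 e (z _ eK) t te; rewrite -xe ltNge xc => <-.
    rewrite (bigD1 e0) //=; have [_ s0] := same e0 e0 e0K e0K.
    exact: leq_trans (w2 e0 s0 w0) (leq_addr _ _).
  rewrite (bigD1 e1) //= (bigD1 e2) /=; last by rewrite e2K eq_sym.
  rewrite addnA; apply: leq_trans (leq_addr _ _).
  exact: leq_add (w1 e1 s1) (w1 e2 s2).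
move: tot; rewrite (bigID (mem K)) /= !addn0.
set B := (\sum_(e | e \notin K) _)%N => tot.
have [cp cq cp' cq' B0] :
    [/\ c < f p, c < f q, ~~ (c < f p'), ~~ (c < f q') & B = 0%N].
  move: (c < f p) (c < f q) (c < f p') (c < f q') tot w_ge2.
  move: B (\sum_(e | _) _)%N; clear => B S [] [] [] [] /= tot S2; split=> //; lia.
split=> //; rewrite ?leNgt // => e1 e1K; apply: w3; apply/eqP.
by move/eqP: B0; rewrite /B sum_nat_eq0 => /forall_inP; apply.
Qed.

(* Where [f] is constant no chip enters or leaves. *)
Lemma not_splits f K e t : e \in K -> 0 < t < len e ->
  (forall c, ~ splits f c K) -> div_coeff f (edge_point e t) = 0.
Proof.
move=> eK te ns; have cst u : 0 <= u <= len e -> f (edge_point e u) = f (edge_point e t).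
  move=> ue; have ute : 0 <= t <= len e by case/andP: te => /ltW -> /ltW ->.
  have on u' : 0 <= u' <= len e -> on_edges K (edge_point e u').
    by move=> ue'; exists e, u'.
  have [lt|lt|//] := ltgtP (f (edge_point e u)) (f (edge_point e t)).
    case: (ns (f (edge_point e u))); exists (edge_point e u), (edge_point e t).
    by split=> //; exact: on.
  case: (ns (f (edge_point e t))); exists (edge_point e t), (edge_point e u).
  by split=> //; exact: on.
have lin : linear_on 0 (len e) 0 (f \o edge_point e).
  move=> u ue /=; rewrite mul0r addr0 cst // [RHS]cst // lexx ltW // mg_len_gt0 //.
case/andP: te => t0 tl; rewrite div_coeff_inside ?t0 //.
rewrite (@linear_fslope _ t (len e) 0) //; last by apply: linear_onS lin => //; apply: ltW.
by rewrite (@linear_bslope _ 0 t 0) //; apply: linear_onS lin => //; apply: ltW.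
Qed.

End Levels.

(** * Two cycles attached to a hub *)

Section Theta.
Context {R : realType} (G : metric_graph R).
Local Notation V := (mg_vertex G).
Local Notation E := (mg_edge G).
Local Notation point := (mg_point G).
Local Notation len := (@mg_len R G).
Local Notation dart := (dart G).
Implicit Types (f : point -> R) (e : E) (v : V) (c t : R) (K J : {set E}).

(* A cycle [K] hangs on the hub cycle between the hub vertices [X] and [Y]: either
   they share the edge [d1], or [X = Y] is the foot of a bridge [g] leading to [K].
   At [Y] the hub continues through [b], and [eps] is an edge of [K] next to it;
   in the bridge case the hub leaves [X] on the other side through [oa]. *)
Inductive attached K J X Y (oa : option dart) (b : dart) eps : Prop :=
| AttachedEdge (d1 d2 : dart) of d1.1 \in K & d1.1 \notin J & d2.1 \in K &
    d2.1 \notin J & eps = d2.1 & dsrc d1 = Y & dtgt d1 = X & dsrc d2 = Y &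
    (forall phi : dart -> int,
       \sum_(d | dsrc d == Y) phi d = phi d1 + phi d2 + phi b)
| AttachedBridge (a g d1 d2 : dart) of oa = Some a & X = Y & g.1 \notin K &
    g.1 \notin J & dsrc g = Y & dsrc d1 = dtgt g & dsrc d2 = dtgt g &
    d1.1 \in K & d2.1 \in K & d2.1 \notin J & eps = d2.1 &
    (forall phi : dart -> int,
       \sum_(d | dsrc d == Y) phi d = phi a + phi b + phi g) &
    (forall phi : dart -> int,
       \sum_(d | dsrc d == dtgt g) phi d = phi (drev g) + phi d1 + phi d2).

Definition midpoint e := edge_point e (len e / 2).

Lemma half_len e : 0 < len e / 2 < len e.
Proof. by have := mg_len_gt0 e => l0; apply/andP; split; lra. Qed.

Lemma midpoint_inj : injective midpoint.
Proof. by move=> e e' /(edge_point_inj (half_len e)) []. Qed.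

Lemma midpoint_dpt (d : dart) : midpoint d.1 = dpt d (len d.1 / 2).
Proof. by case: d => e []; rewrite /midpoint /dpt //=; congr edge_point; field. Qed.

Lemma uncrossed_mid f c (d : dart) : uncrossed f c d.1 ->
  (c < f (midpoint d.1)) = (c < f (inl (dsrc d))).
Proof.
move=> un; have /andP[/ltW h0 /ltW h1] := half_len d.1.
by rewrite midpoint_dpt (uncrossed_dart un) // h0.
Qed.

(** The midpoint of [eps], [X] and [Y] are joined by a path outside [J], along [d1] and [d2] or over
    the bridge [g]. *)
Lemma attached_uncrossed f c K J X Y oa b eps : attached K J X Y oa b eps ->
  (forall e, e \notin J -> uncrossed f c e) ->
  (c < f (midpoint eps)) = (c < f (inl Y)) /\ (c < f (inl X)) = (c < f (inl Y)).
Proof.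
case=> [d1 d2 _ d1J _ d2J -> <- <- d21 _ un|a g d1 d2 _ -> _ gJ <- d1g d2g _ _ d2J -> _ _ un].
  by rewrite (uncrossed_mid (un _ d2J)) d21 (uncrossed_tgt (un _ d1J)).
by rewrite (uncrossed_mid (un _ d2J)) d2g (uncrossed_tgt (un _ gJ)).
Qed.

(** One arc of the hub runs from [Yk] to [Yj] through [h 0], ..., [h m], whose inner vertices have
    valence 2. The other arc is the dart [a] from [Xk] to [Xj], or a single point if [oa] is [None].
    Seen from [J] both arcs are read backwards. *)
Variables (K J : {set E}) (Xk Yk Xj Yj : V) (ek ej : E) (oa : option dart).
Variables (m : nat) (h : nat -> dart).
Hypotheses (cK : cyclic_edges K) (cJ : cyclic_edges J).
Hypothesis atK : attached K J Xk Yk oa (h 0%N) ek.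
Hypothesis atJ : attached J K Xj Yj (omap (@drev R G) oa) (drev (h m)) ej.
Hypotheses (ekK : ek \in K) (ekJ : ek \notin J) (ejJ : ej \in J) (ejK : ej \notin K).
Hypothesis h_src : dsrc (h 0%N) = Yk.
Hypothesis h_tgt : dtgt (h m) = Yj.
Hypothesis h_off : forall i, (i <= m)%N -> (h i).1 \notin K /\ (h i).1 \notin J.
Hypothesis h_path : forall i, (i < m)%N -> dsrc (h i.+1) = dtgt (h i).
Hypothesis h_inner : forall i, (i < m)%N -> forall phi : dart -> int,
  \sum_(d | dsrc d == dtgt (h i)) phi d = phi (drev (h i)) + phi (h i.+1).
Hypothesis a_spec : if oa is Some a then
    [/\ dsrc a = Xk, dtgt a = Xj, a.1 \notin K, a.1 \notin J
      & forall i, (i <= m)%N -> a.1 != (h i).1]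
  else Xk = Xj.

(* The two arcs of the hub between the cycles [K] and [J]. *)
Definition on_arcs (x : point) : Prop :=
  [\/ x = inl Xk, x = inl Xj, exists i t, [/\ (i <= m)%N, 0 <= t <= len (h i).1 & x = dpt (h i) t]
    | exists a t, [/\ oa = Some a, 0 <= t <= len a.1 & x = dpt a t]].

Lemma on_arcs_h i t : (i <= m)%N -> 0 <= t <= len (h i).1 -> on_arcs (dpt (h i) t).
Proof. by move=> im te; apply: Or43; exists i, t. Qed.

Lemma on_arcs_src i : (i <= m)%N -> on_arcs (inl (dsrc (h i))).
Proof. by move=> im; rewrite -dpt0; apply: on_arcs_h; rewrite // lexx ltW // mg_len_gt0. Qed.

Lemma on_arcs_tgt i : (i <= m)%N -> on_arcs (inl (dtgt (h i))).
Proof. by move=> im; rewrite -dpt_len; apply: on_arcs_h; rewrite // lexx ltW // mg_len_gt0. Qed.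

Lemma on_arcs_Yk : on_arcs (inl Yk).
Proof. by rewrite -h_src; exact: on_arcs_src. Qed.

Lemma on_arcs_Yj : on_arcs (inl Yj).
Proof. by rewrite -h_tgt; exact: on_arcs_tgt. Qed.

(** A level that meets only one of the cycles cannot separate the two arcs, because they are still
    joined at the attachment to the other cycle. *)
Lemma arcs_uncrossed f c :
  (forall e, e \notin K -> uncrossed f c e) \/ (forall e, e \notin J -> uncrossed f c e) ->
  forall x, on_arcs x -> (c < f x) = (c < f (inl Yk)).
Proof.
move=> un.
have unh i : (i <= m)%N -> uncrossed f c (h i).1.
  by move=> /h_off[hK hJ]; case: un => un; apply: un.
have unhs i : (i <= m)%N -> (c < f (inl (dsrc (h i)))) = (c < f (inl Yk)).
  elim: i => [|i IH] im; first by rewrite h_src.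
  by rewrite h_path // (uncrossed_tgt (unh i _)) ?IH // ltnW.
have Yjk : (c < f (inl Yj)) = (c < f (inl Yk)).
  by rewrite -h_tgt (uncrossed_tgt (unh m _)) // unhs.
have Xjk : (c < f (inl Xk)) = (c < f (inl Xj)).
  case: oa a_spec => [a [<- <- aK aJ _]|-> //].
  by rewrite uncrossed_tgt //; case: un => un; apply: un.
have Xk_ : (c < f (inl Xk)) = (c < f (inl Yk)).
  case: un => un; last by have [] := attached_uncrossed atK un.
  by rewrite Xjk; have [_ ->] := attached_uncrossed atJ un.
move=> x [->|->|[i [t [im te ->]]]|[a [t [oaE te ->]]]] //.
- by rewrite -Xjk.
- by rewrite (uncrossed_dart (unh i im)) ?unhs.
move: a_spec; rewrite oaE => -[aX _ aK aJ _].
by rewrite uncrossed_dart // ?aX //; case: un => un; apply: un.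
Qed.

Lemma arcs_off_K f c : (forall e, e \notin K -> uncrossed f c e) ->
  forall x, on_arcs x -> (c < f x) = (c < f (midpoint ej)).
Proof.
move=> un x ax; have [-> _] := attached_uncrossed atJ un.
rewrite (arcs_uncrossed (or_introl un) ax); apply/esym.
exact: (arcs_uncrossed (or_introl un) on_arcs_Yj).
Qed.

Lemma arcs_off_J f c : (forall e, e \notin J -> uncrossed f c e) ->
  forall x, on_arcs x -> (c < f x) = (c < f (midpoint ek)).
Proof.
move=> un x ax; have [-> _] := attached_uncrossed atK un.
exact: (arcs_uncrossed (or_intror un) ax).
Qed.

Lemma h_neq i : (i <= m)%N -> (h i).1 != ek /\ (h i).1 != ej.
Proof.
by move=> /h_off[hK hJ]; split; apply/eqP => he; move: hK hJ; rewrite he ?ekK ?ejJ.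
Qed.

(** If a level passed through [K], the chip at the midpoint of [ej] would start above it and the
    chip on the arc would end below, although [arcs_off_K] puts both points on the same side;
    likewise for [J]. So [f] is constant on each cycle and both midpoints keep a chip, but only [q']
    is left for the two. *)
Lemma midpoints_reduced f p q q' : p = midpoint ek -> q = midpoint ej ->
  ~ moves f [:: p; q] [:: midpoint (h 0%N).1; q'].
Proof.
move=> -> -> mf; set t := midpoint (h 0%N).1 in mf.
have [tk tj] := h_neq (leq0n m).
have at_ : on_arcs t.
  have /andP[/ltW l0 /ltW l1] := half_len (h 0%N).1.
  by rewrite /t midpoint_dpt; apply: on_arcs_h; rewrite // l0.
have nK c : ~ splits f c K.
  move=> sp; have [_ cj tc _ un] := splitsP mf cK sp.
  by move: cj; rewrite -(arcs_off_K un at_) ltNge tc.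
have nJ c : ~ splits f c J.
  move=> sp; have [ck _ tc _ un] := splitsP mf cJ sp.
  by move: ck; rewrite -(arcs_off_J un at_) ltNge tc.
have := not_splits ekK (half_len ek) nK; rewrite mf.2 /= -/(midpoint ek) => q'k.
have := not_splits ejJ (half_len ej) nJ; rewrite mf.2 /= -/(midpoint ej) => q'j.
move: q'k q'j; rewrite !eqxx !(inj_eq midpoint_inj) (negbTE tk) (negbTE tj).
have ne : (ek == ej) = false by apply: contraNF ekJ => /eqP ->.
rewrite [ej == ek]eq_sym ne.
case: eqP => [->|]; last by [].
by rewrite (inj_eq midpoint_inj) ne.
Qed.

Lemma moves_swap f x y D : moves f [:: x; y] D -> moves f [:: y; x] D.
Proof. by case=> rf df; split=> // z; rewrite df /= !addn0 addnC. Qed.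

Lemma on_edges_dpt (L : {set E}) (d : dart) t : d.1 \in L -> 0 <= t <= len d.1 ->
  on_edges L (dpt d t).
Proof.
case: d => e [] /= eL /andP[t0 tl]; rewrite /dpt /=.
  by exists e, t; rewrite t0.
by exists e, (len e - t); split=> //; apply/andP; split; lra.
Qed.

Lemma on_edges_src (L : {set E}) (d : dart) : d.1 \in L -> on_edges L (inl (dsrc d)).
Proof. by move=> dL; rewrite -dpt0; apply: on_edges_dpt; rewrite // lexx ltW // mg_len_gt0. Qed.

Lemma on_edges_tgt (L : {set E}) (d : dart) : d.1 \in L -> on_edges L (inl (dtgt d)).
Proof. by move=> dL; rewrite -dpt_len; apply: on_edges_dpt; rewrite // lexx ltW // mg_len_gt0. Qed.

Lemma splits_min f (L : {set E}) x y : on_edges L x -> on_edges L y ->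
  (forall c, splits f c L -> f x <= c) -> f x <= f y.
Proof.
move=> Lx Ly min; have [//|yx] := leP (f x) (f y).
by have := min (f y); rewrite leNgt yx; apply; exists y, x.
Qed.

Lemma splits_max f (L : {set E}) x y : on_edges L x -> on_edges L y ->
  (forall c, splits f c L -> c < f x) -> f y <= f x.
Proof.
move=> Lx Ly max; have [//|xy] := leP (f y) (f x).
by have := max (f x); rewrite ltxx; apply; exists x, y.
Qed.

(** * Descent of the two chips from [K] to [J] along the arcs *)

Section Moves.
Variables (f : point -> R) (qk qj : point) (c c' : R).
Hypothesis mf : moves f [:: midpoint ek; qk] [:: midpoint ej; qj].
Hypotheses (spK : splits f c K) (spJ : splits f c' J).

Let rf : rational_function f := mf.1.

Lemma arcs_below c1 x : splits f c1 K -> on_arcs x -> f x <= c1.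
Proof.
move=> sp ax; have [_ _ zc _ un] := splitsP mf cK sp.
by rewrite leNgt (arcs_off_K un ax) -leNgt.
Qed.

Lemma arcs_above c1 x : splits f c1 J -> on_arcs x -> c1 < f x.
Proof.
move=> sp ax; have [zc _ _ _ un] := splitsP mf cJ sp.
by rewrite (arcs_off_J un ax).
Qed.

(** By [splitsP] both chips start above [c] and end at or below [c'], so none is placed or removed
    in between. *)
Lemma chip_free x : f x <= c -> c' < f x -> div_coeff f x = 0.
Proof.
move=> xc cx; have [k1 k2 _ _ _] := splitsP mf cK spK.
have [_ _ j1 j2 _] := splitsP mf cJ spJ.
have above y : c < f y -> (y == x) = false.
  by move=> cy; apply/negP => /eqP yx; move: cy; rewrite yx ltNge xc.
have below y : f y <= c' -> (y == x) = false.
  by move=> cy; apply/negP => /eqP yx; move: cy; rewrite yx leNgt cx.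
by rewrite mf.2 /= (above _ k1) (above _ k2) (below _ j1) (below _ j2).
Qed.

(** From a lowest point of [K] the function cannot descend within [K]. Along [ek] it cannot start
    horizontally either: with no chip on the way it would keep its value up to the midpoint, where a
    chip starts above [c]. *)
Lemma start_slope v (d : dart) : (forall c1, splits f c1 K -> f (inl v) <= c1) ->
  c' < f (inl v) -> dsrc d = v -> d.1 \in K ->
  0 <= dslope f d /\ (d.1 = ek -> dslope f d != 0).
Proof.
move=> vmin cv dv dK; split.
  apply: dslope_ge0 => // t te.
  by apply: (splits_min (on_edges_src dK) (on_edges_dpt dK te)); rewrite dv.
move=> de; apply/eqP => d0; have [k1 _ _ _ _] := splitsP mf cK spK.
have lin : linear_on 0 (len d.1) (dslope f d) (f \o dpt d).
  apply: dart_linear => // t te; rewrite d0 mul0r addr0 dv => tv.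
  by apply: chip_free; rewrite tv // vmin.
have := lin (len d.1 / 2); rewrite d0 mul0r addr0 /= dpt0 -midpoint_dpt de.
have /andP[/ltW l0 /ltW l1] := half_len ek; rewrite l0 l1 => /(_ isT) e.
by move: k1; rewrite e dv ltNge vmin.
Qed.

(** With a shared edge, [Xk] and [Yk] are both lowest points of [K]. As [Yk] carries no chip its
    outgoing slopes cancel, and those into [K] total at least 1, so the arc descends. With a bridge
    the same holds at its far end; [f] is linear on the bridge, and the descent at [Yk] may be
    shared by both arcs. *)
Lemma ends_K : f (inl Xk) = f (inl Yk) /\
  (dslope f (h 0%N) <= -1 \/
   exists2 a, oa = Some a & dslope f a + dslope f (h 0%N) <= -1).
Proof.
have Ymin c1 : splits f c1 K -> f (inl Yk) <= c1.
  by move=> sp; apply: arcs_below on_arcs_Yk.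
have Yc' : c' < f (inl Yk) by apply: arcs_above on_arcs_Yk.
have divY : div_coeff f (inl Yk) = 0 by apply: chip_free => //; apply: Ymin.
case: atK => [d1 d2 d1K _ d2K _ ed2 d1Y d1X d2Y out
            |a g d1 d2 oaE XY gK gJ gY d1w d2w d1K d2K _ ed2 outY outw].
  split.
    have YK : on_edges K (inl Yk) by rewrite -d1Y; exact: on_edges_src.
    have XK : on_edges K (inl Xk) by rewrite -d1X; exact: on_edges_tgt.
    apply/eqP; rewrite eq_le (splits_min YK XK Ymin) andbT.
    by apply: (splits_min XK YK) => c1 sp; apply: arcs_below => //; exact: Or41.
  have [p1 _] := start_slope Ymin Yc' d1Y d1K.
  have [p2 /(_ (esym ed2)) p3] := start_slope Ymin Yc' d2Y d2K.
  left; move: divY; rewrite div_coeff_darts out; lia.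
split; first by rewrite XY.
right; exists a => //.
have wmin c1 : splits f c1 K -> f (inl (dtgt g)) <= c1.
  move=> sp; have [_ _ _ _ un] := splitsP mf cK sp.
  by rewrite leNgt (uncrossed_tgt (un _ gK)) gY -leNgt Ymin.
have wc' : c' < f (inl (dtgt g)).
  have [_ _ _ _ un] := splitsP mf cJ spJ.
  by rewrite (uncrossed_tgt (un _ gJ)) gY.
have [p1 _] := start_slope wmin wc' d1w d1K.
have [p2 /(_ (esym ed2)) p3] := start_slope wmin wc' d2w d2K.
have lin : linear_on 0 (len g.1) (dslope f g) (f \o dpt g).
  apply: dart_linear => // t /andP[/ltW t0 /ltW tl] _.
  have [_ _ _ _ unK] := splitsP mf cK spK; have [_ _ _ _ unJ] := splitsP mf cJ spJ.
  apply: chip_free; last by rewrite (uncrossed_dart (unJ _ gJ)) ?t0 // gY.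
  by rewrite leNgt (uncrossed_dart (unK _ gK)) ?t0 // gY -leNgt Ymin.
have divw : div_coeff f (inl (dtgt g)) = 0 by apply: chip_free => //; apply: wmin.
move: divY divw; rewrite !div_coeff_darts outY outw (linear_dslope_rev lin); lia.
Qed.

Lemma ends_J : f (inl Xj) = f (inl Yj).
Proof.
case: atJ => [d1 d2 d1J _ _ _ _ d1Y d1X _ _|a g d1 d2 _ -> *] //.
have YJ : on_edges J (inl Yj) by rewrite -d1Y; exact: on_edges_src.
have XJ : on_edges J (inl Xj) by rewrite -d1X; exact: on_edges_tgt.
apply/eqP; rewrite eq_le; apply/andP; split.
  by apply: (splits_max YJ XJ) => c1 sp; apply: arcs_above on_arcs_Yj.
by apply: (splits_max XJ YJ) => c1 sp; apply: arcs_above => //; exact: Or42.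
Qed.

Lemma arcs_free x : on_arcs x -> div_coeff f x = 0.
Proof. by move=> ax; apply: chip_free; [apply: arcs_below|apply: arcs_above]. Qed.

(** At an inner vertex of the arc there are only two outgoing slopes and no chip, so the slope is
    passed on unchanged. *)
Lemma arc_linear i : (i <= m)%N ->
  linear_on 0 (len (h i).1) (dslope f (h 0%N)) (f \o dpt (h i)).
Proof.
have lin j : (j <= m)%N -> linear_on 0 (len (h j).1) (dslope f (h j)) (f \o dpt (h j)).
  move=> jm; apply: dart_linear => // t /andP[/ltW t0 /ltW tl] _.
  by apply: arcs_free; apply: on_arcs_h; rewrite // t0.
suff sl j : (j <= m)%N -> dslope f (h j) = dslope f (h 0%N).
  by move=> im; rewrite -(sl i im); exact: lin.
elim: j => // j IH jm; rewrite -IH; last exact: ltnW.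
have := arcs_free (on_arcs_tgt (ltnW jm)); rewrite div_coeff_darts h_inner //.
rewrite (linear_dslope_rev (lin j (ltnW jm))); lia.
Qed.

Lemma arc_drop i : (i <= m)%N ->
  f (inl (dtgt (h i))) = f (inl Yk)
    + (dslope f (h 0%N))%:~R * \sum_(j < i.+1) len (h j).1.
Proof.
have step j : (j <= m)%N -> f (inl (dtgt (h j))) = f (inl (dsrc (h j)))
    + (dslope f (h 0%N))%:~R * len (h j).1.
  move=> jm; have := arc_linear jm (t := len (h j).1).
  rewrite lexx ltW ?mg_len_gt0 // => /(_ isT).
  by rewrite /= dpt_len dpt0 subr0.
elim: i => [|i IH] im; first by rewrite step // h_src big_ord_recr big_ord0 /= add0r.
rewrite step // h_path // IH; last exact: ltnW.
by rewrite [in RHS]big_ord_recr /=; ring.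
Qed.

Lemma equal_arcs : exists2 a, oa = Some a & \sum_(j < m.+1) len (h j).1 = len a.1.
Proof.
have [XYk slopes] := ends_K; have XYj := ends_J.
have := arc_drop (leqnn m); rewrite h_tgt.
set L := \sum_(j < m.+1) _; set s := dslope f (h 0%N) in slopes * => drop.
have L0 : 0 < L.
  rewrite /L big_ord_recl ltr_pwDl ?mg_len_gt0 //.
  by apply: sumr_ge0 => i _; rewrite ltW ?mg_len_gt0.
move: a_spec slopes; case oaE: oa => [a|]; last first.
  (* An arc reduced to a point forces equal values at both cycles, whereas the long arc descends
     strictly. *)
  move=> XX [s1|[//]].
  have : (s%:~R : R) <= -1 by rewrite -[-1]/((-1)%:~R) ler_int.
  by move: drop; rewrite -XYj -XX XYk => drop s1'; nra.
move=> [aX aX' aK aJ ah] slopes; exists a => //.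
have lin : linear_on 0 (len a.1) (dslope f a) (f \o dpt a).
  apply: dart_linear => // t /andP[/ltW t0 /ltW tl] _.
  by apply: arcs_free; apply: Or44; exists a, t; rewrite t0.
have := lin (len a.1); rewrite lexx ltW ?mg_len_gt0 // => /(_ isT).
rewrite /= dpt_len dpt0 subr0 aX aX' XYj XYk drop => /addrI dropa.
have a0 := mg_len_gt0 a.1.
have {slopes} [s1 sa1] : s <= -1 /\ dslope f a <= -1.
  (* Both arcs span the same difference of heights, so their slopes have the same sign; one slope,
     or their sum, is at most -1, hence both are negative. *)
  have key : forall x y : R, x * L = y * len a.1 -> (x <= -1 -> y < 0) /\
      (x + y <= -1 -> x < 0 /\ y < 0).
    move=> x y e; have sgn : (x < 0) = (y < 0).
      by rewrite -(pmulr_llt0 x L0) -(pmulr_llt0 y a0) e.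
    rewrite -sgn; split=> [x1|xy]; first exact: le_lt_trans x1 (ltrN10 _).
    suff x0 : x < 0 by [].
    rewrite ltNge; apply/negP => x0; have : 0 <= y by rewrite leNgt -sgn -leNgt.
    by move=> /(addr_ge0 x0); rewrite leNgt (le_lt_trans xy (ltrN10 _)).
  have [k1 k2] := key _ _ dropa.
  have neg (z : int) : (z%:~R : R) < 0 -> z <= -1 by rewrite ltrz0 -lezD1 => z0; rewrite -(lerD2r 1) addNr.
  have le1 (z : int) : z <= -1 -> (z%:~R : R) <= -1.
    by rewrite -[(-1 : R)]/((-1)%:~R) ler_int.
  case: slopes => [s1|[a' [<-]]]; first by split=> //; apply/neg/k1/le1.
  by rewrite addrC => /le1; rewrite rmorphD /= => /k2[/neg ? /neg ?].
have le1 (z : int) : z <= -1 -> (z%:~R : R) <= -1.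
  by rewrite -[(-1 : R)]/((-1)%:~R) ler_int.
have jk : f (inl Yj) < f (inl Yk) by rewrite drop; have := le1 _ s1; nra.
(* At the height of [Yj] the strict comparison puts the start of both arcs above the level and their
   end below. Each arc is therefore crossed, and the total weight 2 leaves exactly slope -1 for
   each. *)
have [w /(_ (f (inl Yj)))[tot _ _ _ w4]] := crossing_weights mf.
have wdart (d : dart) (n : int) : linear_on 0 (len d.1) n (f \o dpt d) ->
    (f (inl Yj) < f (inl (dsrc d))) != (f (inl Yj) < f (inl (dtgt d))) ->
    w (f (inl Yj)) d.1 = `|n|%N.
  move=> /linear_edge[n' lin' <-] ne; apply: w4 => //.
  by move: ne; case: (d) => e []; rewrite // eq_sym.
have wa : w (f (inl Yj)) a.1 = `|dslope f a|%N.
  by apply: wdart => //; rewrite aX aX' XYk XYj jk ltxx.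
have [i im wi] : exists2 i, (i <= m)%N & w (f (inl Yj)) (h i).1 = `|s|%N.
  apply: contrapT => no.
  have all_above i : (i <= m)%N -> f (inl Yj) < f (inl (dsrc (h i))).
    elim: i => [|i IH] im; first by rewrite h_src.
    rewrite h_path //; have := IH (ltnW im) => ab.
    apply/negPn/negP => nb; apply: no; exists i; first exact: ltnW.
    by apply: wdart (arc_linear (ltnW im)) _; rewrite ab (negbTE nb).
  apply: no; exists m => //; apply: wdart (arc_linear (leqnn m)) _.
  by rewrite all_above // h_tgt ltxx.
have wtot : (w (f (inl Yj)) a.1 + w (f (inl Yj)) (h i).1 <= 2)%N.
  apply: leq_trans (_ : \sum_e w (f (inl Yj)) e <= 2)%N.
    rewrite (bigD1 a.1) //= (bigD1 (h i).1) /=; last by rewrite eq_sym ah.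
    by rewrite addnA leq_addr.
  apply: (@leq_trans (count (fun x => f (inl Yj) < f x)%R [:: midpoint ek; qk])).
    by rewrite -tot leq_addr.
  exact: (@count_size point).
move: dropa; rewrite wa wi in wtot.
have -> : s = -1 by lia.
have -> : dslope f a = -1 by lia.
by rewrite rmorphN !mulN1r => /oppr_inj.
Qed.

End Moves.

Lemma hyperelliptic_arcs : hyperelliptic G ->
  exists2 a, oa = Some a & \sum_(j < m.+1) len (h j).1 = len a.1.
Proof.
move=> /hyperelliptic_moves[q qP].
have [f mf] := qP (midpoint ek) (midpoint ej).
have ne : (ek == ej) = false by apply: contraNF ekJ => /eqP ->.
have [g mg] := qP (midpoint ek) (midpoint (h 0%N).1).
have [g' mg'] := qP (midpoint ej) (midpoint (h 0%N).1).
(* If [f] were constant on [K], the chip at the midpoint of [ek] would have to stay, so it would be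
   [q] of the midpoint of [ej]; but [midpoints_reduced] forbids moving these two midpoints to an
   arc. The case of [J] is symmetric. *)
have [c spK] : exists c, splits f c K.
  apply: contrapT => ns; have nK c : ~ splits f c K by move=> sp; apply: ns; exists c.
  have := not_splits ekK (half_len ek) nK; rewrite mf.2 /= -/(midpoint ek).
  rewrite eqxx (inj_eq midpoint_inj) [ej == ek]eq_sym ne.
  case: eqP => [qj _|]; last by case: eqP.
  move: mg'; rewrite qj => /moves_swap; exact: midpoints_reduced.
have [c' spJ] : exists c, splits f c J.
  apply: contrapT => ns; have nJ c1 : ~ splits f c1 J by move=> sp; apply: ns; exists c1.
  have := not_splits ejJ (half_len ej) nJ; rewrite mf.2 /= -/(midpoint ej).
  rewrite eqxx (inj_eq midpoint_inj) ne.
  case: (q (midpoint ek) =P _) => [qk _|]; last by case: eqP.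
  move: mg; rewrite qk; exact: midpoints_reduced.
exact: (equal_arcs mf spK spJ).
Qed.

End Theta.

Local Notation coord := Defs.coord.
Local Notation primitive := Defs.primitive.

(** * Unimodular triangulations *)

Section Lattice.
Context {R : realType} {d : nat}.
Local Notation lp := (lattice_point d).
Implicit Types (p q r z : lp) (S T : {set lp}).

Definition det p q r : int :=
  ((coord q).1 - (coord p).1) * ((coord r).2 - (coord p).2)
    - ((coord q).2 - (coord p).2) * ((coord r).1 - (coord p).1).

Lemma det_rot p q r : det q r p = det p q r. Proof. by rewrite /det; ring. Qed.
Lemma det_swap p q r : det q p r = - det p q r. Proof. by rewrite /det; ring. Qed.

Lemma det_neq p q r : det p q r != 0 -> [/\ p != q, p != r & q != r].
Proof.
by move=> h; split; apply: contraNneq h => ->; rewrite /det; apply/eqP; ring.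
Qed.

Lemma sum3 (M : nmodType) p q r (F : lp -> M) : det p q r != 0 ->
  \sum_(z in [set p; q; r]%SET) F z = F p + F q + F r.
Proof.
move=> /det_neq[pq pr qr]; rewrite finset.setUC big_setU1 ?big_setU1 ?big_set1 /=; first by rewrite addrC.
  by rewrite inE.
by rewrite !inE negb_or eq_sym pr eq_sym qr.
Qed.

Lemma unimodularP S : unimodular_triangle S <->
  exists p q r, S = [set p; q; r]%SET /\ det p q r = 1.
Proof.
split=> [[p [q [r [-> h]]]]|[p [q [r [-> h]]]]]; last first.
  by exists p, q, r; split=> //; rewrite /twice_area -/(det p q r) h.
have [h1|h1] : det p q r = 1 \/ det q p r = 1.
  by move: h; rewrite /twice_area -/(det p q r) [det q p r]det_swap; lia.
  by exists p, q, r.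
by exists q, p, r; split=> //; rewrite [X in _ = (X :|: _)%SET]finset.setUC.
Qed.

Lemma unimodular_ccw S p q : unimodular_triangle S -> p \in S -> q \in S -> p != q ->
  exists2 r, S = [set p; q; r]%SET & `|det p q r| = 1.
Proof.
move=> [x [y [z [-> h]]]].
have h' : `|det x y z| = 1 by [].
have sw a b c : ([set a; b; c] = [set b; a; c] :> {set lp})%SET by rewrite [X in (X :|: _)%SET]finset.setUC.
have ro a b c : ([set a; b; c] = [set b; c; a] :> {set lp})%SET.
  by rewrite -finset.setUA finset.setUC.
have dsw a b c : `|det b a c| = `|det a b c| by rewrite det_swap normrN.
have dro a b c : `|det b c a| = `|det a b c| by rewrite det_rot.
rewrite !inE -!orbA => /or3P[] /eqP -> /or3P[] /eqP ->; rewrite ?eqxx // => _.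
- by exists z.
- exists y; [by rewrite finset.setUAC | by rewrite -dro -dsw dro].
- exists z; [by rewrite sw | by rewrite dsw].
- exists x; [by rewrite ro | by rewrite dro].
- exists y; [by rewrite -ro | by rewrite -dro].
- exists x; [by rewrite ro sw | by rewrite dsw dro].
Qed.

(** Uniqueness of barycentric coordinates; the combinations below are Cramer's rule with determinant
    1. *)
Lemma affine_independent S (w : lp -> R) : unimodular_triangle S ->
  \sum_(p in S) w p = 0 -> \sum_(p in S) w p * (coord p).1%:~R = 0 ->
  \sum_(p in S) w p * (coord p).2%:~R = 0 -> forall p, p \in S -> w p = 0.
Proof.
move=> /unimodularP[p [q [r [-> d1]]]]; have d0 : det p q r != 0 by rewrite d1.
rewrite !(sum3 _ d0) => s0 sx sy.
have dR : (det p q r)%:~R = 1 :> R by rewrite d1.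
move: dR; rewrite /det !(rmorphB, rmorphM) /=.
move: (coord p).1%:~R (coord p).2%:~R (coord q).1%:~R (coord q).2%:~R
  (coord r).1%:~R (coord r).2%:~R sx sy => px py qx qy rx ry sx sy dR.
have wr : w r = 0.
  have -> : w r = w r * ((qx - px) * (ry - py) - (qy - py) * (rx - px)) by rewrite dR mulr1.
  have wp : w p = - w q - w r by lra.
  move: sx sy; rewrite wp => sx sy.
  transitivity ((qx - px) * ((- w q - w r) * py + w q * qy + w r * ry)
     - (qy - py) * ((- w q - w r) * px + w q * qx + w r * rx)); first by ring.
  by rewrite sx sy !mulr0 subrr.
have wq : w q = 0.
  have -> : w q = w q * ((qx - px) * (ry - py) - (qy - py) * (rx - px)) by rewrite dR mulr1.
  have wp : w p = - w q - w r by lra.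
  move: sx sy; rewrite wp => sx sy.
  transitivity ((ry - py) * ((- w q - w r) * px + w q * qx + w r * rx)
     - (rx - px) * ((- w q - w r) * py + w q * qy + w r * ry)); first by ring.
  by rewrite sx sy !mulr0 subrr.
by move=> z; rewrite !inE -!orbA => /or3P[] /eqP -> //; lra.
Qed.

Variable X : {set {set lp}}.
Hypothesis triX : unimodular_triangulation R X.

Definition linked p q : bool := (p != q) && [exists S in X, (p \in S) && (q \in S)].

Lemma linkedP p q : reflect (p != q /\ exists2 S, S \in X & p \in S /\ q \in S) (linked p q).
Proof.
apply: (iffP andP) => -[pq].
  by move=> /exists_inP[S SX /andP[]]; split=> //; exists S.
by case=> S SX [pS qS]; split=> //; apply/exists_inP; exists S; rewrite ?pS.
Qed.

Lemma linked_sym p q : linked p q = linked q p.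
Proof.
by apply/linkedP/linkedP => -[pq [S SX [? ?]]]; (split; first by rewrite eq_sym);
  exists S.
Qed.

(** The determinant of a triangle on this side is 1 or -1, which is a Bezout relation between the
    coordinates of [q - p]. *)
Lemma linked_primitive p q : linked p q -> primitive (coord q - coord p).
Proof.
move=> /linkedP[pq [S SX [pS qS]]]; have [_ uni _ _] := triX.
have [r _ h] := unimodular_ccw (uni S SX) pS qS pq.
rewrite /primitive; apply/coprimezP => /=.
have [h1|h1] : det p q r = 1 \/ det p q r = -1 by lia.
  exists ((coord r).2 - (coord p).2, - ((coord r).1 - (coord p).1)) => /=.
  by rewrite -[RHS]h1 /det /=; ring.
exists (- ((coord r).2 - (coord p).2), (coord r).1 - (coord p).1) => /=.
by rewrite -[RHS]opprK -h1 /det /=; ring.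
Qed.

(** A crossing in the interior of both segments: with a common end one of the determinants would
    vanish. *)
Definition cross p q p' q' : bool :=
  (det p q p' * det p q q' < 0) && (det p' q' p * det p' q' q < 0).

Lemma segment_weights S p q (w : lp -> R) (s t : R) : unimodular_triangle S ->
  p \in S -> q \in S -> p != q -> s + t = 1 -> \sum_(z in S) w z = 1 ->
  \sum_(z in S) w z * (coord z).1%:~R = s * (coord p).1%:~R + t * (coord q).1%:~R ->
  \sum_(z in S) w z * (coord z).2%:~R = s * (coord p).2%:~R + t * (coord q).2%:~R ->
  forall z, z \in S -> w z = (z == p)%:R * s + (z == q)%:R * t.
Proof.
move=> uS pS qS pq st1 w1 wx wy z zS; pose v z := (z == p)%:R * s + (z == q)%:R * t.
have sumv (F : lp -> R) : \sum_(z in S) v z * F z = s * F p + t * F q.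
  rewrite (bigD1 p) //= (bigD1 q) /=; last by rewrite qS eq_sym.
  have qp : (q == p) = false by rewrite eq_sym (negbTE pq).
  rewrite /v !eqxx (negbTE pq) qp big1 => [|y]; first by rewrite /= !(mulr1n, mulr0n); ring.
  by move=> /andP[/andP[_ /negbTE ->] /negbTE ->]; rewrite /= mulr0n; ring.
apply/eqP; rewrite -subr_eq0; apply/eqP.
apply: (affine_independent (w := fun z => w z - v z) uS) zS.
- rewrite sumrB w1 (eq_bigr (fun z => v z * 1)) ?sumv => [|y _]; last by rewrite mulr1.
  by rewrite !mulr1 st1 subrr.
- by under eq_bigr do rewrite mulrBl; rewrite sumrB wx sumv subrr.
- by under eq_bigr do rewrite mulrBl; rewrite sumrB wy sumv subrr.
Qed.

Lemma segment_hull S p q (s t : R) (x : R * R) : p \in S -> q \in S -> p != q ->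
  0 <= s -> 0 <= t -> s + t = 1 ->
  x.1 = s * (coord p).1%:~R + t * (coord q).1%:~R ->
  x.2 = s * (coord p).2%:~R + t * (coord q).2%:~R -> hull S x.
Proof.
move=> pS qS pq s0 t0 st x1 x2; pose v z : R := (z == p)%:R * s + (z == q)%:R * t.
have qp : (q == p) = false by rewrite eq_sym (negbTE pq).
have sumv (F : lp -> R) : \sum_(z in S) v z * F z = s * F p + t * F q.
  rewrite (bigD1 p) //= (bigD1 q) /=; last by rewrite qS eq_sym.
  rewrite /v !eqxx (negbTE pq) qp big1 => [|y]; first by rewrite /= !(mulr1n, mulr0n); ring.
  by move=> /andP[/andP[_ /negbTE ->] /negbTE ->]; rewrite /= mulr0n; ring.
exists v; split=> [z||//|//]; rewrite ?sumv //.
  by rewrite /v addr_ge0 ?mulr_ge0 ?ler0n.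
have := sumv (fun=> 1); rewrite !mulr1 st => <-.
by apply: eq_bigr => z _; rewrite mulr1.
Qed.

Lemma hull_subset_weights S T p q (w : lp -> R) (s t : R) (x : R * R) :
  unimodular_triangle S -> T \subset S -> p \in S -> q \in S -> p != q -> s + t = 1 ->
  x.1 = s * (coord p).1%:~R + t * (coord q).1%:~R ->
  x.2 = s * (coord p).2%:~R + t * (coord q).2%:~R ->
  \sum_(z in T) w z = 1 -> x.1 = \sum_(z in T) w z * (coord z).1%:~R ->
  x.2 = \sum_(z in T) w z * (coord z).2%:~R ->
  forall z, z \in S -> (if z \in T then w z else 0) = (z == p)%:R * s + (z == q)%:R * t.
Proof.
move=> uS /fintype.subsetP TS pS qS pq st x1 x2 w1 wx wy.
have ext (F : lp -> R) : \sum_(z in S) (if z \in T then w z else 0) * F z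
    = \sum_(z in T) w z * F z.
  rewrite [LHS](bigID (mem T)) /= addrC big1 ?add0r => [|z /andP[_ /negbTE ->]].
    by apply: eq_big => z => [|/andP[_ ->] //]; have /implyP := TS z; case: (z \in S); case: (z \in T).
  by rewrite mul0r.
apply: (segment_weights uS pS qS pq st); rewrite ?ext -?wx -?wy //.
have := ext (fun=> 1); under eq_bigr do rewrite mulr1; move=> ->.
by under eq_bigr do rewrite mulr1.
Qed.

(** The two quotients are the weights of the zero of an affine function with end values [x] and
    [y]. *)
Lemma opposite_weights (x y : R) : x * y < 0 ->
  [/\ x - y != 0, 0 < - y / (x - y) & 0 < x / (x - y)].
Proof.
move=> xy; have [x0|x0] := ltP 0 x.
  have y0 : y < 0 by rewrite -(pmulr_rlt0 _ x0).
  by split; [rewrite gt_eqF | apply: divr_gt0 | apply: divr_gt0]; lra.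
have {}x0 : x < 0 by rewrite lt_neqAle x0 andbT; apply: contraTneq xy => ->; rewrite mul0r ltxx.
have y0 : 0 < y by rewrite -(nmulr_rlt0 _ x0).
have -> : - y / (x - y) = y / (y - x) by rewrite -[x - y]opprB invrN mulrNN.
have -> : x / (x - y) = - x / (y - x) by rewrite -[x - y]opprB invrN mulrN mulNr.
by split; [rewrite lt_eqF | apply: divr_gt0 | apply: divr_gt0]; lra.
Qed.

(** The crossing point lies in the hulls of [S] and [S'], hence in that of their common vertices. By
    uniqueness its weights sit on [p], [q] and also, positively, on [p'], [q']. So [p'] is [p] or
    [q], against the nonzero determinant. *)
Lemma linked_no_cross p q p' q' :
  linked p q -> linked p' q' -> ~~ cross p q p' q'.
Proof.
move=> /linkedP[pq [S SX [pS qS]]] /linkedP[pq' [S' SX' [pS' qS']]].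
apply/negP => /andP[c1 c2]; have [_ uni _ inter] := triX.
have uS := uni _ SX; have uS' := uni _ SX'.
pose a : R := (det p q p')%:~R; pose b : R := (det p q q')%:~R.
pose a' : R := (det p' q' p)%:~R; pose b' : R := (det p' q' q)%:~R.
have ab : a * b < 0 by rewrite /a /b -rmorphM /= ltrz0.
have ab' : a' * b' < 0 by rewrite /a' /b' -rmorphM /= ltrz0.
have e : a' - b' = b - a.
  by rewrite /a /b /a' /b' -!rmorphB /=; congr (_%:~R); rewrite /det; ring.
have [d0' s0 t0] := opposite_weights ab'; have [d0 s0' t0'] := opposite_weights ab.
pose x : R * R :=
  (- b' / (a' - b') * (coord p).1%:~R + a' / (a' - b') * (coord q).1%:~R,
   - b' / (a' - b') * (coord p).2%:~R + a' / (a' - b') * (coord q).2%:~R).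
have coef (u v u' v' : R) : (b - a) * ((- b' * u + a' * v) - (b * u' - a * v')) = 0 ->
    - b' / (a' - b') * u + a' / (a' - b') * v = - b / (a - b) * u' + a / (a - b) * v'.
  move=> /eqP; rewrite mulf_eq0 -e (negbTE d0') /= subr_eq0 => /eqP h.
  have -> : a - b = - (a' - b') by rewrite e opprB.
  rewrite invrN; set i := (a' - b')^-1.
  transitivity (i * (- b' * u + a' * v)); first by ring.
  by rewrite h; ring.
have x1' : x.1 = - b / (a - b) * (coord p').1%:~R + a / (a - b) * (coord q').1%:~R.
  by apply: coef; rewrite /a' /b' /a /b /det !(rmorphB, rmorphM) /=; ring.
have x2' : x.2 = - b / (a - b) * (coord p').2%:~R + a / (a - b) * (coord q').2%:~R.
  by apply: coef; rewrite /a' /b' /a /b /det !(rmorphB, rmorphM) /=; ring.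
have st : - b' / (a' - b') + a' / (a' - b') = 1 by rewrite -mulrDl addrC divff.
have st' : - b / (a - b) + a / (a - b) = 1 by rewrite -mulrDl addrC divff.
have [w [w0 w1 wx wy]] : hull (S :&: S')%SET x.
  rewrite -inter //; split.
    by apply: (segment_hull pS qS pq _ _ st); rewrite // ltW.
  by apply: (segment_hull pS' qS' pq' _ _ st' x1' x2'); rewrite ltW.
have wS := hull_subset_weights (x := x) uS (finset.subsetIl _ _) pS qS pq st erefl erefl w1 wx wy.
have wS' := hull_subset_weights (x := x) uS' (finset.subsetIr _ _) pS' qS' pq' st' x1' x2' w1 wx wy.
have : (if p' \in (S :&: S')%SET then w p' else 0) != 0.
  rewrite wS' // eqxx (negbTE pq') mul1r mul0r addr0 gt_eqF //.
case: ifP; rewrite ?eqxx // => pT _; have pS1 : p' \in S.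
  by move: pT; rewrite inE => /andP[].
have := wS p' pS1; rewrite pT.
have := wS' p' pS'; rewrite pT eqxx (negbTE pq') mul1r mul0r addr0 => ->.
case: eqP c1 => [->|_] c1.
  by move: c1; rewrite (_ : det p q p = 0) ?mul0r ?ltxx // /det; ring.
case: eqP c1 => [->|_] c1.
  by move: c1; rewrite (_ : det p q q = 0) ?mul0r ?ltxx // /det; ring.
by rewrite !mul0r addr0 => s'0; move: s0'; rewrite s'0 ltxx.
Qed.

Lemma sum_two (a b c : int) : 0 <= a -> 0 <= b -> 0 <= c -> a + b + c = 2 ->
  [\/ [\/ [/\ a = 2, b = 0 & c = 0], [/\ a = 0, b = 2 & c = 0] | [/\ a = 0, b = 0 & c = 2]],
     [/\ a = 1, b = 1 & c = 0], [/\ a = 1, b = 0 & c = 1] | [/\ a = 0, b = 1 & c = 1]].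
Proof.
move=> a0 b0 c0 s; have [a1|[a1|a1]] : a = 0 \/ a = 1 \/ a = 2 by lia.
- have [b1|[b1|b1]] : b = 0 \/ b = 1 \/ b = 2 by lia.
  + by apply: Or41; apply: Or33; split; lia.
  + by apply: Or44; split; lia.
  + by apply: Or41; apply: Or32; split; lia.
- have [b1|b1] : b = 0 \/ b = 1 by lia.
  + by apply: Or43; split; lia.
  + by apply: Or42; split; lia.
by apply: Or41; apply: Or31; split; lia.
Qed.

(** In a unimodular triangle the doubled barycentric coordinates of a half-lattice point are
    non-negative integers with sum 2, so the point is a vertex or the midpoint of a side. *)
Lemma half_point_edge (m : int * int) :
  @big_triangle R d (m.1%:~R / 2, m.2%:~R / 2) ->
  exists p q, [/\ coord p + coord q = m & p = q \/ linked p q].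
Proof.
have [_ uni cover _] := triX; rewrite -cover => -[S SX [w [w0 w1 wx wy]]].
have [p [q [r [SE d1]]]] := (unimodularP S).1 (uni S SX).
have d0 : det p q r != 0 by rewrite d1.
have [pq pr qr] := det_neq d0.
have adj x y : x \in S -> y \in S -> x = y \/ linked x y.
  move=> xS yS; case: (eqVneq x y) => [|xy]; [by left | right].
  by apply/linkedP; split=> //; exists S.
have [pS qS rS] : [/\ p \in S, q \in S & r \in S] by rewrite SE !inE !eqxx !orbT.
move: w1 wx wy; rewrite SE !(sum3 _ d0) => w1 wx_ wy_.
have wx : m.1%:~R / 2 = w p * (coord p).1%:~R + w q * (coord q).1%:~R
  + w r * (coord r).1%:~R := wx_.
have wy : m.2%:~R / 2 = w p * (coord p).2%:~R + w q * (coord q).2%:~R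
  + w r * (coord r).2%:~R := wy_.
move: wx wy {wx_ wy_} => wx wy.
have wgt (z1 z2 z3 : lp) (v1 v2 v3 : R) : det z1 z2 z3 = 1 -> v1 + v2 + v3 = 1 ->
    m.1%:~R / 2 = v1 * (coord z1).1%:~R + v2 * (coord z2).1%:~R + v3 * (coord z3).1%:~R ->
    m.2%:~R / 2 = v1 * (coord z1).2%:~R + v2 * (coord z2).2%:~R + v3 * (coord z3).2%:~R ->
    exists n : int, 2 * v3 = n%:~R.
  move=> dz v1E vx vy.
  exists (((coord z2).1 - (coord z1).1) * (m.2 - ((coord z1).2 + (coord z1).2))
    - ((coord z2).2 - (coord z1).2) * (m.1 - ((coord z1).1 + (coord z1).1))).
  have : (det z1 z2 z3)%:~R = 1 :> R by rewrite dz.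
  rewrite /det !(rmorphB, rmorphM, rmorphD) /= => dR.
  have -> : (m.1%:~R : R) = 2 * (m.1%:~R / 2) by field.
  have -> : (m.2%:~R : R) = 2 * (m.2%:~R / 2) by field.
  rewrite vx vy -[LHS]mulr1 -[X in _ * X = _]dR.
  have -> : v1 = 1 - v2 - v3 by lra.
  by rewrite /Defs.coord /=; ring.
have d1q : det q r p = 1 by rewrite det_rot.
have d1p : det r p q = 1 by rewrite 2!det_rot.
have [n3 h3] := wgt _ _ _ _ _ _ d1 w1 wx wy.
have [n1 h1] : exists n : int, 2 * w p = n%:~R.
  by apply: (wgt _ _ _ (w q) (w r) _ d1q); [rewrite -[RHS]w1; ring | rewrite wx; ring | rewrite wy; ring].
have [n2 h2] : exists n : int, 2 * w q = n%:~R.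
  by apply: (wgt _ _ _ (w r) (w p) _ d1p); [rewrite -[RHS]w1; ring | rewrite wx; ring | rewrite wy; ring].
have pos n z : 2 * w z = n%:~R -> 0 <= n.
  by move=> hz; rewrite -(ler0z R) -hz mulr_ge0.
have n0 := (pos _ _ h1, pos _ _ h2, pos _ _ h3).
have nsum : n1 + n2 + n3 = 2.
  by apply: (@intr_inj R); rewrite !rmorphD /= -h1 -h2 -h3 -!mulrDr w1 mulr1.
have mE (x1 x2 : int) : x1%:~R = n1%:~R * (coord p).1%:~R + n2%:~R * (coord q).1%:~R
        + n3%:~R * (coord r).1%:~R :> R ->
    x2%:~R = n1%:~R * (coord p).2%:~R + n2%:~R * (coord q).2%:~R
        + n3%:~R * (coord r).2%:~R :> R ->
    x1 = n1 * (coord p).1 + n2 * (coord q).1 + n3 * (coord r).1 /\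
    x2 = n1 * (coord p).2 + n2 * (coord q).2 + n3 * (coord r).2.
  by rewrite -!rmorphM -!rmorphD /= => /intr_inj -> /intr_inj ->.
have [m1 m2] : m.1 = n1 * (coord p).1 + n2 * (coord q).1 + n3 * (coord r).1 /\
    m.2 = n1 * (coord p).2 + n2 * (coord q).2 + n3 * (coord r).2.
  apply: mE; rewrite -h1 -h2 -h3.
    have -> : (m.1%:~R : R) = 2 * (m.1%:~R / 2) by field.
    by rewrite wx; ring.
  have -> : (m.2%:~R : R) = 2 * (m.2%:~R / 2) by field.
  by rewrite wy; ring.
have pair x y : x \in S -> y \in S -> (coord x).1 + (coord y).1 = m.1 ->
    (coord x).2 + (coord y).2 = m.2 -> exists p q, [/\ coord p + coord q = m & p = q \/ linked p q].
  move=> xS yS e1 e2; exists x, y; split; last exact: adj.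
  by rewrite [m]surjective_pairing -e1 -e2.
have [[||]|||] := sum_two (pos _ _ h1) (pos _ _ h2) (pos _ _ h3) nsum;
  move=> [e1 e2 e3]; move: m1 m2; rewrite e1 e2 e3 => m1 m2.
- by apply: (pair p p) => //; rewrite ?m1 ?m2; ring.
- by apply: (pair q q) => //; rewrite ?m1 ?m2; ring.
- by apply: (pair r r) => //; rewrite ?m1 ?m2; ring.
- by apply: (pair p q) => //; rewrite ?m1 ?m2; ring.
- by apply: (pair p r) => //; rewrite ?m1 ?m2; ring.
- by apply: (pair q r) => //; rewrite ?m1 ?m2; ring.
Qed.

End Lattice.

Local Notation lp := (lattice_point 4).

(** * Finite checks in the triangle of degree four *)

Section Coordinates.
Implicit Types (p q r z : lp).

(* Coordinates in [nat] let the finite case distinctions be settled by evaluation. *)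
Definition nc p : nat * nat := ((val p).1 : nat, (val p).2 : nat).
Definition points : seq (nat * nat) :=
  [seq (x, y) | x <- iota 0 5, y <- iota 0 (5 - x)].
Definition ndet (a b c : nat * nat) : int :=
  (b.1%:Z - a.1%:Z) * (c.2%:Z - a.2%:Z) - (b.2%:Z - a.2%:Z) * (c.1%:Z - a.1%:Z).
Definition inner_points : seq (nat * nat) := [:: (1, 1); (2, 1); (1, 2)]%N.

Lemma nc_points p : nc p \in points.
Proof.
case: p => -[[x x5] [y y5]] /= xy.
apply/allpairsPdep; exists x, y; rewrite !mem_iota /=; split=> //.
by rewrite add0n; lia.
Qed.

Lemma nc_inj : injective nc.
Proof.
move=> [[x y] h] [[x' y'] h'] [e1 e2].
by apply: val_inj; rewrite /=; congr pair; apply: val_inj.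
Qed.

Lemma nc_onto a : a \in points -> exists p, nc p = a.
Proof.
move=> /allpairsPdep[x [y [+ + ->]]]; rewrite !mem_iota /= => x5 y5.
have x5' : (x < 5)%N by lia.
have y5' : (y < 5)%N by lia.
have xy : ((Ordinal x5', Ordinal y5').1 + (Ordinal x5', Ordinal y5').2 <= 4)%N.
  by rewrite /=; lia.
by exists (exist _ (Ordinal x5', Ordinal y5') xy).
Qed.

Lemma det_ndet p q r : det p q r = ndet (nc p) (nc q) (nc r). Proof. by []. Qed.

Definition inner p := nc p \in inner_points.

Lemma inner_not_on_boundary p q : inner p -> ~~ on_boundary [set p; q]%SET.
Proof.
rewrite /inner /on_boundary => pin; apply/negP; case/or3P => /forall_inP /(_ p).
- rewrite !inE eqxx => /(_ isT); rewrite /Defs.coord /=.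
  by move: pin; rewrite /nc !inE => /or3P[] /eqP[e1 e2]; rewrite ?e1 ?e2.
- rewrite !inE eqxx => /(_ isT); rewrite /Defs.coord /=.
  by move: pin; rewrite /nc !inE => /or3P[] /eqP[e1 e2]; rewrite ?e1 ?e2.
- rewrite !inE eqxx => /(_ isT); rewrite /Defs.coord /=.
  by move: pin; rewrite /nc !inE => /or3P[] /eqP[e1 e2]; rewrite ?e1 ?e2.
Qed.

Definition same_side (a b : nat * nat) : bool :=
  [|| (a.1 == 0%N) && (b.1 == 0%N), (a.2 == 0%N) && (b.2 == 0%N)
    | (a.1 + a.2 == 4)%N && (b.1 + b.2 == 4)%N].

Lemma same_sideP p q : ~~ on_boundary [set p; q]%SET -> ~~ same_side (nc p) (nc q).
Proof.
apply: contra => /or3P[] /andP[/eqP e1 /eqP e2]; apply/or3P.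
- by apply: Or31; apply/forall_inP => z; rewrite !inE => /orP[] /eqP ->; apply/eqP; congr Posz.
- by apply: Or32; apply/forall_inP => z; rewrite !inE => /orP[] /eqP ->; apply/eqP; congr Posz.
- by apply: Or33; apply/forall_inP => z; rewrite !inE => /orP[] /eqP ->; apply/eqP; congr Posz.
Qed.

Lemma on_boundary_same_side p q : on_boundary [set p; q]%SET = same_side (nc p) (nc q).
Proof.
apply/idP/idP; last by move=> h; apply/negPn/negP => /same_sideP; rewrite h.
have in2 : p \in [set p; q]%SET /\ q \in [set p; q]%SET by rewrite !inE !eqxx orbT.
case: in2 => pin qin; case/or3P => /forall_inP h; apply/or3P;
  have /eqP hp := h p pin; have /eqP hq := h q qin; move: hp hq;
  rewrite /Defs.coord /= -?PoszD => -[hp] [hq].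
- by apply: Or31; rewrite /nc /= hp hq.
- by apply: Or32; rewrite /nc /= hp hq.
- by apply: Or33; rewrite /nc /= hp hq.
Qed.

(** The line through a side of the big triangle has lattice points of the triangle on one side
    only. *)
Lemma same_side_det p q r r' : same_side (nc p) (nc q) -> det p q r = 1 ->
  det q p r' <> 1.
Proof.
have : all (fun a => all (fun b => all (fun c => all (fun e => ndet b a e != 1) points)
    [seq c <- points | ndet a b c == 1]) [seq b <- points | same_side a b]) points by vm_compute.
move=> /allP /(_ _ (nc_points p)) /allP /(_ (nc q)) + ss h; rewrite mem_filter ss nc_points.
move=> /(_ isT) /allP /(_ (nc r)); rewrite mem_filter -det_ndet h eqxx nc_points.
by move=> /(_ isT) /allP /(_ _ (nc_points r')) /eqP.
Qed.

Definition ncross (a b c e : nat * nat) : bool :=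
  (ndet a b c * ndet a b e < 0) && (ndet c e a * ndet c e b < 0).

Definition compatible (sel : seq ((nat * nat) * (nat * nat))) (a b : nat * nat) : bool :=
  all (fun s => ~~ ncross a b s.1 s.2) sel.

(** The [x] with determinant 1 are the possible apexes of a triangle to the left of [a b]; any
    choice but [c] would need a side that crosses a segment of [sel]. *)
Definition forced_apex sel (a b c : nat * nat) : bool :=
  all (fun x => compatible sel a x ==> compatible sel b x ==> (x == c))
    [seq x <- points | ndet a b x == 1].

(* Among the triangles at [h], only those with the vertex [p0] can have an opposite
   side that cuts off another inner point. *)
Definition no_chord sel (h : nat * nat) (bad : pred (nat * nat)) : bool :=
  all (fun a => all (fun b => [&& compatible sel a b, compatible sel h a,
      compatible sel h b, ~~ bad a & ~~ bad b] ==>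
    all (fun x => ~~ (0 < ndet b a x)) inner_points)
    [seq c <- points | (ndet h a c == 1) && (c \notin inner_points)])
  [seq c <- points | c \notin inner_points].

Definition coordinate (b : bool) (a : nat * nat) : int := if b then a.1%:Z else a.2%:Z.

(* The hub is the cycle around [h], and [w] and [u] are the neighbours of [p0] in the link
   of [h]. The cycle around [k] shares with the hub the edge dual to [h k] if [w] is [k];
   otherwise it hangs on a bridge dual to [w p0]. Likewise for [u] and [j]. The conditions on
   [lam] let the closing relation of the dual polygon contradict the equality of the arcs. *)
Definition hub_check (h p0 j k : nat * nat) (b : bool) : bool :=
  let lam a := coordinate b a - coordinate b h in
  [&& perm_eq inner_points [:: h; j; k], p0 \notin inner_points, lam p0 == 1,
    all (fun a => (a \notin inner_points) ==> (- 1 <= lam a)) points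
  & all (fun u => all (fun w =>
      let sel := [:: (h, p0); if w == k then (h, w) else (w, p0);
                     if u == j then (h, u) else (p0, u)] in
      [&& (w == k) || [&& w \notin inner_points, ~~ compatible sel h k,
                          ~~ same_side w p0 & forced_apex sel w p0 k],
          (u == j) || [&& u \notin inner_points, ~~ compatible sel h j,
                          ~~ same_side p0 u & forced_apex sel p0 u j],
          u != w, (w == k) && (u == j) ==> (ndet h w u != 1), no_chord sel h (pred1 p0),
          (w == k) ==> (0 <= lam w), (u == j) ==> (0 <= lam u)
        & (if w == k then 0 < lam w else - 1 < lam w)
          || (if u == j then 0 < lam u else - 1 < lam u)])
      [seq w <- points | ndet h p0 w == 1]) [seq u <- points | ndet h u p0 == 1]].

(** In each case [p0] is [j + k - h]. The flag selects a coordinate that is 1 at [h] and 2 at [p0];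
    since coordinates are non-negative, no lattice point of the triangle is more than 1 below
    [h]. *)
Lemma hub_checks :
  [/\ hub_check (1, 1) (2, 2) (2, 1) (1, 2) true,
      hub_check (2, 1) (0, 2) (1, 2) (1, 1) false
    & hub_check (1, 2) (2, 0) (1, 1) (2, 1) true]%N.
Proof. by split; vm_compute. Qed.

(* Beyond a chord with ends on the boundary of the triangle, cutting off one more
   boundary point only shrinks the region. *)
Lemma beyond_chord p q r z :
  ~~ same_side (nc p) (nc q) -> ~~ inner p -> ~~ inner q -> ~~ inner r -> det p q r = 1 ->
  (0 < det r q z -> 0 < det p q z) /\ (0 < det p r z -> 0 < det p q z).
Proof.
have : all (fun a => all (fun b => all (fun c => all (fun e =>
    ((0 < ndet c b e) ==> (0 < ndet a b e)) && ((0 < ndet a c e) ==> (0 < ndet a b e)))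
    points) [seq c <- points | (ndet a b c == 1) && (c \notin inner_points)])
    [seq c <- points | ~~ same_side a c && (c \notin inner_points)])
    [seq c <- points | c \notin inner_points].
  by vm_compute.
move=> /allP /(_ (nc p)) + pq pi qi ri d1; rewrite mem_filter pi nc_points => /(_ isT).
move=> /allP /(_ (nc q)); rewrite mem_filter pq qi nc_points => /(_ isT).
move=> /allP /(_ (nc r)); rewrite mem_filter -det_ndet d1 eqxx ri nc_points => /(_ isT).
move=> /allP /(_ (nc z) (nc_points z)) /andP[/implyP h1 /implyP h2].
by split.
Qed.

Lemma set3_rot p q r : [set p; q; r]%SET = [set r; p; q]%SET :> {set lp}.
Proof. by rewrite finset.setUC finset.setUA. Qed.

Definition left_normal p q : int * int :=
  (- ((coord q).2 - (coord p).2), (coord q).1 - (coord p).1).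

Lemma primitive_orthogonal (a b x y u v : int) : coprimez a b -> a * x + b * y = 0 ->
  `|x * v - y * u| = 1 -> (a = - y /\ b = x) \/ (a = y /\ b = - x).
Proof.
move=> /coprimezP[[m n] /= mn] ab h.
have [d dd] : exists d, d * (x * v - y * u) = 1.
  have [e|e] : x * v - y * u = 1 \/ x * v - y * u = - 1 by lia.
    by exists 1; rewrite e.
  by exists (-1); rewrite e.
(* [(a, b)] is [k] times the rotated vector [(- y, x)], and primitivity makes [k] a unit. *)
pose k := d * (a * u + b * v).
have ka : a = - (k * y).
  transitivity (d * (x * v - y * u) * a - (a * x + b * y) * d * v); last by rewrite /k; ring.
  by rewrite dd ab; ring.
have kb : b = k * x.
  transitivity (d * (x * v - y * u) * b + (a * x + b * y) * d * u); last by rewrite /k; ring.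
  by rewrite dd ab; ring.
have : k * (n * x - m * y) = 1 by rewrite -mn ka kb; ring.
move: ka kb; move: (n * x - m * y) => t ka kb kt.
have [k1|k1] : k = 1 \/ k = -1.
  have : (k %| 1)%Z by apply/dvdzP; exists t; rewrite mulrC.
  by rewrite dvdz1 => /eqP; lia.
  by left; rewrite ka kb k1 !mul1r.
by right; rewrite ka kb k1 !mulN1r opprK.
Qed.

End Coordinates.

(** * Cyclic orbits of an injective map *)

Section Orbits.
Variables (T : finType) (sigma : T -> T) (sigma_inj : injective sigma).

Lemma fconnect_ind (P : T -> Prop) x : P x -> (forall y, fconnect sigma x y -> P y -> P (sigma y)) ->
  forall y, fconnect sigma x y -> P y.
Proof.
move=> Px Ps y /iter_findex <-; elim: findex => //= n IH; apply: Ps => //.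
exact: fconnect_iter.
Qed.

(** A two-valued function that changes once along a cycle must change back. If it did not, going
    around from [sigma x] would return to [x] with the wrong value. *)
Lemma orbit_changes (b : T -> bool) x0 :
  (forall x, fconnect sigma x0 x -> b x = b x0) \/
  exists x y, [/\ fconnect sigma x0 x, fconnect sigma x0 y, x != y,
    b x != b (sigma x) & b y != b (sigma y)].
Proof.
have [[x [x0x bx]]|no] := pselect (exists x, fconnect sigma x0 x /\ b x != b (sigma x)); last first.
  left; apply: fconnect_ind => // y x0y <-; apply/esym/eqP/negPn/negP => yy.
  by apply: no; exists y.
right; have [[y [x0y by_ by2]]|no] :=
    pselect (exists y, [/\ fconnect sigma x0 y, b y != b x & b (sigma y) = b x]).
  exists x, y; split=> //; last by rewrite by2.
  by apply: contraNneq by_ => ->.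
have : b x != b x; last by rewrite eqxx.
have sx : fconnect sigma (sigma x) x by rewrite fconnect_sym // fconnect1.
apply: (fconnect_ind (x := sigma x) (P := fun z => b z != b x)) sx.
  by rewrite eq_sym.
move=> z sxz bz; apply/negP => /eqP bsz; apply: no; exists z; split=> //.
apply: connect_trans x0x (connect_trans (fconnect1 _ _) sxz).
Qed.

Lemma orbit_iter_inj x t t' : (t < order sigma x)%N -> (t' < order sigma x)%N ->
  iter t sigma x = iter t' sigma x -> t = t'.
Proof.
move=> tn tn' e; apply/eqP; rewrite -(nth_uniq x _ _ (orbit_uniq sigma x)) ?size_orbit //.
by rewrite !nth_traject // e.
Qed.

Lemma sum_orbit (M : nmodType) (F : T -> M) x :
  \sum_(y | fconnect sigma x y) F y = \sum_(t < order sigma x) F (iter t sigma x).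
Proof.
rewrite (eq_bigl (mem (orbit sigma x))) => [|y]; last by rewrite fconnect_orbit.
rewrite -big_uniq ?orbit_uniq // (big_nth x) size_orbit big_mkord.
by apply: eq_bigr => t _; rewrite nth_traject.
Qed.

End Orbits.

(** Merged into one sum, the coefficients are [lam t + 1] on the arc and [lam t] off it: all
    non-negative, one of them positive. Equal arcs and the closing relation would make this sum
    0. *)
Lemma arc_inequality (R : realFieldType) (N a0 a1 : nat) (l lam : nat -> R) :
  (a0 <= a1 <= N)%N -> (forall t, 0 < l t) ->
  (forall t, (a0 <= t <= a1)%N -> - 1 <= lam t) ->
  (forall t, (t <= N)%N -> ~~ (a0 <= t <= a1)%N -> 0 <= lam t) ->
  (exists2 t, (t <= N)%N & if (a0 <= t <= a1)%N then - 1 < lam t else 0 < lam t) ->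
  \sum_(t < N.+1) l t * lam t + \sum_(i < (a1 - a0).+1) l (a0 + i)%N != 0.
Proof.
move=> /andP[a01 a1N] l0 lam1 lam0 [t0 t0N strict].
have -> : \sum_(i < (a1 - a0).+1) l (a0 + i)%N = \sum_(t < N.+1) (a0 <= t <= a1)%N%:R * l t.
  rewrite -(big_mkord xpredT (fun i => l (a0 + i)%N)) -(big_mkord xpredT (fun t => (a0 <= t <= a1)%N%:R * l t)).
  have a0N : (a0 <= N.+1)%N by apply: leq_trans a01 _; apply: leqW.
  have a0a1 : (a0 <= a1.+1)%N by apply: leqW.
  rewrite [RHS](@big_cat_nat _ _ _ a0) //= [X in _ = X + _]big1_seq ?add0r => [|t]; last first.
    by rewrite mem_index_iota => /andP[_ /andP[_ ta]]; rewrite leqNgt ta /= mul0r.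
  rewrite [RHS](@big_cat_nat _ _ _ a1.+1) //= [X in _ = _ + X]big1_seq ?addr0 => [|t]; last first.
    by rewrite mem_index_iota => /andP[_ /andP[ta _]]; rewrite [(t <= a1)%N]leqNgt ta andbF mul0r.
  have := @big_addn R 0 +%R 0%N a1.+1 a0 xpredT (fun t => (a0 <= t <= a1)%N%:R * l t).
  rewrite add0n => ->; rewrite subSn //; apply: eq_big_nat => t /andP[_ ta].
  have -> : (a0 <= t + a0 <= a1)%N by rewrite leq_addl /=; move: ta a01; clear; lia.
  by rewrite mul1r addnC.
rewrite -big_split /= gt_eqF //.
have ge0 t : (t <= N)%N -> 0 <= l t * lam t + (a0 <= t <= a1)%N%:R * l t.
  move=> tN; rewrite [_%:R * _]mulrC -mulrDr; apply: mulr_ge0; first exact: ltW.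
  case: (boolP (a0 <= t <= a1)%N) => ta; first by have := lam1 t ta; rewrite /=; lra.
  by rewrite addr0; apply: lam0.
rewrite (bigD1 (inord t0)) //= ltr_pwDl //; last first.
  by apply: sumr_ge0 => t _; apply: ge0; rewrite -ltnS.
rewrite inordK // [_%:R * _]mulrC -mulrDr; apply: mulr_gt0 => //.
by move: strict; case: ifP => ta /=; lra.
Qed.

(** * The skeleton of a smooth quartic *)

Section Dual.
Context {R : realType} (C : plane_graph R) (X : {set {set lp}}).
Hypothesis triX : unimodular_triangulation R X.
Variable dual : cell C -> {set lp}.
Implicit Types (p q r z : lp) (e : edge C) (v : vertex C).
Local Notation tri v := (dual (CVertex v)).
Local Notation edg e := (dual (CEdge e)).
Hypothesis primitive_dir : forall e : edge C, primitive (dir e).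
Hypothesis dual_inj : injective dual.
Hypothesis dual_vertices :
  ([set tri v | v in [set: vertex C]] = [set` X])%classic.
Hypothesis dual_edges : ([set edg e | e in [set: edge C]]
  = [set s | s \in triangulation_edges X /\ ~~ on_boundary s])%classic.
Hypothesis incidence : forall (e : edge C) (v : vertex C),
  edg e \subset tri v <-> v = src e \/ v = tgt e.
Hypothesis normal_src : forall e : edge C, outward_normal (dir e) (tri (src e)) (edg e).
Hypothesis normal_tgt : forall e : edge C, outward_normal (- dir e) (tri (tgt e)) (edg e).

Lemma tri_in v : tri v \in X.
Proof.
have : ([set tri v | v in [set: vertex C]])%classic (tri v) by exists v.
by rewrite dual_vertices.
Qed.

Lemma tri_onto S : S \in X -> exists v, tri v = S.
Proof.
move=> SX; have : [set` X]%classic S by [].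
by rewrite -dual_vertices => -[v _ <-]; exists v.
Qed.

Lemma edg_inj e e' : edg e = edg e' -> e = e'.
Proof. by move=> /dual_inj[]. Qed.

Lemma tri_unimodular v : unimodular_triangle (tri v).
Proof. by have [_ uni _ _] := triX; apply: uni; exact: tri_in. Qed.

Lemma edg_onto p q : linked X p q -> ~~ on_boundary [set p; q]%SET ->
  exists e, edg e = [set p; q]%SET.
Proof.
move=> /linkedP[pq [S SX [pS qS]]] nb.
have : ([set s | s \in triangulation_edges X /\ ~~ on_boundary s])%classic [set p; q]%SET.
  split=> //; rewrite inE cards2 pq eqxx /=; apply/exists_inP; exists S => //.
  by apply/fintype.subsetP => z; rewrite !inE => /orP[] /eqP ->.
by rewrite -dual_edges => -[e _ <-]; exists e.
Qed.

Lemma third_vertex p q r r' : ([set p; q; r] = [set p; q; r'] :> {set lp})%SET ->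
  det p q r != 0 -> r = r'.
Proof.
move=> e /det_neq[_ pr qr]; have : r \in [set p; q; r']%SET by rewrite -e !inE eqxx orbT.
by rewrite !inE -orbA => /or3P[] /eqP h //; [move: pr | move: qr]; rewrite h eqxx.
Qed.

(** [b] records which end of [e] is dual to the triangle on the left of [p q]. Orthogonality fixes
    [dir e] up to sign, and the outward normals at the ends relate the sign to the side. *)
Lemma edge_dart e p q : edg e = [set p; q]%SET -> p != q ->
  exists b : bool, let l := if b then tgt e else src e in
    let s := if b then src e else tgt e in
  [/\ exists2 r, tri l = [set p; q; r]%SET & det p q r = 1,
      exists2 r, tri s = [set q; p; r]%SET & det q p r = 1
    & pos l = translate (pos s) (len e) (left_normal p q)].
Proof.
move=> epq pq.
have in_tri v : edg e \subset tri v -> exists2 r, tri v = [set p; q; r]%SET & `|det p q r| = 1.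
  move=> /fintype.subsetP sub; apply: unimodular_ccw (tri_unimodular v) _ _ pq; apply: sub;
    by rewrite epq !inE eqxx ?orbT.
have sS : edg e \subset tri (src e) by apply/incidence; left.
have sT : edg e \subset tri (tgt e) by apply/incidence; right.
have [r1 S1 h1] := in_tri _ sS; have [r2 S2 h2] := in_tri _ sT.
have out r : `|det p q r| = 1 -> r \notin [set p; q]%SET.
  move=> h; have /det_neq[_ pr qr] : det p q r != 0 by rewrite -normr_eq0 h.
  by rewrite !inE negb_or ![r == _]eq_sym pr qr.
have [pe qe] : p \in edg e /\ q \in edg e by rewrite epq !inE !eqxx orbT.
have [_ orth n1] := normal_src e; have [_ _ n2] := normal_tgt e.
have orth0 := orth _ _ pe qe.
have nr1 := out _ h1; have nr2 := out _ h2; rewrite -epq in nr1 nr2.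
have r1S : r1 \in tri (src e) by rewrite S1 !inE eqxx orbT.
have r2S : r2 \in tri (tgt e) by rewrite S2 !inE eqxx orbT.
have p1 := n1 r1 p r1S nr1 pe; have p2 := n2 r2 p r2S nr2 pe.
have dirE : dir e = ((dir e).1, (dir e).2) by case: (dir e).
have := primitive_orthogonal (primitive_dir e) orth0 h1.
case=> [[ka kb]|[ka kb]].
  exists true; split=> /=.
  - exists r2 => //; have : 0 < det p q r2.
      suff <- : dot (- dir e) (coord p - coord r2) = det p q r2 by [].
      by rewrite /dot /det /= ka kb /=; ring.
    by move=> h; rewrite -h2 gtr0_norm.
  - exists r1; first by rewrite S1 [X in (X :|: _)%SET]finset.setUC.
    have : 0 < det q p r1.
      suff <- : dot (dir e) (coord p - coord r1) = det q p r1 by [].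
      by rewrite /dot /det /= ka kb /=; ring.
    by move=> h; rewrite -h1 -[RHS]normrN -det_swap gtr0_norm.
  - by rewrite pos_tgt; congr translate; rewrite dirE ka kb.
exists false; split=> /=.
- exists r1 => //; have : 0 < det p q r1.
    suff <- : dot (dir e) (coord p - coord r1) = det p q r1 by [].
    by rewrite /dot /det /= ka kb /=; ring.
  by move=> h; rewrite -h1 gtr0_norm.
- exists r2; first by rewrite S2 [X in (X :|: _)%SET]finset.setUC.
  have : 0 < det q p r2.
    suff <- : dot (- dir e) (coord p - coord r2) = det q p r2 by [].
    by rewrite /dot /det /= ka kb /=; ring.
  by move=> h; rewrite -h2 -[RHS]normrN -det_swap gtr0_norm.
rewrite pos_tgt /translate /left_normal /= ka kb !rmorphN /=.
by case: (pos (src e)) => x y /=; congr pair; ring.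
Qed.

Lemma edg_spec e : edg e \in triangulation_edges X /\ ~~ on_boundary (edg e).
Proof.
have : ([set edg e | e in [set: edge C]])%classic (edg e) by exists e.
by rewrite dual_edges.
Qed.

Lemma ccw_absurd p q r r' : [set p; q; r]%SET = [set q; p; r']%SET :> {set lp} ->
  det p q r = 1 -> det q p r' = 1 -> False.
Proof.
move=> e h1 h2; have : [set p; q; r]%SET = [set p; q; r']%SET.
  by rewrite e [X in (X :|: _)%SET]finset.setUC.
by move=> /third_vertex; rewrite h1 => /(_ isT) e12; move: h2; rewrite -e12 det_swap h1.
Qed.

Lemma src_neq_tgt e : src e != tgt e.
Proof.
have [/[1!inE] /andP[/cards2P[p [q [pq epq]]] _] _] := edg_spec e.
have [b [[r1 S1 h1] [r2 S2 h2] _]] := edge_dart epq pq.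
apply/eqP => st; have : [set p; q; r1]%SET = [set q; p; r2]%SET.
  by rewrite -S1 -S2; case: (b); rewrite st.
by move=> /ccw_absurd /(_ h1 h2).
Qed.

Section Skeleton.
Local Notation G := (skeleton C).
Local Notation S := (skeleton_vertices C).
Implicit Types (d : dart G).

Definition csrc d : vertex C := if d.2 then src (val d.1) else tgt (val d.1).
Definition ctgt d : vertex C := if d.2 then tgt (val d.1) else src (val d.1).

Lemma val_dsrc d : sval (dsrc d : {v | v \in S}) = csrc d.
Proof. by case: d => e []. Qed.

Lemma val_dtgt d : sval (dtgt d : {v | v \in S}) = ctgt d.
Proof. by case: d => e []. Qed.

Lemma ctgt_rev d : ctgt (drev d) = csrc d. Proof. by case: d => e []. Qed.

Lemma dart_vertexE d d' : ctgt d = csrc d' -> dsrc d' = dtgt d.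
Proof. by move=> e; apply: val_inj; rewrite /= val_dsrc val_dtgt. Qed.

(* [d] crosses the edge [p q] of the triangulation from its right to its left. *)
Definition crosses p q d : Prop :=
  [/\ edg (val d.1) = [set p; q]%SET, p != q
    & exists2 r, tri (ctgt d) = [set p; q; r]%SET & det p q r = 1].

Lemma crosses_total p q d : edg (val d.1) = [set p; q]%SET -> p != q ->
  crosses p q d \/ crosses q p d.
Proof.
move=> epq pq; have [b [[r1 S1 h1] [r2 S2 h2] _]] := edge_dart epq pq.
case: (eqVneq d.2 b) => [db|db].
  by left; split=> //; exists r1; rewrite // /ctgt db.
right; split; [by rewrite epq finset.setUC | by rewrite eq_sym | exists r2 => //].
by rewrite /ctgt -S2; case: (d.2) (b) db => [] [].
Qed.

Lemma crosses_src p q d : crosses p q d ->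
  (exists2 r, tri (csrc d) = [set q; p; r]%SET & det q p r = 1) /\
  pos (ctgt d) = translate (pos (csrc d)) (len (val d.1)) (left_normal p q).
Proof.
move=> [epq pq [r Sr hr]]; have [b [[r1 S1 h1] [r2 S2 h2] ps]] := edge_dart epq pq.
case: (eqVneq d.2 b) => [db|db].
  by rewrite /csrc /ctgt db; split=> //; exists r2.
have : tri (ctgt d) = [set q; p; r2]%SET.
  by rewrite -S2 /ctgt; case: (d.2) (b) db => [] [].
by rewrite Sr => /ccw_absurd /(_ hr h2).
Qed.

Lemma crosses_rev p q d : crosses p q d -> crosses q p (drev d).
Proof.
move=> cr; have [epq pq _] := cr; have [h _] := crosses_src cr.
by split; [rewrite finset.setUC | rewrite eq_sym | rewrite ctgt_rev].
Qed.

Lemma crosses_uniq p q d d' : crosses p q d -> crosses p q d' -> d = d'.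
Proof.
case: d d' => [e b] [e' b'] cr cr'; have [h _] := crosses_src cr.
case: cr cr' => /= epq _ [r Sr hr] [epq' _ [r' Sr' hr']].
have ee : e = e' by apply: val_inj; apply: edg_inj; rewrite /= epq epq'.
rewrite -ee in Sr' *; congr pair; apply: contrapT => /eqP bb.
have [r2 S2 h2] := h; move: Sr'; rewrite [ctgt _](_ : _ = csrc (e, b)); last first.
  by rewrite /ctgt /csrc /=; case: (b) (b') bb => [] [].
by rewrite S2 => /esym /ccw_absurd /(_ hr' h2).
Qed.

Lemma crosses_tgtE p q r d v : crosses p q d -> tri v = [set p; q; r]%SET ->
  det p q r = 1 -> v = ctgt d.
Proof.
move=> cr Sv hr; have [epq pq _] := cr; have [[r' Sr' hr'] _] := crosses_src cr.
have : edg (val d.1) \subset tri v by rewrite epq Sv finset.subsetUl.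
rewrite incidence => vE.
have [//|vs] : v = ctgt d \/ v = csrc d.
  by rewrite /ctgt /csrc; case: (d.2); case: vE; auto.
by move: Sr'; rewrite -vs Sv => /ccw_absurd /(_ hr hr').
Qed.

(** The triangle is on the left of its sides and the dart leaves it, so the sides appear
    reversed. *)
Lemma crosses_out p q r d : tri (csrc d) = [set p; q; r]%SET -> det p q r = 1 ->
  [\/ crosses q p d, crosses r q d | crosses p r d].
Proof.
move=> Sv h; have sub : edg (val d.1) \subset tri (csrc d).
  by apply/incidence; rewrite /csrc; case: (d.2); auto.
have aux x y z : tri (csrc d) = [set x; y; z]%SET -> det x y z = 1 ->
    edg (val d.1) = [set x; y]%SET -> crosses y x d.
  move=> Sx hx exy; have /det_neq[xy _ _] : det x y z != 0 by rewrite hx.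
  have [cr|//] := crosses_total exy xy; have [[r' Sr' hr'] _] := crosses_src cr.
  by move: Sr'; rewrite Sx => /ccw_absurd /(_ hx hr').
have rot x y z : ([set x; y; z] = [set y; z; x] :> {set lp})%SET.
  by rewrite -finset.setUA finset.setUC.
have [/[1!inE] /andP[/cards2P[x [y [xy exy]]] _] _] := edg_spec (val d.1).
have [xS yS] : x \in tri (csrc d) /\ y \in tri (csrc d).
  by move/fintype.subsetP: sub => sub; split; apply: sub; rewrite exy !inE eqxx ?orbT.
have eyx : edg (val d.1) = [set y; x]%SET by rewrite exy finset.setUC.
have h2 : det q r p = 1 by rewrite det_rot.
have h3 : det r p q = 1 by rewrite det_rot.
have S2 : tri (csrc d) = [set q; r; p]%SET by rewrite Sv rot.
have S3 : tri (csrc d) = [set r; p; q]%SET by rewrite S2 rot.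
move: xS yS; rewrite Sv !inE -!orbA => /or3P[] /eqP xE /or3P[] /eqP yE;
  move: xy exy eyx; rewrite xE yE ?eqxx // => _ exy eyx.
- by apply: Or31; exact: (aux _ _ _ Sv h exy).
- by apply: Or33; exact: (aux _ _ _ S3 h3 eyx).
- by apply: Or31; exact: (aux _ _ _ Sv h eyx).
- by apply: Or32; exact: (aux _ _ _ S2 h2 exy).
- by apply: Or33; exact: (aux _ _ _ S3 h3 exy).
- by apply: Or32; exact: (aux _ _ _ S2 h2 eyx).
Qed.

Lemma crosses_exists p q e : edg e = [set p; q]%SET -> p != q ->
  src e \in S -> tgt e \in S -> exists d, crosses p q d.
Proof.
move=> epq pq sS tS; have eS : e \in edges_in S by rewrite inE sS.
pose d b : dart G := (exist _ e eS, b).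
have [cr|cr] := crosses_total (d := d true) epq pq; first by exists (d true).
by exists (d false); exact: crosses_rev cr.
Qed.

(** * Leaf contraction and the edges that survive it *)

Lemma sub_contract_leaf (S0 S1 : {set vertex C}) : S0 \subset S1 ->
  (forall v, v \in S0 -> exists e1 e2, [/\ e1 != e2, e1 \in edges_in S0,
     e2 \in edges_in S0, (v == src e1) || (v == tgt e1) & (v == src e2) || (v == tgt e2)]) ->
  S0 \subset contract_leaf S1.
Proof.
move=> /fintype.subsetP sub core; rewrite /contract_leaf; case: pickP => [v /andP[vS1 /eqP val1]|_];
  last by apply/fintype.subsetP.
apply/fintype.subsetP => x x0; rewrite !inE sub // andbT; apply/negP => /eqP xv.
have [e1 [e2 [ne e1S e2S v1 v2]]] := core x x0; move: v1 v2; rewrite xv => v1 v2.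
have in1 e : e \in edges_in S0 -> e \in edges_in S1.
  by rewrite !inE => /andP[/sub -> /sub ->].
have : (2 <= valence_in S1 v)%N.
  rewrite /valence_in; apply: leq_trans (_ : #|_ :|: _| <= _)%N; last exact: leq_card_setU.
  rewrite -[2%N](_ : #|[set e1; e2]| = 2%N); last by rewrite cards2 ne.
  apply: subset_leq_card; apply/fintype.subsetP => e; rewrite !inE => /orP[] /eqP ->.
    by move: (in1 _ e1S) v1; rewrite !inE => -> /orP[] /eqP <-; rewrite eqxx ?orbT.
  by move: (in1 _ e2S) v2; rewrite !inE => -> /orP[] /eqP <-; rewrite eqxx ?orbT.
by rewrite val1.
Qed.

Lemma contract_leafE (S1 : {set vertex C}) : contract_leaf S1 = S1 \/
  (#|contract_leaf S1| < #|S1|)%N.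
Proof.
rewrite /contract_leaf; case: pickP => [v /andP[vS _]|_]; last by left.
by right; rewrite [X in (_ < X)%N](cardsD1 v) vS.
Qed.

(** A round either removes a vertex or changes nothing from then on, so [#|vertex C|] rounds reach a
    fixed point. *)
Lemma skeleton_fixed : contract_leaf S = S.
Proof.
have it n : contract_leaf (iter n (@contract_leaf R C) [set: vertex C]%SET)
      = iter n (@contract_leaf R C) [set: vertex C]%SET \/
    (#|iter n (@contract_leaf R C) [set: vertex C]%SET| + n <= #|vertex C|)%N.
  elim: n => [|n [IH|IH]] /=; first by right; rewrite addn0 cardsT.
    by left; rewrite !IH.
  have [e|lt] := contract_leafE (iter n (@contract_leaf R C) [set: vertex C]%SET).
    by left; rewrite !e.
  by right; apply: leq_trans IH; rewrite addnS ltn_add2r.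
have [//|h] := it #|vertex C|; have S0 : #|S| = 0%N by apply/eqP; rewrite -leqn0 -(leq_add2r #|vertex C|).
by have [//|] := contract_leafE S; rewrite S0.
Qed.

Lemma skeleton_valence v : v \in S -> valence_in S v <> 1%N.
Proof.
move=> vS /eqP val1; have := skeleton_fixed; rewrite /contract_leaf.
case: pickP => [w /andP[wS _] e|/(_ v)]; last by rewrite vS val1.
by move: wS; rewrite -[in X in X -> _]e !inE eqxx.
Qed.

Lemma skeleton_core (S0 : {set vertex C}) :
  (forall v, v \in S0 -> exists e1 e2, [/\ e1 != e2, e1 \in edges_in S0,
     e2 \in edges_in S0, (v == src e1) || (v == tgt e1) & (v == src e2) || (v == tgt e2)]) ->
  S0 \subset S.
Proof.
move=> core; rewrite /skeleton_vertices; elim: #|vertex C| => [|n IH] /=.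
  exact: finset.subsetT.
exact: sub_contract_leaf.
Qed.

(** Without a second edge at its target, that vertex would have valence 1, because [src_neq_tgt]
    excludes loops; such a vertex would have been contracted. *)
Lemma next_dart d : exists d', csrc d' = ctgt d /\ val d'.1 <> val d.1.
Proof.
case: d => e b; set v := ctgt (e, b).
have [sS tS] : src (val e) \in S /\ tgt (val e) \in S.
  by have := valP e; rewrite inE => /andP[].
have vS : v \in S by rewrite /v /ctgt; case: (b).
have inc : (src (val e) == v) || (tgt (val e) == v).
  by rewrite /v /ctgt /=; case: (b); rewrite eqxx ?orbT.
have [e2 [e2S ne inc2]] : exists e2, [/\ e2 \in edges_in S, e2 != val e
    & (src e2 == v) || (tgt e2 == v)].
  apply: contrapT => no; apply: (skeleton_valence vS).
  have only e2 : e2 \in edges_in S -> (src e2 == v) || (tgt e2 == v) -> e2 = val e.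
    by move=> e2S i2; apply: contrapT => /eqP ne; apply: no; exists e2.
  rewrite /valence_in.
  have -> : [set e2 in edges_in S | src e2 == v]%SET
     = (if src (val e) == v then [set val e] else finset.set0)%SET.
    apply/setP => e2; rewrite inE; case: (boolP (e2 == val e)) => [/eqP ->|ne].
      by rewrite (valP e); case: ifP; rewrite ?inE // eqxx.
    transitivity false; last by case: ifP; rewrite !inE // (negbTE ne).
    apply/negP => /andP[e2S s2]; move: ne; rewrite (only e2 e2S) ?s2 // eqxx //.
  have -> : [set e2 in edges_in S | tgt e2 == v]%SET
     = (if tgt (val e) == v then [set val e] else finset.set0)%SET.
    apply/setP => e2; rewrite inE; case: (boolP (e2 == val e)) => [/eqP ->|ne].
      by rewrite (valP e); case: ifP; rewrite ?inE // eqxx.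
    transitivity false; last by case: ifP; rewrite !inE // (negbTE ne).
    apply/negP => /andP[e2S s2]; move: ne; rewrite (only e2 e2S) ?s2 ?orbT // eqxx //.
  case: eqP inc => [sv _|_ /= ->]; last by rewrite cards0 cards1.
  case: eqP => [tv|_]; last by rewrite cards0 cards1.
  by have := src_neq_tgt (val e); rewrite sv tv eqxx.
exists (exist _ e2 e2S, src e2 == v); split=> /=; last exact/eqP.
rewrite /csrc /=; case: eqP inc2 => [//|_ /= /eqP //].
Qed.

(* A chord with no interior lattice point beyond it bounds a tree. *)
Lemma dead_end p q d : crosses p q d -> ~~ inner p -> ~~ inner q ->
  (forall z, inner z -> ~~ (0 < det p q z)) -> False.
Proof.
have [n] := ubnP #|[set z | 0 < det p q z]%SET|.
elim: n p q d => // n IH p q d le_n cr pi qi beyond.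
have [epq pq [r Sr h]] := cr.
have ri : ~~ inner r by apply/negP => /beyond; rewrite h.
have nb : ~~ same_side (nc p) (nc q).
  by apply: same_sideP; have [_] := edg_spec (val d.1); rewrite epq.
have h0 : 0 < det p q r by rewrite h.
have less x y : (forall z, 0 < det x y z -> 0 < det p q z) -> det x y r = 0 ->
    (#|[set z | (0 < det x y z)%R]%SET| < n)%N.
  move=> sub xyr; rewrite -ltnS; apply: leq_trans le_n; rewrite ltnS.
  apply: proper_card; apply/properP; split.
    by apply/fintype.subsetP => z; rewrite !inE; apply: sub.
  by exists r; rewrite !inE ?xyr // ltxx.
(* The skeleton must continue through one of the other two sides of the triangle. That side is again
   a chord with no inner point beyond it, and [r] is no longer beyond it, so the induction
   applies. *)
have [d' [sd ne]] := next_dart d.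
have Sd' : tri (csrc d') = [set p; q; r]%SET by rewrite sd.
case: (crosses_out Sd' h) => cr'.
- by case: cr' => e' _ _; apply: ne; apply: edg_inj; rewrite e' epq finset.setUC.
- apply: (IH r q d' _ cr' ri qi).
    apply: less => [z|]; last by rewrite /det; ring.
    by have [] := beyond_chord z nb pi qi ri h.
  move=> z /beyond; apply: contra.
  by have [] := beyond_chord z nb pi qi ri h.
apply: (IH p r d' _ cr' pi ri).
  apply: less => [z|]; last by rewrite /det; ring.
  by have [] := beyond_chord z nb pi qi ri h.
move=> z /beyond; apply: contra.
by have [] := beyond_chord z nb pi qi ri h.
Qed.

Definition core : {set vertex C} := [set v | [exists p in tri v, inner p]].

Lemma edge_at v p q : p \in tri v -> q \in tri v -> p != q -> inner p ->
  exists e, [/\ edg e = [set p; q]%SET, e \in edges_in core & (v == src e) || (v == tgt e)].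
Proof.
move=> pv qv pq pin.
have adj : linked X p q by apply/linkedP; split=> //; exists (tri v); rewrite ?tri_in.
have [e epq] := edg_onto adj (inner_not_on_boundary q pin); exists e; split=> //.
  have inT w : edg e \subset tri w -> w \in core.
    move=> /fintype.subsetP sub; rewrite inE; apply/exists_inP; exists p => //.
    by apply: sub; rewrite epq !inE eqxx.
  by rewrite inE !inT //; apply/incidence; auto.
have : edg e \subset tri v.
  by rewrite epq; apply/fintype.subsetP => z; rewrite !inE => /orP[] /eqP ->.
by rewrite incidence => -[] ->; rewrite eqxx ?orbT.
Qed.

(** The two sides of a triangle at an inner vertex are dual to bounded edges between triangles with
    the same inner vertex, so each vertex of [core] keeps two edges. *)
Lemma core_sub : core \subset S.
Proof.
apply: skeleton_core => v; rewrite inE => /exists_inP[p pv pin].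
have [a [b [c [SE h]]]] := (unimodularP _).1 (tri_unimodular v).
have [ab ac bc] : [/\ a != b, a != c & b != c] by apply: det_neq; rewrite h.
have [x [y [xv yv px py xy]]] : exists x y, [/\ x \in tri v, y \in tri v, p != x, p != y & x != y].
  move: pv; rewrite SE !inE -!orbA => /or3P[] /eqP ->.
  - by exists b, c; rewrite !inE !eqxx !orbT.
  - by exists a, c; rewrite !inE !eqxx !orbT [b == a]eq_sym.
  - by exists a, b; rewrite !inE !eqxx !orbT [c == a]eq_sym [c == b]eq_sym.
have [e1 [E1 c1 v1]] := edge_at pv xv px pin.
have [e2 [E2 c2 v2]] := edge_at pv yv py pin.
exists e1, e2; split=> //; apply: contraNneq xy => ee.
have : x \in [set p; y]%SET by rewrite -E2 -ee E1 !inE eqxx orbT.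
by rewrite !inE [x == p]eq_sym (negbTE px).
Qed.

Lemma crosses_inner p q : linked X p q -> inner p || inner q -> exists d, crosses p q d.
Proof.
have main x y : linked X x y -> inner x -> exists d, crosses x y d.
  move=> /linkedP[xy [T TX [xT yT]]] xin; have [v vT] := tri_onto TX.
  rewrite -vT in xT yT; have [e [exy ec _]] := edge_at xT yT xy xin.
  move/fintype.subsetP: core_sub => sub.
  by move: ec; rewrite inE => /andP[/sub sS /sub tS]; exact: crosses_exists exy xy sS tS.
move=> pq /orP[|] i; first exact: main.
by have [|d /crosses_rev] := main q p _ i; rewrite 1?linked_sym //; exists (drev d).
Qed.

(** Both ends of the dual edge lie in [core] thanks to the inner apexes, even if neither [p] nor [q]
    is inner. *)
Lemma crosses_bridge p q v w r s : tri v = [set p; q; r]%SET -> tri w = [set q; p; s]%SET ->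
  det p q r = 1 -> det q p s = 1 -> inner r -> inner s -> exists d, crosses p q d.
Proof.
move=> Sv Sw hr hs rin sin; have /det_neq[pq _ _] : det p q r != 0 by rewrite hr.
have vcore : v \in core by rewrite inE; apply/exists_inP; exists r; rewrite // Sv !inE eqxx orbT.
have wcore : w \in core by rewrite inE; apply/exists_inP; exists s; rewrite // Sw !inE eqxx orbT.
have adj : linked X p q.
  by apply/linkedP; split=> //; exists (tri v); rewrite ?tri_in // Sv !inE !eqxx orbT.
have nb : ~~ on_boundary [set p; q]%SET.
  by rewrite on_boundary_same_side; apply/negP => /same_side_det /(_ hr) /(_ hs).
have [e epq] := edg_onto adj nb.
have /incidence ve : edg e \subset tri v by rewrite epq Sv finset.subsetUl.
have /incidence we : edg e \subset tri w by rewrite epq finset.setUC Sw finset.subsetUl.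
have vw : v <> w by move=> vw; move: Sv; rewrite vw Sw => /esym /ccw_absurd /(_ hr hs).
move/fintype.subsetP: core_sub => sub.
case: ve => ve; case: we => we; try by case: vw; rewrite ve we.
  by apply: (crosses_exists epq pq); rewrite -?ve -?we sub.
by apply: (crosses_exists epq pq); rewrite -?ve -?we sub.
Qed.

Lemma left_triangle p q : linked X p q -> ~~ same_side (nc p) (nc q) ->
  exists v r, tri v = [set p; q; r]%SET /\ det p q r = 1.
Proof.
move=> adj; rewrite -on_boundary_same_side => nb.
have [e epq] := edg_onto adj nb; have [pq _] := linkedP _ _ _ adj.
have [b [[r1 S1 h1] _ _]] := edge_dart epq pq.
by exists (if b then tgt e else src e), r1.
Qed.

(* The triangles around the inner point [i], in counterclockwise order: [sigma q]
   follows [q], and [D q] crosses the segment from [i] to [q]. *)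
Definition star i (D : lp -> dart G) (sigma : lp -> lp) : Prop :=
  [/\ injective sigma,
      forall q, linked X i q -> [/\ crosses i q (D q),
        tri (ctgt (D q)) = [set i; q; sigma q]%SET & det i q (sigma q) = 1],
      forall q, linked X i q -> linked X i (sigma q)
    & forall q, linked X i q -> dsrc (D (sigma q)) = dtgt (D q)].

Lemma tri_linked v p q : p \in tri v -> q \in tri v -> p != q -> linked X p q.
Proof. by move=> pv qv pq; apply/linkedP; split=> //; exists (tri v); rewrite ?tri_in. Qed.

(** Outside the link of [i] the successor is the identity, which makes [sigma] injective on all
    lattice points. On the link, [sigma q] determines the triangle before it, hence [q]. *)
Lemma star_exists i (d0 : dart G) : inner i -> exists D sigma, star i D sigma.
Proof.
move=> iin; have /choice[Ds DsP] : forall q, exists x : dart G * lp, if linked X i q then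
    [/\ crosses i q x.1, tri (ctgt x.1) = [set i; q; x.2]%SET & det i q x.2 = 1] else x.2 = q.
  move=> q; case: (boolP (linked X i q)) => [iq|_]; last by exists (d0, q).
  have [d cr] : exists d, crosses i q d by apply: crosses_inner; rewrite ?iin.
  by have [_ _ [r Sr hr]] := cr; exists (d, r).
pose D q := (Ds q).1; pose sigma q := (Ds q).2.
have sl q : linked X i q -> [/\ crosses i q (D q),
    tri (ctgt (D q)) = [set i; q; sigma q]%SET & det i q (sigma q) = 1].
  by move=> iq; have := DsP q; rewrite iq.
have sn q : linked X i q = false -> sigma q = q by move=> iq; have := DsP q; rewrite iq.
have sL q : linked X i q -> linked X i (sigma q).
  move=> iq; have [_ Sq hq] := sl q iq; have /det_neq[_ ir _] : det i q (sigma q) != 0 by rewrite hq.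
  by apply: (@tri_linked (ctgt (D q))); rewrite // Sq !inE eqxx ?orbT.
have link q : linked X i q -> csrc (D (sigma q)) = ctgt (D q).
  move=> iq; have [_ Sq hq] := sl q iq; have [cr _ _] := sl _ (sL q iq).
  apply/esym; rewrite -(ctgt_rev (D (sigma q))).
  apply: (crosses_tgtE (crosses_rev cr) (r := q)); first by rewrite Sq set3_rot.
  by rewrite -[RHS]hq -det_rot.
exists D, sigma; split=> //; last first.
  by move=> q /link e; apply: dart_vertexE.
move=> q q' e; case: (boolP (linked X i q)) (boolP (linked X i q')) => iq [] iq'.
- have [cr Sq hq] := sl q iq; have [cr' Sq' hq'] := sl q' iq'.
  have vv : ctgt (D q) = ctgt (D q') by rewrite -!link // e.
  have : [set sigma q; i; q]%SET = [set sigma q; i; q']%SET.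
    by rewrite -[LHS]set3_rot -[RHS]set3_rot -Sq vv Sq' e.
  by move=> /third_vertex; apply; rewrite -det_rot hq.
- by have := sL q iq; rewrite e (sn q' (negbTE iq')) (negbTE iq').
- by have := sL q' iq'; rewrite -e (sn q (negbTE iq)) (negbTE iq).
- by move: e; rewrite !sn //; apply: negbTE.
Qed.

Section Star.
Variables (i : lp) (D : lp -> dart G) (sigma : lp -> lp) (q0 : lp).
Hypotheses (st : star i D sigma) (iq0 : linked X i q0).

Let sigma_inj : injective sigma. Proof. by case: st. Qed.

Definition star_edges : {set mg_edge G} := [set (D q).1 | q in [set q | fconnect sigma q0 q]].

Lemma star_linked q : fconnect sigma q0 q -> linked X i q.
Proof.
case: st => _ _ L _; apply: (fconnect_ind (P := fun z => linked X i z)) => // y _.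
exact: L.
Qed.

Lemma star_edges_in q d : fconnect sigma q0 q -> crosses i q d \/ crosses q i d ->
  d.1 \in star_edges.
Proof.
move=> q0q cr; case: st => _ st1 _ _; have [cr' _ _] := st1 q (star_linked q0q).
apply/imsetP; exists q; rewrite ?inE //.
case: cr => cr; first by rewrite (crosses_uniq cr cr').
by rewrite -(crosses_uniq (crosses_rev cr) cr').
Qed.

Lemma star_edges_at p q d : crosses p q d -> d.1 \in star_edges -> (i == p) || (i == q).
Proof.
move=> [epq _ _] /imsetP[x]; rewrite inE => q0x e; case: st => _ st1 _ _.
have [[eix _ _] _ _] := st1 x (star_linked q0x).
have : i \in [set p; q]%SET by rewrite -epq e eix !inE eqxx.
by rewrite !inE.
Qed.

(** The darts [D q] follow each other head to tail, so [orbit_changes] supplies two steps across the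
    cut. They lie on different edges, because an edge determines the end other than [i] of its dual
    segment. *)
Lemma star_cyclic : cyclic_edges star_edges.
Proof.
move=> b; case: st => _ st1 _ st2.
have ends (d : dart G) : (b (mg_src d.1) != b (mg_tgt d.1)) = (b (dsrc d) != b (dtgt d)).
  by case: d => e []; rewrite // eq_sym.
have pred q : fconnect sigma q0 q -> exists2 q', fconnect sigma q0 q' & sigma q' = q.
  move=> q0q; exists (finv sigma q); last exact: f_finv.
  by apply: connect_trans q0q _; rewrite fconnect_sym // -{2}(f_finv sigma_inj q) fconnect1.
have [cst|[x [y [q0x q0y xy bx by_]]]] := orbit_changes sigma_inj (fun q => b (dtgt (D q))) q0.
  have both q : fconnect sigma q0 q ->
      b (mg_src (D q).1) = b (dtgt (D q0)) /\ b (mg_tgt (D q).1) = b (dtgt (D q0)).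
    move=> q0q; have [q' q0q' e] := pred q q0q.
    have h1 : b (dtgt (D q)) = b (dtgt (D q0)) by apply: cst.
    have h2 : b (dsrc (D q)) = b (dtgt (D q0)) by rewrite -e st2 ?star_linked // cst.
    by case: (D q) h1 h2 => e1 [].
  left=> e e' /imsetP[q]; rewrite inE => q0q -> /imsetP[q']; rewrite inE => q0q' ->.
  have [h1 h2] := both q q0q; have [h1' h2'] := both q' q0q'.
  by rewrite h1 h2 h1'.
have q0s q : fconnect sigma q0 q -> fconnect sigma q0 (sigma q).
  by move=> q0q; apply: connect_trans q0q (fconnect1 _ _).
right; exists (D (sigma x)).1, (D (sigma y)).1; split.
- by apply/imsetP; exists (sigma x); rewrite ?inE ?q0s.
- by apply/imsetP; exists (sigma y); rewrite ?inE ?q0s.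
- have [[ex nx _] _ _] := st1 _ (star_linked (q0s _ q0x)).
  have [[ey _ _] _ _] := st1 _ (star_linked (q0s _ q0y)).
  apply: contraNneq xy => e; apply/eqP/sigma_inj.
  have : sigma x \in [set i; sigma y]%SET by rewrite -ey -e ex !inE eqxx orbT.
  by rewrite !inE eq_sym (negbTE nx) => /eqP.
- by rewrite ends st2 // star_linked.
- by rewrite ends st2 // star_linked.
Qed.

(** Along [D q] the position moves by the length times [q - i] turned by a quarter, and these moves
    close up. Because of the turn, the first coordinates of [q - i] come from the second coordinates
    of the positions and conversely. *)
Lemma star_polygon :
  \sum_(q | fconnect sigma q0 q) mg_len (D q).1 * ((coord q).1 - (coord i).1)%:~R = 0 /\
  \sum_(q | fconnect sigma q0 q) mg_len (D q).1 * ((coord q).2 - (coord i).2)%:~R = 0.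
Proof.
case: st => _ st1 _ st2.
have telescope (F : vertex C -> R) :
    \sum_(q | fconnect sigma q0 q) (F (ctgt (D q)) - F (csrc (D q))) = 0.
  rewrite sumrB [X in _ - X](reindex_inj sigma_inj) /=.
  rewrite [X in _ - X](eq_bigl (fconnect sigma q0)); last first.
    by move=> q; rewrite /= -same_fconnect1_r.
  rewrite -sumrB big1 // => q q0q; rewrite -!val_dsrc -!val_dtgt st2 ?subrr //.
  exact: star_linked.
have step q : fconnect sigma q0 q -> pos (ctgt (D q))
    = translate (pos (csrc (D q))) (mg_len (D q).1) (left_normal i q).
  move=> /star_linked /st1[cr _ _]; have [_ ->] := crosses_src cr; by [].
split.
  rewrite -[RHS](telescope (fun v => (pos v).2)); apply: eq_bigr => q /step ->.
  by rewrite /translate /left_normal /=; ring.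
rewrite -[RHS]oppr0 -[in RHS](telescope (fun v => (pos v).1)) -sumrN; apply: eq_bigr => q /step ->.
by rewrite /translate /left_normal /= rmorphN /=; ring.
Qed.

End Star.

Lemma crosses_dsrc p q r (v : mg_vertex G) d : crosses q p d ->
  tri (sval (v : {v | v \in S})) = [set p; q; r]%SET -> det p q r = 1 -> dsrc d = v.
Proof.
move=> cr Sv h; apply: val_inj; rewrite /= val_dsrc -ctgt_rev; apply/esym.
exact: (crosses_tgtE (crosses_rev cr) Sv h).
Qed.

Lemma out_sum3 p q r (v : mg_vertex G) d1 d2 d3 (phi : dart G -> int) :
  tri (sval (v : {v | v \in S})) = [set p; q; r]%SET -> det p q r = 1 ->
  crosses q p d1 -> crosses r q d2 -> crosses p r d3 ->
  \sum_(d | dsrc d == v) phi d = phi d1 + phi d2 + phi d3.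
Proof.
move=> Sv h c1 c2 c3; have /det_neq[pq pr qr] : det p q r != 0 by rewrite h.
have s1 : dsrc d1 = v := crosses_dsrc c1 Sv h.
have s2 : dsrc d2 = v.
  by apply: (crosses_dsrc c2 (r := p)); [rewrite Sv [RHS]set3_rot | rewrite det_rot].
have s3 : dsrc d3 = v.
  by apply: (crosses_dsrc c3 (r := q)); [rewrite Sv set3_rot | rewrite 2!det_rot].
have [e1 _ _] := c1; have [e2 _ _] := c2; have [e3 _ _] := c3.
have neq x (d d' : dart G) : x \in edg (val d.1) -> x \notin edg (val d'.1) -> d != d'.
  by move=> xd; apply: contraNneq => <-.
have d12 : d1 != d2 by apply: (neq p); rewrite ?e1 ?e2 !inE ?eqxx ?orbT // negb_or pr pq.
have d13 : d1 != d3 by apply: (neq q); rewrite ?e1 ?e3 !inE ?eqxx ?orbT // negb_or eq_sym pq qr.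
have d23 : d2 != d3 by apply: (neq q); rewrite ?e2 ?e3 !inE ?eqxx ?orbT // negb_or eq_sym pq qr.
rewrite (bigD1 d1) /=; last exact/eqP.
rewrite (bigD1 d2) /=; last by rewrite s2 eqxx eq_sym.
rewrite (bigD1 d3) /=; last by rewrite s3 eqxx ![d3 == _]eq_sym d13.
rewrite big1 ?addr0 ?addrA // => d /andP[/andP[/andP[/eqP dv n1] n2] n3].
have Sd : tri (csrc d) = [set p; q; r]%SET by rewrite -val_dsrc dv.
case: (crosses_out Sd h) => cr.
- by rewrite (crosses_uniq cr c1) eqxx in n1.
- by rewrite (crosses_uniq cr c2) eqxx in n2.
- by rewrite (crosses_uniq cr c3) eqxx in n3.
Qed.

(** When the skeleton does not cross the side [q r], the vertex has valence 2 in it. *)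
Lemma out_sum2 p q r (v : mg_vertex G) d1 d3 (phi : dart G -> int) :
  tri (sval (v : {v | v \in S})) = [set p; q; r]%SET -> det p q r = 1 ->
  crosses q p d1 -> (forall d, ~ crosses r q d) -> crosses p r d3 ->
  \sum_(d | dsrc d == v) phi d = phi d1 + phi d3.
Proof.
move=> Sv h c1 c2 c3; have /det_neq[pq pr qr] : det p q r != 0 by rewrite h.
have s1 : dsrc d1 = v := crosses_dsrc c1 Sv h.
have s3 : dsrc d3 = v.
  by apply: (crosses_dsrc c3 (r := q)); [rewrite Sv set3_rot | rewrite 2!det_rot].
have [e1 _ _] := c1; have [e3 _ _] := c3.
have d13 : d3 != d1.
  apply/eqP => e; have : q \in edg (val d3.1) by rewrite e e1 !inE eqxx.
  by rewrite e3 !inE eq_sym (negbTE pq) (negbTE qr).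
rewrite (bigD1 d1) /=; last exact/eqP.
rewrite (bigD1 d3) /=; last by rewrite s3 eqxx.
rewrite big1 ?addr0 // => d /andP[/andP[/eqP dv n1] n3].
have Sd : tri (csrc d) = [set p; q; r]%SET by rewrite -val_dsrc dv.
case: (crosses_out Sd h) => cr.
- by rewrite (crosses_uniq cr c1) eqxx in n1.
- by have := c2 _ cr.
- by rewrite (crosses_uniq cr c3) eqxx in n3.
Qed.

Definition edges_at i (K : {set mg_edge G}) : Prop :=
  forall p q d, crosses p q d -> d.1 \in K -> (i == p) || (i == q).

Lemma not_edges_at i K p q d : edges_at i K -> crosses p q d -> i != p -> i != q ->
  d.1 \notin K.
Proof. by move=> at_ cr ip iq; apply/negP => /(at_ _ _ _ cr); rewrite (negbTE ip) (negbTE iq). Qed.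

Lemma star_next i D sigma v q r : star i D sigma -> tri v = [set i; q; r]%SET ->
  det i q r = 1 -> linked X i q /\ sigma q = r.
Proof.
move=> [_ st1 _ _] Sv h; have /det_neq[iq _ _] : det i q r != 0 by rewrite h.
have Liq : linked X i q by apply: (@tri_linked v); rewrite // Sv !inE eqxx ?orbT.
split=> //; have [cr Sq hq] := st1 q Liq.
have vE := crosses_tgtE cr Sv h; move: Sq; rewrite -vE Sv => /third_vertex.
by rewrite h => /(_ isT).
Qed.

(** * Attaching the cycle of another inner point to the hub *)

Section Attach.
Variables (H : lp) (D : lp -> dart G) (sigma : lp -> lp).
Hypothesis stH : star H D sigma.
Variables (i : lp) (Di : lp -> dart G) (sigmai : lp -> lp).
Hypothesis sti : star i Di sigmai.
Variables (x : lp) (L : {set mg_edge G}).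
Hypotheses (Lx : edges_at x L) (xi : x != i) (xH : x != H) (iin : inner i).

Let crH q : linked X H q -> crosses H q (D q).
Proof. by case: stH => _ st1 _ _ /st1[]. Qed.

Let cri q : linked X i q -> crosses i q (Di q).
Proof. by case: sti => _ st1 _ _ /st1[]. Qed.

(** The segment [H i] is dual to an edge shared with the hub. At the triangle [H i r], with [r] the
    successor of [i], the paths separate, and [i r] is dual to [eps]. *)
Lemma attach_edge_right oa : linked X H i -> sigma i != x ->
  attached (star_edges Di sigmai H) L (dsrc (D i)) (dsrc (D (sigma i))) oa
    (D (sigma i)) (Di (sigma i)).1.
Proof.
move=> Hi rx; have [_ st1 stL st2] := stH; have [c1 Sv h] := st1 i Hi.
set r := sigma i in rx Sv h *.
have h2 : det i r H = 1 by rewrite det_rot.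
have S2 : tri (ctgt (D i)) = [set i; r; H]%SET by rewrite Sv [RHS]set3_rot.
have [Lir sr] := star_next sti S2 h2.
have iH : linked X i H by rewrite linked_sym.
have Hr : fconnect sigmai H r by rewrite fconnect_sym; [rewrite -sr fconnect1 | case: sti].
have Sd : tri (sval (dtgt (D i) : {v | v \in S})) = [set H; i; r]%SET by rewrite val_dtgt.
have cw := crosses_rev c1; have cr := crosses_rev (cri Lir).
apply: (@AttachedEdge _ _ _ _ _ _ _ _ _ (drev (D i)) (drev (Di r))) => //.
- by apply: (star_edges_in sti iH (q := H)); auto.
- by apply: (not_edges_at Lx cw).
- by apply: (star_edges_in sti iH (q := r)); auto.
- by apply: (not_edges_at Lx cr); rewrite // eq_sym.
- by rewrite dsrc_rev -st2.
- by rewrite dtgt_rev.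
- by rewrite st2 //; apply: (crosses_dsrc cr (r := H)); [rewrite Sd [RHS]set3_rot | rewrite det_rot].
- move=> phi; rewrite st2 // (out_sum3 phi Sd h cw cr (crH (stL i Hi))).
  by [].
Qed.

Lemma attach_edge_left oa r : linked X H r -> sigma r = i -> r != x ->
  attached (star_edges Di sigmai H) L (dtgt (D i)) (dtgt (D r)) oa
    (drev (D r)) (Di r).1.
Proof.
move=> Hr ri rx; have [_ st1 stL st2] := stH; have [c1 Sv h] := st1 r Hr.
have Hi : linked X H i by rewrite -ri; exact: stL.
rewrite ri in Sv h; have h2 : det i H r = 1 by rewrite 2!det_rot.
have S2 : tri (ctgt (D r)) = [set i; H; r]%SET by rewrite Sv set3_rot.
have [LiH sr] := star_next sti S2 h2.
have Lir : linked X i r by rewrite -sr; case: sti => _ _ + _; apply.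
have Hr' : fconnect sigmai H r by rewrite -sr fconnect1.
have Sd : tri (sval (dtgt (D r) : {v | v \in S})) = [set H; r; i]%SET by rewrite val_dtgt.
have cw := crosses_rev c1; have cr := cri Lir; have cH := crH Hi.
apply: (@AttachedEdge _ _ _ _ _ _ _ _ _ (D i) (Di r)) => //.
- by apply: (star_edges_in sti LiH (q := H)); auto.
- by apply: (not_edges_at Lx cH).
- by apply: (star_edges_in sti LiH (q := r)); auto.
- by apply: (not_edges_at Lx cr); rewrite // eq_sym.
- by rewrite -ri st2.
- by apply: (crosses_dsrc cr (r := H)); [rewrite Sd [RHS]set3_rot | rewrite det_rot].
- by move=> phi; rewrite (out_sum3 phi Sd h cw cr cH); ring.
Qed.

Variables (y p : lp) (z : vertex C).
Hypotheses (xy : x != y) (xp : x != p) (yi : y != i) (pi : p != i) (Hin : inner H).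

(** The bridge is dual to [y p]: the triangles on its two sides have the apexes [H] and [i], both
    inner, so [crosses_bridge] applies. *)
Lemma attach_bridge_right : linked X H p -> sigma p = y ->
  tri z = [set y; p; i]%SET -> det y p i = 1 ->
  attached (star_edges Di sigmai p) L (dsrc (D y)) (dsrc (D y)) (Some (drev (D p)))
    (D y) (Di y).1.
Proof.
move=> Hp py Sz hz; have [_ st1 stL st2] := stH; have [c1 Sv h] := st1 p Hp.
have Hy : linked X H y by rewrite -py; exact: stL.
rewrite py in Sv h.
have [g cg] : exists d, crosses y p d.
  apply: (crosses_bridge (v := z) (w := ctgt (D p)) (r := i) (s := H)) => //.
    by rewrite Sv [RHS]set3_rot.
  by rewrite det_rot.
have gz := crosses_tgtE cg Sz hz.
have h2 : det i y p = 1 by rewrite 2!det_rot.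
have S2 : tri z = [set i; y; p]%SET by rewrite Sz set3_rot.
have [Liy sy] := star_next sti S2 h2.
have Lip : linked X i p by rewrite -sy; case: sti => _ _ + _; apply.
have py' : fconnect sigmai p y by rewrite fconnect_sym; [rewrite -sy fconnect1 | case: sti].
have DyE : dsrc (D y) = dtgt (D p) by rewrite -py st2.
have Sd : tri (sval (dtgt (D p) : {v | v \in S})) = [set H; p; y]%SET by rewrite val_dtgt.
have Sg : tri (sval (dtgt g : {v | v \in S})) = [set y; p; i]%SET by rewrite val_dtgt -gz.
have cw := crosses_rev c1; have cp := cri Lip; have cy := crosses_rev (cri Liy).
have Lk := star_edges_at sti Lip.
apply: (@AttachedBridge _ _ _ _ _ _ _ _ _ (drev (D p)) g (Di p) (drev (Di y))) => //.
- by apply: (not_edges_at (Lk : edges_at i _) cg); rewrite eq_sym.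
- exact: (not_edges_at Lx cg).
- by rewrite DyE; apply: (crosses_dsrc cg (r := H)); [rewrite Sd [RHS]set3_rot | rewrite det_rot].
- by apply: (crosses_dsrc cp (r := y)); [rewrite Sg [RHS]set3_rot | rewrite det_rot].
- by apply: (crosses_dsrc cy (r := p)); [rewrite Sg set3_rot | rewrite 2!det_rot].
- by apply: (star_edges_in sti Lip (q := p)); auto.
- by apply: (star_edges_in sti Lip (q := y)); auto.
- exact: (not_edges_at Lx cy).
- by move=> phi; rewrite DyE (out_sum3 phi Sd h cw cg (crH Hy)); ring.
- by move=> phi; rewrite (out_sum3 phi Sg hz (crosses_rev cg) cp cy).
Qed.

Lemma attach_bridge_left : linked X H y -> sigma y = p ->
  tri z = [set p; y; i]%SET -> det p y i = 1 ->
  attached (star_edges Di sigmai p) L (dtgt (D y)) (dtgt (D y)) (Some (D p))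
    (drev (D y)) (Di y).1.
Proof.
move=> Hy yp Sz hz; have [_ st1 stL st2] := stH; have [c1 Sv h] := st1 y Hy.
have Hp : linked X H p by rewrite -yp; exact: stL.
rewrite yp in Sv h.
have [g cg] : exists d, crosses p y d.
  apply: (crosses_bridge (v := z) (w := ctgt (D y)) (r := i) (s := H)) => //.
    by rewrite Sv [RHS]set3_rot.
  by rewrite det_rot.
have gz := crosses_tgtE cg Sz hz.
have h2 : det i p y = 1 by rewrite 2!det_rot.
have S2 : tri z = [set i; p; y]%SET by rewrite Sz set3_rot.
have [Lip sy] := star_next sti S2 h2.
have Liy : linked X i y by rewrite -sy; case: sti => _ _ + _; apply.
have py' : fconnect sigmai p y by rewrite -sy fconnect1.
have Sd : tri (sval (dtgt (D y) : {v | v \in S})) = [set H; y; p]%SET by rewrite val_dtgt.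
have Sg : tri (sval (dtgt g : {v | v \in S})) = [set p; y; i]%SET by rewrite val_dtgt -gz.
have cw := crosses_rev c1; have cp := crosses_rev (cri Lip); have cy := cri Liy.
have Lk := star_edges_at sti Lip.
apply: (@AttachedBridge _ _ _ _ _ _ _ _ _ (D p) g (drev (Di p)) (Di y)) => //.
- by apply: (not_edges_at (Lk : edges_at i _) cg); rewrite eq_sym.
- exact: (not_edges_at Lx cg).
- by apply: (crosses_dsrc cg (r := H)); [rewrite Sd [RHS]set3_rot | rewrite det_rot].
- by apply: (crosses_dsrc cp (r := y)); [rewrite Sg set3_rot | rewrite 2!det_rot].
- by apply: (crosses_dsrc cy (r := p)); [rewrite Sg [RHS]set3_rot | rewrite det_rot].
- by apply: (star_edges_in sti Lip (q := p)); auto.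
- by apply: (star_edges_in sti Lip (q := y)); auto.
- exact: (not_edges_at Lx cy).
- by move=> phi; rewrite (out_sum3 phi Sd h cw cg (crH Hp)); ring.
- by move=> phi; rewrite (out_sum3 phi Sg hz (crosses_rev cg) cy cp); ring.
Qed.

End Attach.

(** The long arc is dual to the segments from [H] to [o a0], ..., [o a1]. Between them the sides
    opposite [H] are not crossed, which gives valence 2 as required by [hyperelliptic_arcs]. *)
Lemma hub_arcs H D sigma w j k (K J : {set mg_edge G}) Xk Xj oa ek ej (a0 a1 : nat) :
  star H D sigma -> linked X H w -> inner H ->
  let o t := iter t sigma w in
  cyclic_edges K -> cyclic_edges J -> edges_at k K -> edges_at j J ->
  attached K J Xk (dsrc (D (o a0))) oa (D (o a0)) ek ->
  attached J K Xj (dtgt (D (o a1))) (omap (@drev R G) oa) (drev (D (o a1))) ej ->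
  (a0 <= a1)%N -> k != H -> j != H ->
  (forall t, (a0 <= t <= a1)%N -> k != o t /\ j != o t) ->
  (forall t, (a0 <= t < a1)%N -> forall d, ~ crosses (o t.+1) (o t) d) ->
  (if oa is Some a then [/\ dsrc a = Xk, dtgt a = Xj & exists p, [/\ crosses p H a,
      k != p, j != p & forall t, (a0 <= t <= a1)%N -> o t != p]] else Xk = Xj) ->
  hyperelliptic G ->
  exists2 a, oa = Some a
    & \sum_(i < (a1 - a0).+1) mg_len (D (o (a0 + i)%N)).1 = mg_len a.1.
Proof.
move=> st Hw Hin o cK cJ Kk Jj atK atJ a01 kH jH kj chord aspec hyp.
have [_ st1 stL st2] := st.
have Ho t : linked X H (o t) by elim: t => //= t; exact: stL.
have cr t : crosses H (o t) (D (o t)) by have [] := st1 _ (Ho t).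
have aux (K' J' : {set mg_edge G}) X' Y' oa' b (f : mg_edge G) : attached K' J' X' Y' oa' b f -> f \in K' /\ f \notin J'.
  by case=> [d1 d2 _ _ ? ? -> //|a g d1 d2 _ _ _ _ _ _ _ _ ? ? -> //].
have [ekK ekJ] := aux _ _ _ _ _ _ _ atK; have [ejJ ejK] := aux _ _ _ _ _ _ _ atJ.
have rng i : (i <= a1 - a0)%N -> (a0 <= a0 + i <= a1)%N.
  by move=> ia; rewrite leq_addr -[X in (_ <= X)%N](subnKC a01) leq_add2l.
have m1 : (a0 + (a1 - a0))%N = a1 by rewrite subnKC.
apply: (hyperelliptic_arcs (m := (a1 - a0)%N) (h := fun i => D (o (a0 + i)%N)) cK cJ
   (Xk := Xk) (Xj := Xj) (Yk := dsrc (D (o a0))) (Yj := dtgt (D (o a1))) (ek := ek) (ej := ej)) => //.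
- by rewrite addn0.
- by rewrite m1.
- by rewrite addn0.
- by rewrite m1.
- move=> i /rng it; have [ki ji] := kj _ it.
  by split; [apply: (not_edges_at Kk (cr _)) | apply: (not_edges_at Jj (cr _))].
- by move=> i _; rewrite addnS /= st2.
- move=> t ta phi; have [c1 Sv h] := st1 _ (Ho (a0 + t)%N).
  rewrite addnS; apply: (out_sum2 _ (r := o (a0 + t).+1) _ h); rewrite ?val_dtgt //.
  + exact: crosses_rev.
  + apply: chord; rewrite leq_addr -[X in (_ < X)%N](subnKC a01) ltn_add2l //.
case: oa {atK atJ} aspec => // a [aX aJ [p [cp kp jp op]]]; split=> //.
- exact: (not_edges_at Kk cp).
- exact: (not_edges_at Jj cp).
move=> i /rng /op; apply: contraNneq => e; have [ep _ _] := cp; have [eo no _] := cr (a0 + i)%N.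
have : o (a0 + i)%N \in [set p; H]%SET by rewrite -ep e eo !inE eqxx orbT.
by rewrite !inE [_ == H]eq_sym (negbTE no) orbF.
Qed.

(** * From finite checks on coordinates to the triangulation around the hub *)

Definition names (sel : seq (lp * lp)) := [seq (nc s.1, nc s.2) | s <- sel].

Lemma linked_compatible sel p q : all (fun s => linked X s.1 s.2) sel ->
  linked X p q -> compatible (names sel) (nc p) (nc q).
Proof.
move=> ls pq; rewrite /compatible all_map; apply: sub_all ls => s ls /=.
exact: (linked_no_cross triX pq ls).
Qed.

Lemma forced_apexP sel p q r v (c : nat * nat) : all (fun s => linked X s.1 s.2) sel ->
  forced_apex (names sel) (nc p) (nc q) c ->
  tri v = [set p; q; r]%SET -> det p q r = 1 -> nc r = c.
Proof.
move=> ls fa Sv h; have /det_neq[pq pr qr] : det p q r != 0 by rewrite h.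
have [pv qv rv] : [/\ p \in tri v, q \in tri v & r \in tri v] by rewrite Sv !inE !eqxx !orbT.
move: fa => /allP /(_ (nc r)); rewrite mem_filter -det_ndet h eqxx nc_points => /(_ isT).
by rewrite (linked_compatible ls (tri_linked pv rv pr)) (linked_compatible ls (tri_linked qv rv qr)) => /eqP.
Qed.

Lemma dead_chord sel bad H p q d : all (fun s => linked X s.1 s.2) sel ->
  no_chord (names sel) (nc H) bad -> linked X H p -> linked X H q -> linked X p q ->
  det H p q = 1 -> ~~ inner p -> ~~ inner q -> ~~ bad (nc p) -> ~~ bad (nc q) ->
  ~ crosses q p d.
Proof.
move=> ls nch Hp Hq pq h pi qi bp bq cr.
apply: (dead_end cr qi pi) => z zin.
move: nch => /allP /(_ (nc p)); rewrite mem_filter pi nc_points => /(_ isT).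
move=> /allP /(_ (nc q)); rewrite mem_filter -det_ndet h eqxx qi nc_points => /(_ isT).
by rewrite !(linked_compatible ls) // bp bq => /allP /(_ (nc z) zin).
Qed.

Lemma hub_range H D sigma w u j k N : star H D sigma -> linked X H w ->
  let o t := iter t sigma w in
  perm_eq inner_points [:: nc H; nc j; nc k] -> o N = u -> (N < order sigma w)%N ->
  (w == k) || ~~ linked X H k -> (u == j) || ~~ linked X H j -> u != w ->
  ((w == k) && (u == j) -> det H w u != 1) ->
  ((w == k) <= N - (u == j) <= N)%N /\
  forall t, ((w == k) <= t <= N - (u == j))%N -> ~~ inner (o t).
Proof.
move=> st Hw o ip oN No wk uj uw wu; have [s_inj st1 stL _] := st.
have Ho t : linked X H (o t) by elim: t => //= t; exact: stL.
have N0 : (0 < N)%N by rewrite lt0n; apply: contra_neq uw => N0; rewrite -oN N0.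
have N1 : (w == k) && (u == j) -> (1 < N)%N.
  move=> /wu; apply: contraNT; rewrite -leqNgt => N1; have NE : N = 1%N by apply/eqP; rewrite eqn_leq N1.
  by rewrite -oN NE /=; have [_ _ ->] := st1 w Hw.
split.
  rewrite leq_subr andbT; move: N0 N1; case: (w == k); case: (u == j) => /=; rewrite ?subn0 //.
    by move=> _ /(_ isT); rewrite subn_gt0.
have tlt t : ((w == k) <= t <= N - (u == j))%N -> (t < order sigma w)%N.
  by case/andP => _ /leq_ltn_trans; apply; apply: leq_ltn_trans No; rewrite leq_subr.
move=> t tr; have tn := tlt t tr; apply/negP => oi; have [Hot _] := linkedP _ _ _ (Ho t).
have : nc (o t) \in [:: nc H; nc j; nc k] by rewrite -(perm_mem ip).
rewrite !inE !(inj_eq nc_inj) [_ == H]eq_sym (negbTE Hot) /= => /orP[/eqP oj|/eqP ok].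
  have uj1 : u == j by case/orP: uj => // /negP[]; rewrite -oj.
  have tN : t = N.
    by apply: (orbit_iter_inj tn No); rewrite -/(o t) -/(o N) oN oj (eqP uj1).
  by move: tr; rewrite tN uj1 => /andP[_]; rewrite leqNgt subn1 prednK ?leqnn.
have wk1 : w == k by case/orP: wk => // /negP[]; rewrite -ok.
have t0 : t = 0%N.
  by apply: (orbit_iter_inj tn (leq_ltn_trans (leq0n N) No)); rewrite -/(o t) ok -(eqP wk1).
by move: tr; rewrite t0 wk1.
Qed.

Lemma hub_contradiction H p0 j k b : hyperelliptic G -> linked X H p0 ->
  hub_check (nc H) (nc p0) (nc j) (nc k) b -> False.
Proof.
move=> hyp Hp0; pose lam a := coordinate b a - coordinate b (nc H); rewrite /hub_check.
move=> /and5P[ip p0n]; rewrite -/(lam _) => lp0 lamn chk.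
have inE3 q : inner q = (q \in [:: H; j; k]).
  by rewrite /inner (perm_mem ip) !inE !(inj_eq nc_inj).
have Hin : inner H by rewrite inE3 !inE eqxx.
have jin : inner j by rewrite inE3 !inE eqxx orbT.
have kin : inner k by rewrite inE3 !inE eqxx !orbT.
have := perm_uniq ip; rewrite [uniq inner_points](_ : _ = true) // => /esym.
rewrite /= !inE !(inj_eq nc_inj) negb_or andbT => /andP[/andP[Hj Hk] jk].
have p0i : ~~ inner p0 by [].
have not_in q q' : inner q -> ~~ inner q' -> q != q'.
  by move=> qi; apply: contraNneq => <-.
have [d0 _] : exists d, crosses H p0 d by apply: crosses_inner; rewrite ?Hin.
have [D [sigma st]] := star_exists d0 Hin.
have [Dj [sj stj]] := star_exists d0 jin; have [Dk [sk stk]] := star_exists d0 kin.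
have [s_inj st1 stL st2] := st.
have [w wE] : exists w, sigma p0 = w by exists (sigma p0).
have [u uE] : exists u, sigma u = p0 by exists (finv sigma p0); rewrite f_finv.
have Hw : linked X H w by rewrite -wE; exact: stL.
have Hu : linked X H u.
  apply: (star_linked st Hw); rewrite fconnect_sym //.
  by rewrite -wE -uE; apply: connect_trans (fconnect1 _ _) (fconnect1 _ _).
have [cp0 Sp0 hp0] := st1 p0 Hp0; have [cu Su hu] := st1 u Hu.
rewrite wE in Sp0 hp0; rewrite uE in Su hu.
have /det_neq[_ _ p0w] : det H p0 w != 0 by rewrite hp0.
have /det_neq[_ _ up0] : det H u p0 != 0 by rewrite hu.
have Lwp : linked X w p0.
  by apply: (@tri_linked (ctgt (D p0))); rewrite 1?eq_sym // Sp0 !inE eqxx ?orbT.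
have Lpu : linked X p0 u.
  by apply: (@tri_linked (ctgt (D u))); rewrite 1?eq_sym // Su !inE eqxx ?orbT.
pose sel := [:: (H, p0); if w == k then (H, w) else (w, p0); if u == j then (H, u) else (p0, u)].
have ls : all (fun s => linked X s.1 s.2) sel.
  by rewrite /= Hp0; case: (w == k); case: (u == j); rewrite /= ?Hw ?Hu ?Lwp ?Lpu.
have selE : [:: (nc H, nc p0); if nc w == nc k then (nc H, nc w) else (nc w, nc p0);
    if nc u == nc j then (nc H, nc u) else (nc p0, nc u)] = names sel.
  by rewrite /names /sel /= !(inj_eq nc_inj); case: (w == k); case: (u == j).
move: chk => /allP /(_ (nc u)); rewrite mem_filter -det_ndet hu eqxx nc_points => /(_ isT).
move=> /allP /(_ (nc w)); rewrite mem_filter -det_ndet hp0 eqxx nc_points => /(_ isT).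
rewrite selE !(inj_eq nc_inj) => /and5P[wk uj uw wu /and4P[nch lw lu strict]].
have wk' : (w == k) || ~~ linked X H k.
  case/orP: wk => [->//|/and4P[_ nk _ _]]; apply/orP; right.
  by apply: contra nk; exact: (linked_compatible ls).
have uj' : (u == j) || ~~ linked X H j.
  case/orP: uj => [->//|/and4P[_ nj _ _]]; apply/orP; right.
  by apply: contra nj; exact: (linked_compatible ls).
(* Beyond the segment [w p0] the triangle is forced to have the apex [k], so the dual edge is a
   bridge to the cycle around [k]. *)
have TK : w != k -> exists v, [/\ tri v = [set w; p0; k]%SET, det w p0 k = 1 & ~~ inner w].
  move=> nwk; move: wk; rewrite (negbTE nwk) /= => /and4P[wi _ ss fa].
  have [v [r [Sv hv]]] := left_triangle Lwp ss.
  have := forced_apexP ls fa Sv hv => /nc_inj rk.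
  by exists v; rewrite -rk.
have TJ : u != j -> exists v, [/\ tri v = [set p0; u; j]%SET, det p0 u j = 1 & ~~ inner u].
  move=> nuj; move: uj; rewrite (negbTE nuj) /= => /and4P[ui _ ss fa].
  have [v [r [Sv hv]]] := left_triangle Lpu ss.
  have := forced_apexP ls fa Sv hv => /nc_inj rj.
  by exists v; rewrite -rj.
pose o t := iter t sigma w; pose n := order sigma w.
have n0 : (0 < n)%N by apply: order_gt0.
have on : o n = w by apply: iter_order.
have on1 : o n.-1 = p0.
  by apply: s_inj; rewrite wE -[RHS]on -[in RHS](prednK n0).
have n1 : (1 < n)%N.
  rewrite ltn_neqAle n0 andbT; apply: contra_neq p0w => n1.
  by rewrite -on1 -n1.
(* Around [H] the points [u], [p0], [w] are consecutive. Counted from [w], the point [p0] has the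
   last index [N.+1] and [u] the index [N]. *)
pose N := n.-2; have nE : n = N.+2 by rewrite /N; case: (n) n1 => [|[]].
have oN : o N = u.
  by apply: s_inj; rewrite uE -on1 nE.
have No : (N < order sigma w)%N by rewrite -/n nE.
have [rng nin] := hub_range st Hw ip oN No wk' uj' uw (implyP wu).
pose a0 : nat := w == k; pose a1 := (N - (u == j))%N.
have tN t : (a0 <= t <= a1)%N -> (t <= N)%N.
  by case/andP => _ /leq_trans; apply; rewrite leq_subr.
have op0 t : (a0 <= t <= a1)%N -> o t != p0.
  move=> /tN tn; rewrite -on1; apply/eqP => /orbit_iter_inj; rewrite -/n nE /= => /(_ _ _).
  by move=> /(_ (leqW tn) (ltnSn _)) te; move: tn; rewrite te ltnn.
have Ho t : linked X H (o t) by elim: t => //= t; exact: stL.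
(* These neighbours of [k] and [j] start the orbits whose cycles carry the attachment: [H] for a
   shared edge, [p0] for a bridge. *)
pose xk := if w == k then H else p0; pose xj := if u == j then H else p0.
have Lk : linked X k xk.
  rewrite /xk; case: eqP => [wk0|/eqP /TK[v [Sv h _]]]; first by rewrite linked_sym -wk0.
  have /det_neq[_ wk1 pk] : det w p0 k != 0 by rewrite h.
  by apply: (@tri_linked v); rewrite ?Sv ?inE ?eqxx ?orbT // eq_sym.
have Lj : linked X j xj.
  rewrite /xj; case: eqP => [uj0|/eqP /TJ[v [Sv h _]]]; first by rewrite linked_sym -uj0.
  have /det_neq[pj uj1 _] : det p0 u j != 0 by rewrite h.
  by apply: (@tri_linked v); rewrite ?Sv ?inE ?eqxx ?orbT // eq_sym.
pose K := star_edges Dk sk xk; pose J := star_edges Dj sj xj.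
have Kk : edges_at k K := star_edges_at stk Lk.
have Jj : edges_at j J := star_edges_at stj Lj.
have [no0 no1] : ~~ inner (o a0) /\ ~~ inner (o a1).
  by case/andP: rng => r1 _; split; apply: nin; rewrite leqnn ?r1.
have kj : k != j by rewrite eq_sym.
have jH : j != H by rewrite eq_sym.
have kH : k != H by rewrite eq_sym.
have p0j : p0 != j by rewrite eq_sym not_in.
have p0k : p0 != k by rewrite eq_sym not_in.
have [ek atK] : exists ek, attached K J (dsrc (D w)) (dsrc (D (o a0)))
    (Some (drev (D p0))) (D (o a0)) ek.
  move: no0; rewrite /K /xk /o /a0; case: (eqVneq w k) => [wk0|wk0] /= no0.
    rewrite wk0 in no0 *; exists (Dk (sigma k)).1.
    apply: (attach_edge_right st stk Jj jk jH); first by rewrite -wk0.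
    by rewrite eq_sym not_in.
  have [v [Sv h wi]] := TK wk0; exists (Dk w).1.
  exact: (attach_bridge_right st stk Jj jk kin (not_in _ _ jin wi) (not_in _ _ jin p0i)
    wk0 p0k Hin Hp0 wE Sv h).
have [ej atJ] : exists ej, attached J K (dtgt (D u)) (dtgt (D (o a1)))
    (Some (D p0)) (drev (D (o a1))) ej.
  move: no1; rewrite /J /xj /a1; case: (eqVneq u j) => [uj0|uj0] /= no1.
    have so : sigma (o (N - 1)%N) = j.
      have N0 : (0 < N)%N by rewrite lt0n; apply: contra_neq uw => N0; rewrite -oN N0.
      by rewrite -uj0 -oN -[in RHS](prednK N0) subn1.
    rewrite uj0; exists (Dj (o (N - 1)%N)).1.
    apply: (attach_edge_left st stj Kk kj kH _ (Ho _) so).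
    by rewrite eq_sym not_in.
  rewrite subn0 oN; have [v [Sv h ui]] := TJ uj0; exists (Dj u).1.
  exact: (attach_bridge_left st stj Kk kj jin (not_in _ _ kin ui) (not_in _ _ kin p0i)
    uj0 p0j Hin Hu uE Sv h).
have atJ' : attached J K (dtgt (D u)) (dtgt (D (o a1)))
    (omap (@drev R G) (Some (drev (D p0)))) (drev (D (o a1))) ej by rewrite /= drevK.
have a01 : (a0 <= a1)%N by case/andP: rng.
have [|||||_ [<-]] := hub_arcs st Hw Hin (star_cyclic stk Lk) (star_cyclic stj Lj)
  Kk Jj atK atJ' a01 _ _ _ _ _ hyp; first by [].
- by [].
- by move=> t /nin ot; rewrite !not_in.
- move=> t /andP[t0 t1]; have tin : (a0 <= t <= a1)%N by rewrite t0 ltnW.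
  have t1in : (a0 <= t.+1 <= a1)%N by rewrite t1 (leq_trans t0).
  have [_ Sv hv] := st1 _ (Ho t); have /det_neq[_ _ tt] : det H (o t) (o t.+1) != 0 by rewrite hv.
  move=> d; apply: (dead_chord ls nch (Ho t) (Ho t.+1) _ hv).
  + by apply: (@tri_linked (ctgt (D (o t)))); rewrite // Sv !inE eqxx ?orbT.
  + exact: nin.
  + exact: (nin t.+1).
  + by rewrite /= (inj_eq nc_inj) op0.
  + by rewrite /= (inj_eq nc_inj) (op0 t.+1).
- split; [by rewrite dsrc_rev -wE st2 | by rewrite dtgt_rev -uE st2 |].
  by exists p0; split; rewrite ?not_in //; exact: crosses_rev.
move=> arcs.
have [poly1 poly2] := star_polygon st Hw.
have poly : \sum_(t < n) mg_len (D (o t)).1 * (lam (nc (o t)))%:~R = 0.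
  rewrite /lam; case: (b).
    by apply: etrans poly1; rewrite sum_orbit.
  by apply: etrans poly2; rewrite sum_orbit.
have int_ge (z : int) : - 1 <= z -> (- 1 : R) <= z%:~R.
  by move=> z1; rewrite -[(- 1 : R)]/((- 1)%:~R) ler_int.
have int_gt (z : int) : - 1 < z -> (- 1 : R) < z%:~R.
  by move=> z1; rewrite -[(- 1 : R)]/((- 1)%:~R) ltr_int.
(* In the closing relation [p0] has coefficient 1, and its edge, the short arc, has the length of
   the long arc. Substituting this leaves a sum that [arc_inequality] shows to be nonzero. *)
have : \sum_(t < N.+1) mg_len (D (o t)).1 * (lam (nc (o t)))%:~R
    + \sum_(i < (a1 - a0).+1) mg_len (D (o (a0 + i)%N)).1 = 0.
  rewrite arcs -[RHS]poly nE [RHS]big_ord_recr; congr (_ + _).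
  by rewrite /= -/(o N) oN uE (eqP lp0) mulr1.
apply/eqP/(@arc_inequality R N a0 a1 (fun t => mg_len (D (o t)).1)
  (fun t => (lam (nc (o t)))%:~R) rng); first by move=> t; exact: mg_len_gt0.
- move=> t /nin /= oi; apply: int_ge.
  by have /allP/(_ _ (nc_points (o t)))/implyP := lamn; apply.
- move=> t tN'; rewrite negb_and -!ltnNge /a0 /a1 ler0z => /orP[].
    by case: (w == k) lw => //= lw; rewrite ltnS leqn0 => /eqP ->.
  case: (u == j) lu => /= lu; last by rewrite subn0 ltnNge tN'.
  rewrite subn1 => Nt; suff -> : t = N by rewrite oN.
  by apply/eqP; rewrite eqn_leq tN' (leq_trans (leqSpred N) Nt).
have N0 : (0 < N)%N by rewrite lt0n; apply: contra_neq uw => N0; rewrite -oN N0.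
have r0 : (a0 <= 0 <= a1)%N = (w != k).
  by move: a01; rewrite leqn0 /a0; case: (w == k).
have rN : (a0 <= N <= a1)%N = (u != j).
  move: a01; rewrite /a1; case: (u == j); last by rewrite subn0 leqnn andbT.
  by rewrite subn1 [(N <= _)%N]leqNgt ltn_predL N0 andbF.
case/orP: strict => [sw|su].
  by exists 0%N; rewrite // r0; move: sw; case: (w == k) => /= sw; rewrite ?ltr0z ?int_gt.
exists N; rewrite // rN oN; move: su; case: (u == j) => /= su; rewrite ?ltr0z ?int_gt //.
Qed.

(** For three pairwise linked inner points: [forced_apex] makes [h j k] a triangle, and
    [ndet h k j != 1] keeps the other arc, from [k] around to [j], nonempty. *)
Definition k4_check (h j k : nat * nat) :=
  let sel := [:: (h, j); (h, k); (j, k)] in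
  [&& perm_eq inner_points [:: h; j; k], ndet h k j != 1, forced_apex sel h j k
    & no_chord sel h pred0].

(** As [sigma j] is [k], the short arc shrinks to the vertex dual to [H j k], so [oa] is [None],
    whereas [hub_arcs] would require a dart. *)
Lemma k4_contradiction H j k : hyperelliptic G -> linked X H j -> linked X H k ->
  linked X j k -> k4_check (nc H) (nc j) (nc k) -> False.
Proof.
move=> hyp Hj Hk jk /and4P[ip nd fa nch].
have inE3 q : inner q = (q \in [:: H; j; k]).
  by rewrite /inner (perm_mem ip) !inE !(inj_eq nc_inj).
have Hin : inner H by rewrite inE3 !inE eqxx.
have jin : inner j by rewrite inE3 !inE eqxx orbT.
have kin : inner k by rewrite inE3 !inE eqxx !orbT.
have [nHj _] := linkedP _ _ _ Hj; have [nHk _] := linkedP _ _ _ Hk.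
have [njk _] := linkedP _ _ _ jk.
have kj : k != j by rewrite eq_sym.
have jH : j != H by rewrite eq_sym.
have kH : k != H by rewrite eq_sym.
have not_in q q' : inner q -> ~~ inner q' -> q != q'.
  by move=> qi; apply: contraNneq => <-.
have [d0 _] : exists d, crosses H j d by apply: crosses_inner; rewrite ?Hin.
have [D [sigma st]] := star_exists d0 Hin.
have [Dj [sj stj]] := star_exists d0 jin; have [Dk [sk stk]] := star_exists d0 kin.
have [s_inj st1 stL st2] := st.
pose sel := [:: (H, j); (H, k); (j, k)].
have ls : all (fun s => linked X s.1 s.2) sel by rewrite /= Hj Hk jk.
have sjk : sigma j = k.
  by have [_ Sv hv] := st1 j Hj; apply/nc_inj/(forced_apexP ls fa Sv hv).
pose o t := iter t sigma k; pose n := order sigma k.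
have n0 : (0 < n)%N by apply: order_gt0.
have on : o n = k by apply: iter_order.
have on1 : o n.-1 = j.
  by apply: s_inj; rewrite sjk -[RHS]on -[in RHS](prednK n0).
have No : (n.-1 < order sigma k)%N by rewrite -/n prednK.
have Ho t : linked X H (o t) by elim: t => //= t; exact: stL.
have [||||] := @hub_range H D sigma k j j k n.-1 st Hk ip on1 No; rewrite ?eqxx //.
move=> /andP[n1 _] nin; set a1 := (_ - _)%N in n1 nin.
have [no0 no1] : ~~ inner (o 1%N) /\ ~~ inner (o a1).
  by split; apply: nin; rewrite leqnn ?n1.
have Lj : linked X j H by rewrite linked_sym.
have Lk : linked X k H by rewrite linked_sym.
have Kk := star_edges_at stk Lk; have Jj := star_edges_at stj Lj.
have so : sigma (o a1) = j.
  rewrite -on1 -[in RHS](prednK (leq_trans n1 (leq_subr _ _))).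
  by rewrite /a1 subn1.
have atK : attached (star_edges Dk sk H) (star_edges Dj sj H) (dsrc (D k)) (dsrc (D (o 1%N)))
    None (D (o 1%N)) (Dk (sigma k)).1.
  by apply: (attach_edge_right st stk Jj _ jH) => //; rewrite eq_sym not_in.
have atJ : attached (star_edges Dj sj H) (star_edges Dk sk H) (dtgt (D j)) (dtgt (D (o a1)))
    (omap (@drev R G) None) (drev (D (o a1))) (Dj (o a1)).1.
  by apply: (attach_edge_left st stj Kk kj kH _ (Ho _) so); rewrite eq_sym not_in.
have [|||a] // := hub_arcs st Hk Hin (star_cyclic stk Lk) (star_cyclic stj Lj)
  Kk Jj atK atJ n1 kH jH _ _ _ hyp.
- by move=> t /nin ot; rewrite !not_in.
- move=> t /andP[t0 t1]; have tin : (1 <= t <= a1)%N by rewrite t0 ltnW.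
  have t1in : (1 <= t.+1 <= a1)%N by rewrite t1.
  have [_ Sv hv] := st1 _ (Ho t); have /det_neq[_ _ tt] : det H (o t) (o t.+1) != 0 by rewrite hv.
  move=> d; apply: (dead_chord ls nch (Ho t) (Ho t.+1) _ hv) => //.
  + by apply: (@tri_linked (ctgt (D (o t)))); rewrite // Sv !inE eqxx ?orbT.
  + exact: nin.
  + exact: (nin t.+1).
by rewrite -sjk st2.
Qed.

Lemma k4_checks : k4_check (1, 1) (2, 1) (1, 2).
Proof. by vm_compute. Qed.

(** * Edges of the triangulation through the midpoints of the inner segments *)

Definition half_point_pairs (m : nat * nat) :=
  [seq s <- [seq (a, b) | a <- points, b <- points] | [&& (s.1.1 + s.2.1 == m.1)%N,
    (s.1.2 + s.2.2 == m.2)%N & coprimez (s.2.1%:Z - s.1.1%:Z) (s.2.2%:Z - s.1.2%:Z)]].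

(** Half of [m] lies in the big triangle by the bound 8, and an odd coordinate keeps it from being a
    lattice point, so it is the midpoint of a proper edge. *)
Lemma half_point_linked m : odd m.1 || odd m.2 -> (m.1 + m.2 <= 8)%N ->
  exists p q, linked X p q /\ (nc p, nc q) \in half_point_pairs m.
Proof.
move=> om m8; have [|p [q [e pq]]] := @half_point_edge R 4 X triX (m.1%:Z, m.2%:Z).
  split=> /=; rewrite ?divr_ge0 ?ler0z //.
  rewrite -mulrDl ler_pdivrMr ?ltr0n // -!pmulrn -natrD -natrM ler_nat //.
have [e1 e2] : ((nc p).1 + (nc q).1 = m.1)%N /\ ((nc p).2 + (nc q).2 = m.2)%N.
  by case: e => -[e1] [e2]; split.
exists p, q; case: pq => [pq|pq].
  by move: om; rewrite -e1 -e2 pq !addnn !odd_double.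
split=> //; rewrite mem_filter e1 e2 !eqxx; apply/andP; split.
  exact: (linked_primitive triX pq).
by apply/allpairsP; exists (nc p, nc q); rewrite !nc_points.
Qed.

(** The sums [(3, 2)], [(2, 3)] and [(3, 3)] are twice the midpoints of the three inner segments,
    and each of the three segments treated in [hub_checks] passes through one of these midpoints. *)
Lemma half_point_options : all (fun s => all (fun s' => all (fun s'' =>
    [|| has (mem [:: ((1, 1), (2, 2)); ((2, 2), (1, 1)); ((2, 1), (0, 2)); ((0, 2), (2, 1));
          ((1, 2), (2, 0)); ((2, 0), (1, 2))]) [:: s; s'; s''],
      [&& perm_eq [:: s.1; s.2] [:: (1, 1); (2, 1)], perm_eq [:: s'.1; s'.2] [:: (1, 1); (1, 2)]
        & perm_eq [:: s''.1; s''.2] [:: (2, 1); (1, 2)]],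
      ncross s.1 s.2 s'.1 s'.2, ncross s.1 s.2 s''.1 s''.2 | ncross s'.1 s'.2 s''.1 s''.2])
  (half_point_pairs (3, 3))) (half_point_pairs (2, 3))) (half_point_pairs (3, 2)).
Proof. by vm_compute. Qed.

Lemma skeleton_not_hyperelliptic : ~ hyperelliptic G.
Proof.
move=> hyp.
have hub h a j k b p q : hub_check h a j k b -> j \in points -> k \in points ->
    linked X p q -> (nc p, nc q) = (h, a) \/ (nc p, nc q) = (a, h) -> False.
  move=> chk /nc_onto[j' ej] /nc_onto[k' ek] pq [] [eh ea]; rewrite -eh -ea -ej -ek in chk.
    exact: hub_contradiction hyp pq chk.
  by rewrite linked_sym in pq; apply: hub_contradiction hyp pq chk.
have no_hub p q : linked X p q -> (nc p, nc q) \notin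
    [:: ((1, 1), (2, 2)); ((2, 2), (1, 1)); ((2, 1), (0, 2)); ((0, 2), (2, 1));
        ((1, 2), (2, 0)); ((2, 0), (1, 2))]%N.
  move=> pq; have [h1 h2 h3] := hub_checks; apply/negP.
  rewrite !inE => /or4P[/eqP e|/eqP e|/eqP e|/or3P[/eqP e|/eqP e|/eqP e]].
  - exact: (@hub _ _ _ _ _ p q h1 isT isT pq (or_introl e)).
  - exact: (@hub _ _ _ _ _ p q h1 isT isT pq (or_intror e)).
  - exact: (@hub _ _ _ _ _ p q h2 isT isT pq (or_introl e)).
  - exact: (@hub _ _ _ _ _ p q h2 isT isT pq (or_intror e)).
  - exact: (@hub _ _ _ _ _ p q h3 isT isT pq (or_introl e)).
  - exact: (@hub _ _ _ _ _ p q h3 isT isT pq (or_intror e)).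
have [p [q [pq s1]]] := @half_point_linked (3, 2) isT isT.
have [p' [q' [pq' s2]]] := @half_point_linked (2, 3) isT isT.
have [p'' [q'' [pq'' s3]]] := @half_point_linked (3, 3) isT isT.
have := half_point_options => /allP/(_ _ s1)/allP/(_ _ s2)/allP/(_ _ s3).
rewrite /has !topredE (negbTE (no_hub _ _ pq)) (negbTE (no_hub _ _ pq')) (negbTE (no_hub _ _ pq'')) /=.
have no_cross a b a' b' : linked X a b -> linked X a' b' ->
    ncross (nc a) (nc b) (nc a') (nc b') = false.
  by move=> ab ab'; apply/negbTE/(linked_no_cross triX ab ab').
rewrite !no_cross // !orbF.
have [H eH] : exists H, nc H = (1, 1)%N by exact: nc_onto.
have [j ej] : exists j, nc j = (2, 1)%N by exact: nc_onto.
have [k ek] : exists k, nc k = (1, 2)%N by exact: nc_onto.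
rewrite -eH -ej -ek => /and3P[e1 e2 e3].
have same a b z t : linked X a b -> perm_eq [:: nc a; nc b] [:: nc z; nc t] -> z != t -> linked X z t.
  move=> ab /perm_mem e zt; have := e (nc z); have := e (nc t).
  rewrite !inE !(inj_eq nc_inj) !eqxx ?orbT => /orP[]/eqP te /orP[]/eqP ze.
  - by rewrite te ze eqxx in zt.
  - by rewrite te ze linked_sym.
  - by rewrite te ze.
  - by rewrite te ze eqxx in zt.
have neq z t : nc z != nc t -> z != t by rewrite (inj_eq nc_inj).
apply: (k4_contradiction hyp (same _ _ _ _ pq e1 _) (same _ _ _ _ pq' e2 _) (same _ _ _ _ pq'' e3 _));
  first [by rewrite eH ej ek; exact: k4_checks | by apply: neq; rewrite ?eH ?ej ?ek].
Qed.

End Skeleton.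

End Dual.

Theorem theorem4p3 (R : realType) (C : plane_graph R) :
  smooth_of_degree 4 C -> ~ hyperelliptic (skeleton C).
Proof.
case=> -[prim _ _ _] [X triX [dual [_ [[dual_inj dual_v dual_e _] [inc _] [ns nt _] _ _]]]].
apply: (skeleton_not_hyperelliptic triX _ dual_inj dual_v dual_e inc ns nt) => e.
by have [] := prim e.
Qed.
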